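(* Let $q\ge3$ and $\delta\ge1$ be fixed, and let $G$ be uniformly random in $\mathbb G^q_{n,\delta}$ (or uniformly random in $\tilde{\mathbb G}^q_{n,\delta}$). Then, with probability tending to $1$ as $n\to\infty$, $G$ is an SYK graph (so that it represents a unicellular space, i.e. $G_{\hat 0}$ is connected) and the $(q-1)$-dimensional colored triangulation $\mathcal T(G_{\hat 0})$ dual to $G_{\hat 0}$ is a piecewise-linear manifold.
   Context: Fix an integer $q\ge 2$. A $(q+1)$-edge-colored graph (colored graph) is a finite connected graph, multiple edges allowed and no loops, whose edges carry colors in $\{0,1,\dots,q\}$ such that every vertex is incident to exactly one edge of each color. It is rooted if one color-0 edge is distinguished and oriented; it is bipartite if its vertices can be colored black and white so that every edge joins a black and a white vertex, with the convention that the origin of the root edge is black. $\tilde{\mathbb G}^q$ denotes the set of rooted colored graphs and $\mathbb G^q\subset\tilde{\mathbb G}^q$ the set of bipartite ones. For $i\in\{1,\dots,q\}$, a color-$0i$ cycle is a connected component of the subgraph formed by the edges of colors $0$ and $i$; $F_0(G)$ is the total number of such cycles over all $i$. The order of $G$ is $\delta_0(G)=1+\frac{q-1}{2}V(G)-F_0(G)$. $G_{\hat 0}$ denotes the graph obtained from $G$ by deleting all color-0 edges; $G$ is an SYK graph if $G_{\hat 0}$ is connected. $\mathbb G^q_{n,\delta}$ (resp. $\tilde{\mathbb G}^q_{n,\delta}$) is the set of graphs in $\mathbb G^q$ (resp. $\tilde{\mathbb G}^q$) with $2n$ vertices and order $\delta$. Dual triangulation: for a connected graph $H$ in which every vertex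 has exactly one incident edge of each color of a set $A$ with $|A|=k$, the dual $(k-1)$-dimensional colored triangulation $\mathcal T(H)$ is obtained by taking, for each vertex of $H$, a $(k-1)$-simplex whose vertices are labelled bijectively by $A$, and, for each edge of color $a$ of $H$, identifying the facets opposite to the vertex labelled $a$ in the simplices of its two endpoints, matching vertices with equal labels. *)

(* Defs.v *)
From HB Require Import structures.
From mathcomp Require Import all_boot all_order all_algebra.
Set Implicit Arguments. Unset Strict Implicit. Unset Printing Implicit Defensive.
Import Order.TTheory GRing.Theory Num.Theory.

Definition is_complex (X : finType) (K : {set {set X}}) : bool :=
  (set0 \in K) && [forall s in K, forall t : {set X}, (t \subset s) ==> (t \in K)].

Definition link (X : finType) (K : {set {set X}}) (sigma : {set X}) : {set {set X}} :=
  [set t in K | [disjoint t & sigma] && ((t :|: sigma) \in K)].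

(* stellar subdivision of K at the face sigma; the new vertex is None:
   (K minus the open star of sigma) union (None * boundary(sigma) * lk(sigma)) *)
Definition stellar (X : finType) (K : {set {set X}}) (sigma : {set X})
  : {set {set option X}} :=
  [set (@Some X) @: t | t : {set X} in [set t in K | ~~ (sigma \subset t)]] :|:
  [set None |: ((@Some X) @: (a :|: b))
     | a : {set X} in [set a : {set X} | a \proper sigma], b : {set X} in link K sigma].

(* combinatorial equivalence (= PL homeomorphism, Alexander-Newman):
   equivalence relation generated by isomorphisms and stellar subdivisions *)
Inductive comb_equiv : forall (X Y : finType), {set {set X}} -> {set {set Y}} -> Prop :=
| CE_iso (X Y : finType) (f : X -> Y) (K : {set {set X}}) :
    is_complex K -> injective f -> comb_equiv K [set f @: t | t : {set X} in K]
| CE_stellar (X : finType) (K : {set {set X}}) (sigma : {set X}) :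
    is_complex K -> sigma \in K -> sigma != set0 -> comb_equiv K (stellar K sigma)
| CE_sym (X Y : finType) (K : {set {set X}}) (L : {set {set Y}}) :
    comb_equiv K L -> comb_equiv L K
| CE_trans (X Y Z : finType) (K : {set {set X}}) (L : {set {set Y}}) (M : {set {set Z}}) :
    comb_equiv K L -> comb_equiv L M -> comb_equiv K M.

Definition simplex_boundary (d : nat) : {set {set 'I_d.+2}} :=
  [set t : {set 'I_d.+2} | t != setT].

Definition pl_sphere (d : nat) (X : finType) (K : {set {set X}}) : Prop :=
  comb_equiv (simplex_boundary d) K.

Definition pl_manifold (d : nat) (X : finType) (K : {set {set X}}) : Prop :=
  is_complex K /\ forall v : X, [set v] \in K -> pl_sphere d.-1 (link K [set v]).

(* The edges of colour c are encoded by the map s c : 'I_N -> 'I_N,    *)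
(* which must be a fixed-point-free involution (a perfect matching).  *)

Definition cgraph (q N : nat) := {ffun 'I_q.+1 -> {ffun 'I_N -> 'I_N}}.

Definition adjA (q N : nat) (s : cgraph q N) (A : {set 'I_q.+1}) : rel 'I_N :=
  fun x y => [exists c in A, s c x == y].

Definition connectedA (q N : nat) (s : cgraph q N) (A : {set 'I_q.+1}) : bool :=
  [forall x, forall y, connect (adjA s A) x y].

Definition is_colored_graph (q N : nat) (s : cgraph q N) : bool :=
  [forall c, forall x, (s c (s c x) == x) && (s c x != x)] && connectedA s setT.

Definition is_bipartite (q N : nat) (s : cgraph q N) : bool :=
  [exists b : {ffun 'I_N -> bool}, [forall c, forall x, b (s c x) != b x]].

Definition ncomp (q N : nat) (s : cgraph q N) (A : {set 'I_q.+1}) : nat :=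
  #|[set [set y | connect (adjA s A) x y] | x : 'I_N]|.

(* F_0 : total number of colour-0i cycles, i = 1..q *)
Definition F0 (q N : nat) (s : cgraph q N) : nat :=
  \sum_(i < q.+1 | i != ord0) ncomp s [set ord0; i].

(* order delta_0 = 1 + (q-1)/2 * V - F_0, with V = 2n vertices *)
Definition graph_order (q n : nat) (s : cgraph q (2 * n)) : int :=
  Posz (1 + (q - 1) * n) - Posz (F0 s).

Definition nonzero_colors (q : nat) : {set 'I_q.+1} := [set c | c != ord0].

Definition is_SYK (q N : nat) (s : cgraph q N) : bool :=
  connectedA s (nonzero_colors q).

(* A face of T(H) (H = G_{\hat 0}, colour set A = {1..q}) with vertex  *)
(* colours B (nonempty, B \subset A) is a connected component S of the *)
(* subgraph of H with colours A \ B.  Faces are ordered by             *)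
(* (B,S) <= (B',S') iff B \subset B' and S' \subset S.  Since all the  *)
(* vertices of a simplex of T(H) carry distinct colours, T(H) is a     *)
(* regular cell complex and its PL structure is that of its first      *)
(* barycentric subdivision = order complex of this face poset.         *)

Definition tface (q N : nat) := ({set 'I_q.+1} * {set 'I_N})%type.

Definition is_face (q N : nat) (s : cgraph q N) (F : tface q N) : bool :=
  [&& F.1 != set0, F.1 \subset nonzero_colors q &
      [exists x, F.2 == [set y | connect (adjA s (nonzero_colors q :\: F.1)) x y]]].

Definition face_le (q N : nat) (F F' : tface q N) : bool :=
  (F.1 \subset F'.1) && (F'.2 \subset F.2).

Definition bary_T0 (q N : nat) (s : cgraph q N) : {set {set tface q N}} :=
  [set C : {set tface q N} | [forall F in C, is_face s F] &&
     [forall F in C, forall F' in C, face_le F F' || face_le F' F]].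

(* Part 4: the sets G^q_{n,delta} (bip = true) and tilde G^q_{n,delta}  *)
(* (bip = false), as labelled rooted graphs (s, r): r is the origin of *)
(* the root colour-0 edge.                                             *)

Definition rooted_graph (q n : nat) := (cgraph q (2 * n) * 'I_(2 * n))%type.

Definition Gset (q n delta : nat) (bip : bool) : {set rooted_graph q n} :=
  [set G : rooted_graph q n | [&& is_colored_graph G.1, bip ==> is_bipartite G.1 &
                           graph_order G.1 == Posz delta]].

Definition good_graph (q n : nat) (G : rooted_graph q n) : Prop :=
  is_SYK G.1 /\ pl_manifold q.-1 (bary_T0 G.1).

(* Main.v *)
(** Write [X_d] for the set of graphs of order [d]. The incidence graph between
    the colour-0 edges and the 0c-cycles of a connected graph has first Betti
    number equal to the order, so graphs of order 0 are trees. Cutting a 0-edge out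
    of a 0c-cycle (leaving a melon there) without disconnecting the graph lowers the
    order by one, and inserting it again at another edge of colour [c] is the
    inverse operation; thus [X_{d+1}] is obtained from [X_d] by insertions.

    If for every colour [i != 0] the graph without the colour [i] is a forest,
    then every residue is built from melons by leaf insertions, which are
    sequences of stellar moves; hence all links are spheres and the graph without
    the colour 0 is connected. The other graphs of [X_{d+1}] have a cuttable
    0-edge whose insertion point lies in a component of the cut graph avoiding a
    colour [i]. In a random tree on [n] 0-edges such components have size
    [n^o(1)] and the height is at most [n^{2/3+o(1)}]. A graph of [X_d] over such
    a tree thus has about [n^2] insertions, of which only [n^{1+o(1)}] are bad, and
    a graph of [X_{d+1}] over such a tree has only [n^{2/3+o(1)}] cuttable
    0-edges, since they all lie on the branches from the root to the boundedly
    many modified vertices. Comparing both counts, bad graphs have density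
    [n^{-1/3+o(1)}] at most. *)

Require Import Defs.
From HB Require Import structures.
From mathcomp Require Import all_boot all_order all_algebra.
From mathcomp Require Import zify ring lra.
Set Implicit Arguments. Unset Strict Implicit. Unset Printing Implicit Defensive.
Import Order.TTheory GRing.Theory Num.Theory.

(** * Cutting and inserting 0-edges *)

(** No asymptotic enumeration enters: every estimate is a ratio of counts, and polynomial losses are
    harmless. Trees are bounded from above by words, counted by the binomials [wordnum], which
    overshoot by a factor [n] only. The exceptional trees (too high, or with a large component
    avoiding a colour) have a share exponentially small in [u], where [n] is about [u ^ 6]. This
    absorbs the factor [n], the choice of a vertex and a colour, and a crude bound of order [n ^ 2]
    on the insertions at each of the boundedly many levels above an exceptional tree. Sharper
    counting is needed only for the last step, from order [d] to order [d + 1] over ordinary trees.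
    On the topological side the equivalence is generated by isomorphisms and stellar moves alone, so
    a melon insertion has to be decomposed into explicit ones. The complexes of faces are treated as
    clique complexes, and the moves on them are subdivisions of edges: such a move yields a clique
    complex again, and it is verified on adjacencies. *)

Definition ncls (V : finType) (R : rel V) : nat :=
  #|[set [set y | R x y] | x : V]|.

Section Classes.
Variable V : finType.
Implicit Types R : rel V.

Lemma eq_ncls R R' : R =2 R' -> ncls R = ncls R'.
Proof.
move=> eqR; rewrite /ncls; congr #|pred_of_set _|.
by apply: eq_imset => x; apply/setP=> y; rewrite !inE eqR.
Qed.

Lemma cls_eq R : equivalence_rel R -> forall x y,
  ([set z | R x z] == [set z | R y z]) = R x y.
Proof.
move=> eqR x y; apply/eqP/idP => [/setP/(_ y)|Rxy].
  by rewrite !inE => ->; have [-> _] := eqR y y y.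
apply/setP=> z; rewrite !inE.
by have [_ ->] := eqR x y z.
Qed.

Lemma sum_cls R (g : V -> nat) : equivalence_rel R ->
  \sum_x g x = \sum_(O in [set [set y | R x y] | x : V]) \sum_(x in O) g x.
Proof.
move=> eqR.
have Rxx x : R x x by have [-> _] := eqR x x x.
rewrite (partition_big (fun x => [set y | R x y])
          [in [set [set y | R x y] | x : V]]) /=; last first.
  by move=> x _; apply: imset_f.
apply: eq_bigr => O /imsetP[x _ ->]; apply: eq_bigl => y.
rewrite inE cls_eq //; apply/idP/idP => r.
  by have [_ /(_ r)] := eqR y x y; rewrite Rxx.
by have [_ /(_ r)] := eqR x y x; rewrite Rxx.
Qed.

(** Sending a class of [R'] to the class of [R] around it is onto, and it identifies the two classes
    that only [R'] separates. *)
Lemma ncls_strict R R' : equivalence_rel R -> equivalence_rel R' ->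
  (forall x y, R' x y -> R x y) -> (exists x y, R x y && ~~ R' x y) ->
  ncls R < ncls R'.
Proof.
move=> eqR eqR' sub [a [b /andP[Rab nR'ab]]].
have Rxx x : R x x by have [-> _] := eqR x x x.
have R'xx x : R' x x by have [-> _] := eqR' x x x.
pose f (O : {set V}) := if [pick x in O] is Some x then [set y | R x y] else set0.
have fE x : f [set y | R' x y] = [set y | R x y].
  rewrite /f; case: pickP => [z|/(_ x)]; last by rewrite inE R'xx.
  by rewrite inE => /sub Rxz; apply/eqP; rewrite eq_sym cls_eq.
rewrite /ncls.
have -> : [set [set y | R x y] | x : V] = f @: [set [set y | R' x y] | x : V].
  by rewrite -imset_comp; apply: eq_imset => x /=; rewrite fE.
rewrite ltn_neqAle leq_imset_card andbT; apply/negP => /imset_injP inj.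
have h := inj [set y | R' a y] [set y | R' b y] (imset_f _ isT) (imset_f _ isT).
move/negP: nR'ab; apply; rewrite -(cls_eq eqR'); apply/eqP/h.
by rewrite !fE; apply/eqP; rewrite cls_eq.
Qed.

(** Removing [W] is a bijection from the classes of [R] to the classes of [R'] other than [W]: the
    class around [W] also contains [x], so it does not vanish. *)
Lemma ncls_split R R' (W : {set V}) w x :
  equivalence_rel R -> w \in W -> x \notin W -> R w x ->
  (forall u v, u \in W -> v \in W -> R u v) ->
  (forall u v, R' u v = if u \in W then v \in W else (v \notin W) && R u v) ->
  ncls R' = (ncls R).+1.
Proof.
move=> eqR Ww Wx Rwx RW R'E.
have Rxx y : R y y by have [-> _] := eqR y y y.
have Rsym u v : R u v = R v u.
  apply/idP/idP => r; first by have [_ /(_ r)] := eqR u v u; rewrite Rxx.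
  by have [_ /(_ r)] := eqR v u v; rewrite Rxx.
have Rtr u v z : R u v -> R v z -> R u z by move=> r; have [_ ->] := eqR u v z.
pose f (O : {set V}) := O :\: W.
have fO y : y \notin W -> f [set z | R y z] = [set z | R' y z].
  by move=> Wy; apply/setP=> z; rewrite !inE R'E (negPf Wy).
have rep (O : {set V}) : O \in [set [set y | R x y] | x : V] ->
    exists2 y, y \notin W & O = [set z | R y z].
  case/imsetP=> y _ ->; have [Wy|Wy] := boolP (y \in W); last by exists y.
  exists x => //; apply/eqP; rewrite cls_eq //.
  by apply: Rtr Rwx; apply: RW.
have WE : [set z | R' w z] = W by apply/setP=> z; rewrite inE R'E Ww.
rewrite /ncls.
have -> : [set [set y | R' x y] | x : V] = W |: (f @: [set [set y | R x y] | x : V]).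
  apply/setP=> O; rewrite !inE; apply/imsetP/orP.
  - case=> y _ ->; have [Wy|Wy] := boolP (y \in W).
      by left; apply/eqP/setP=> z; rewrite inE R'E Wy.
    by right; rewrite -fO //; apply/imset_f/imset_f.
  - case=> [/eqP->|/imsetP[O1 /rep[y Wy ->] ->]]; first by exists w; rewrite ?WE.
    by exists y; rewrite ?fO.
rewrite cardsU1 card_in_imset ?add1n; last first.
  move=> O1 O2 /rep[y1 Wy1 ->] /rep[y2 Wy2 ->]; rewrite !fO // => /setP/(_ y2).
  rewrite !inE !R'E (negPf Wy1) (negPf Wy2) /= Rxx => r.
  by apply/eqP; rewrite cls_eq.
suff -> : W \notin f @: [set [set y | R x y] | x : V] by [].
by apply/negP => /imsetP[O1 _ /setP/(_ w)]; rewrite !inE Ww.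
Qed.

End Classes.

Section Graph.
Variables (q N : nat).
Implicit Types (s : cgraph q N) (A : {set 'I_q.+1}).

Definition matched s := [forall c, forall x, (s c (s c x) == x) && (s c x != x)].

Lemma matchedK s c : matched s -> involutive (s c).
Proof. by move=> /forallP/(_ c)/forallP h x; have /andP[/eqP] := h x. Qed.

Lemma matched_neq s c x : matched s -> s c x != x.
Proof. by move=> /forallP/(_ c)/forallP/(_ x)/andP[]. Qed.

Definition conn s A : rel 'I_N := connect (adjA s A).

Lemma ncompE s A : ncomp s A = ncls (conn s A).
Proof. by []. Qed.

Lemma conn_refl s A x : conn s A x x. Proof. exact: connect0. Qed.

Lemma conn_trans s A x y z : conn s A x y -> conn s A y z -> conn s A x z.
Proof. exact: connect_trans. Qed.

Lemma conn_step s A c x : c \in A -> conn s A x (s c x).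
Proof. by move=> cA; apply: connect1; apply/existsP; exists c; rewrite cA eqxx. Qed.

Lemma conn_sym s A : matched s -> symmetric (conn s A).
Proof.
move=> ms; apply: sym_connect_sym => x y.
by apply/existsP/existsP => -[c /andP[cA /eqP<-]]; exists c; rewrite cA matchedK ?eqxx.
Qed.

Lemma conn_equiv s A : matched s -> equivalence_rel (conn s A).
Proof.
move=> ms; apply/equivalence_relP; split; first exact: conn_refl.
by move=> x y xy z; apply/idP/idP; apply: conn_trans => //; rewrite conn_sym.
Qed.

(** Inclusions of connectivity into a transitive relation are checked on single edges. [R] takes
    values in [Prop], so that implications between memberships qualify. *)
Lemma conn_min s A (R : 'I_N -> 'I_N -> Prop) x y :
  (forall z, R z z) -> (forall u v z, R u v -> R v z -> R u z) ->
  (forall z c, c \in A -> R z (s c z)) -> conn s A x y -> R x y.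
Proof.
move=> R0 Rt R1 /connectP[p pp ->]; elim: p x pp => [|z p IH] x //= /andP[e pp].
by case/existsP: e => c /andP[cA /eqP e]; apply: Rt (IH _ pp); rewrite -e; apply: R1.
Qed.

Lemma conn_closed s A (S : {set 'I_N}) x y :
  (forall z c, z \in S -> c \in A -> s c z \in S) -> x \in S -> conn s A x y -> y \in S.
Proof.
move=> cl Sx xy; move: Sx; apply: (conn_min (R := fun x y => x \in S -> y \in S)) xy => //.
- by move=> u v z h1 h2 /h1/h2.
- by move=> z c cA Sz; apply: cl.
Qed.

Lemma conn_sub s s' A A' : (forall z c, c \in A -> conn s' A' z (s c z)) ->
  forall x y, conn s A x y -> conn s' A' x y.
Proof.
move=> h x y; apply: (conn_min (R := conn s' A')) => // [z|u v z]; first exact: conn_refl.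
exact: conn_trans.
Qed.

Lemma conn_subset s A A' x y : A \subset A' -> conn s A x y -> conn s A' x y.
Proof. by move=> /subsetP sA; apply: conn_sub => z c /sA cA; apply: conn_step. Qed.

Lemma conn_eqs s s' A : (forall c, c \in A -> s c = s' c) -> conn s A =2 conn s' A.
Proof.
by move=> h x y; apply/idP/idP; apply: conn_sub => z c cA; [rewrite h//|rewrite -h//]; apply: conn_step.
Qed.

(* [cut s w c] removes the 0-edge [w, w'] from its 0c-cycle: [w] and [w'] become
   joined by colour [c], and so do their former neighbours [x] and [y].
   [ins s w c x] puts it back between [x] and [s c x], with [w] next to [x]; it
   expects [w] and [s ord0 w] to be joined by colour [c]. *)
Definition cut s (w : 'I_N) (c : 'I_q.+1) : cgraph q N :=
  [ffun c' => if c' == c then [ffun z =>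
     if z == w then s ord0 w else if z == s ord0 w then w
     else if z == s c w then s c (s ord0 w)
     else if z == s c (s ord0 w) then s c w else s c z] else s c'].

Definition ins s (w : 'I_N) (c : 'I_q.+1) (x : 'I_N) : cgraph q N :=
  [ffun c' => if c' == c then [ffun z =>
     if z == w then x else if z == s ord0 w then s c x
     else if z == x then w
     else if z == s c x then s ord0 w else s c z] else s c'].

(** The 0c-cycle through [w] has length two: in the incidence graph it is a node of degree one
    hanging from the 0-edge of [w]. *)
Definition fixedc s (c : 'I_q.+1) (w : 'I_N) := s c w == s ord0 w.

Lemma cut_other s w c c' : c' != c -> cut s w c c' = s c'.
Proof. by move=> h; rewrite ffunE (negPf h). Qed.

Lemma ins_other s w c x c' : c' != c -> ins s w c x c' = s c'.
Proof. by move=> h; rewrite ffunE (negPf h). Qed.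

Lemma cutE s w c z : cut s w c c z =
  if z == w then s ord0 w else if z == s ord0 w then w
  else if z == s c w then s c (s ord0 w)
  else if z == s c (s ord0 w) then s c w else s c z.
Proof. by rewrite /cut ffunE eqxx ffunE. Qed.

Lemma insE s w c x z : ins s w c x c z =
  if z == w then x else if z == s ord0 w then s c x
  else if z == x then w else if z == s c x then s ord0 w else s c z.
Proof. by rewrite /ins ffunE eqxx ffunE. Qed.

Section CutIns.
Variables (s : cgraph q N) (w : 'I_N) (c : 'I_q.+1).
Hypotheses (ms : matched s) (c0 : c != ord0).

Lemma fixedcC : fixedc s c (s ord0 w) = fixedc s c w.
Proof.
rewrite /fixedc matchedK //; apply/eqP/eqP => h; last by rewrite -h matchedK.
by rewrite -[in LHS]h matchedK.
Qed.

Lemma cutw : cut s w c c w = s ord0 w.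
Proof. by rewrite cutE eqxx. Qed.

Lemma cutw' : cut s w c c (s ord0 w) = w.
Proof. by rewrite cutE eqxx (negPf (matched_neq _ _ ms)). Qed.

Lemma cut0 : cut s w c ord0 = s ord0.
Proof. by rewrite cut_other // eq_sym. Qed.

Lemma ins0 x : ins s w c x ord0 = s ord0.
Proof. by rewrite ins_other // eq_sym. Qed.

Lemma fixed_cut : fixedc (cut s w c) c w.
Proof. by rewrite /fixedc cutw cut0. Qed.

Section Cut.
Hypothesis nf : ~~ fixedc s c w.
Let w' := s ord0 w.
Let x := s c w.
Let y := s c w'.

Lemma cut_neqs : [/\ w' != w, x != w, x != w', y != w & y != w'].
Proof.
rewrite !matched_neq //; split=> //.
by apply: contra nf => /eqP h; rewrite /fixedc -{1}h /y matchedK.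
Qed.

Lemma cutx : cut s w c c x = y.
Proof.
have [_ /negPf h1 /negPf h2 _ _] := cut_neqs.
by rewrite cutE h1 h2 eqxx.
Qed.

Lemma cuty : cut s w c c y = x.
Proof.
have [h0 h1 h2 /negPf h3 /negPf h4] := cut_neqs.
rewrite cutE h3 h4; case: eqP => [e|_]; last by rewrite eqxx.
exact: e.
Qed.

Lemma cut_else z : z != w -> z != w' -> z != x -> z != y -> cut s w c c z = s c z.
Proof. by move=> /negPf h1 /negPf h2 /negPf h3 /negPf h4; rewrite cutE h1 h2 h3 h4. Qed.

Lemma matched_cut : matched (cut s w c).
Proof.
have [h0 h1 h2 h3 h4] := cut_neqs.
apply/forallP=> c'; apply/forallP=> z.
have [->{c'}|c'c] := eqVneq c' c; last by rewrite cut_other // matchedK // eqxx matched_neq.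
have [->|zw] := eqVneq z w; first by rewrite cutw cutw' eqxx.
have [->|zw'] := eqVneq z w'; first by rewrite cutw' cutw eqxx eq_sym.
have xy : x != y.
  by rewrite /x /y (can_eq (matchedK c ms)) eq_sym.
have [->|zx] := eqVneq z x; first by rewrite cutx cuty eqxx eq_sym.
have [->|zy] := eqVneq z y; first by rewrite cuty cutx eqxx.
rewrite (cut_else zw zw' zx zy) matched_neq // andbT.
have e1 : s c z != w by apply: contra zx => /eqP h; rewrite /x -h matchedK.
have e2 : s c z != w' by apply: contra zy => /eqP h; rewrite /y -h matchedK.
have e3 : s c z != x by apply: contra zw => /eqP/(can_inj (matchedK c ms))->.
have e4 : s c z != y by apply: contra zw' => /eqP/(can_inj (matchedK c ms))->.
by rewrite (cut_else e1 e2 e3 e4) matchedK.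
Qed.

Lemma cutK : ins (cut s w c) w c x = s.
Proof.
have [h0 h1 h2 h3 h4] := cut_neqs.
apply/ffunP=> c'; apply/ffunP=> z.
have [->{c'}|c'c] := eqVneq c' c; last by rewrite ins_other // cut_other.
rewrite insE cut0 cutx -/w'.
case: eqP => [->//|/eqP zw]; case: eqP => [->//|/eqP zw'].
case: eqP => [->|/eqP zx]; first by rewrite /x matchedK.
case: eqP => [->|/eqP zy]; first by rewrite /y matchedK.
exact: cut_else.
Qed.

(* Paths through the 0-edge of [w] are rerouted along the new edge [x y]. *)
Lemma conn_cut_leaf A u v : c \in A ->
  (forall c', c' \in A -> c' != c -> fixedc s c' w) ->
  (exists2 c1, c1 \in A & c1 != c) ->
  conn (cut s w c) A u v =
  if u \in [set w; w'] then v \in [set w; w'] else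
  (v \notin [set w; w']) && conn s A u v.
Proof.
move=> Ac hA [c1 Ac1 c1c].
have [h0 h1 h2 h3 h4] := cut_neqs.
have mc := matched_cut.
have sw c' : c' \in A -> c' != c -> s c' w = w' by move=> /hA h /h/eqP.
have sw' c' : c' \in A -> c' != c -> s c' w' = w.
  by move=> /hA h /h; rewrite /w' => /eqP <-; rewrite matchedK.
have sW c' z : c' \in A -> c' != c -> (s c' z \in [set w; w']) = (z \in [set w; w']).
  move=> c'A c'c; rewrite !inE orbC; congr (_ || _).
    by rewrite -(sw c') // (can_eq (matchedK c' ms)).
  by rewrite -(sw' c') // (can_eq (matchedK c' ms)).
have cW z : (cut s w c c z \in [set w; w']) = (z \in [set w; w']).
  suff h t : t \in [set w; w'] -> cut s w c c t \in [set w; w'].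
    by apply/idP/idP => [/h|/h//]; rewrite matchedK.
  by rewrite !inE => /orP[]/eqP->; rewrite ?cutw ?cutw' eqxx ?orbT.
have cutW z c' : c' \in A -> (cut s w c c' z \in [set w; w']) = (z \in [set w; w']).
  move=> c'A; have [->|c'c] := eqVneq c' c; first exact: cW.
  by rewrite cut_other // sW.
have clW z c' : z \in [set w; w'] -> c' \in A -> cut s w c c' z \in [set w; w'].
  by move=> zW c'A; rewrite cutW.
have clW' z c' : z \in ~: [set w; w'] -> c' \in A -> cut s w c c' z \in ~: [set w; w'].
  by rewrite !in_setC => zW c'A; rewrite cutW.
have ww' : conn (cut s w c) A w w' by rewrite /w' -cutw; apply: conn_step.
have xy : conn (cut s w c) A x y by rewrite -cutx; apply: conn_step.
have yx : conn (cut s w c) A y x by rewrite conn_sym.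
pose rho z := if z == w then x else if z == w' then y else z.
have rho_id z : z \notin [set w; w'] -> rho z = z.
  by rewrite !inE negb_or /rho => /andP[/negPf-> /negPf->].
case: ifPn => uW.
  apply/idP/idP => [|vW]; first exact: conn_closed.
  move: uW vW; rewrite !inE => /orP[]/eqP-> /orP[]/eqP->; rewrite ?conn_refl //.
  by rewrite conn_sym.
apply/idP/andP => [uv|[vW uv]].
  split.
    by move: uv => /(conn_closed clW'); rewrite !in_setC uW; apply.
  move: uv; apply: conn_sub => z c' c'A.
  have Rs t c2 : c2 \in A -> conn s A t (s c2 t) by apply: conn_step.
  have [->|c'c] := eqVneq c' c; last by rewrite cut_other //; apply: Rs.
  have Ryx : conn s A y x.
    apply: (conn_trans (y := w')); first by rewrite conn_sym //; apply: Rs.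
    by apply: (conn_trans (y := w)); [rewrite -(sw' c1) //; apply: Rs | apply: Rs].
  have [->|zw] := eqVneq z w; first by rewrite cutw -/w' -(sw c1) //; apply: Rs.
  have [->|zw'] := eqVneq z w'; first by rewrite cutw' -(sw' c1) //; apply: Rs.
  have [->|zx] := eqVneq z x; first by rewrite cutx conn_sym.
  have [->|zy] := eqVneq z y; first by rewrite cuty.
  by rewrite cut_else //; apply: Rs.
rewrite -(rho_id u) // -(rho_id v) //.
apply: (conn_min (R := fun u v => conn (cut s w c) A (rho u) (rho v))) uv.
- by move=> z; apply: conn_refl.
- by move=> a b z; apply: conn_trans.
move=> z c' c'A.
have [->{c' c'A}|c'c] := eqVneq c' c; last first.
  have [->|zw] := eqVneq z w; first by rewrite sw // /rho eqxx (negPf h0) eqxx.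
  have [->|zw'] := eqVneq z w'; first by rewrite sw' // /rho eqxx (negPf h0) eqxx.
  rewrite !rho_id ?sW // ?inE ?negb_or ?zw //.
  by rewrite -(cut_other s w c'c); apply: conn_step.
have [->|zw] := eqVneq z w.
  by rewrite /rho eqxx -/x (negPf h1) (negPf h2) conn_refl.
have [->|zw'] := eqVneq z w'.
  by rewrite /rho -/y (negPf h0) eqxx (negPf h3) (negPf h4) conn_refl.
have [->|zx] := eqVneq z x.
  by rewrite /x matchedK // /rho eqxx (negPf h1) -/x (negPf h2) conn_refl.
have [->|zy] := eqVneq z y.
  by rewrite /y matchedK // /rho -/y (negPf h3) (negPf h0) eqxx (negPf h4) conn_refl.
have e : s c z \notin [set w; w'] by rewrite -cut_else // cW !inE negb_or zw.
rewrite !rho_id // ?inE ?negb_or ?zw //.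
by rewrite -cut_else //; apply: conn_step.
Qed.

(** With only the colours 0 and [c] the leaf condition is empty: a cut always takes the 0-edge out
    of its 0c-cycle and leaves the rest of that cycle in one piece. *)
Lemma conn_cut0c u v : conn (cut s w c) [set ord0; c] u v =
  if u \in [set w; w'] then v \in [set w; w'] else
  (v \notin [set w; w']) && conn s [set ord0; c] u v.
Proof.
apply: conn_cut_leaf; rewrite ?inE ?eqxx ?orbT //.
  2: by exists ord0; rewrite ?inE ?eqxx // eq_sym.
by move=> c'; rewrite !inE => /orP[]/eqP->; rewrite /fixedc ?eqxx.
Qed.

(** The edges created by the cut join vertices of one and the same 0c-cycle of [s]. *)
Lemma conn_cut_sub A u v : ord0 \in A -> conn (cut s w c) A u v -> conn s A u v.
Proof.
move=> A0; apply: conn_sub => z c' c'A.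
have [e|c'c] := eqVneq c' c; last by rewrite cut_other //; apply: conn_step.
rewrite {c'}e in c'A *.
have sA : [set ord0; c] \subset A by apply/subsetP=> d; rewrite !inE => /orP[]/eqP->.
apply: (conn_subset sA).
have : conn (cut s w c) [set ord0; c] z (cut s w c c z).
  by apply: conn_step; rewrite !inE eqxx orbT.
rewrite conn_cut0c; case: ifP => [zW cW|_ /andP[]//].
have h : conn s [set ord0; c] w w' by apply: conn_step; rewrite !inE eqxx.
move: zW cW; rewrite !inE => /orP[]/eqP-> /orP[]/eqP->; rewrite ?conn_refl //.
by rewrite conn_sym.
Qed.

(** The lost edges [w x] and [w' y] are bypassed: [w w'] and [x y] are edges of the cut graph, and
    [w] is still joined to [x] by hypothesis. *)
Lemma conn_cut_nonbridge A : ord0 \in A -> c \in A -> conn (cut s w c) A w x ->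
  conn (cut s w c) A =2 conn s A.
Proof.
move=> A0 Ac wx u v; apply/idP/idP; first exact: conn_cut_sub.
apply: conn_sub => z c' c'A.
have [e|c'c] := eqVneq c' c; last by rewrite -(cut_other s w c'c); apply: conn_step.
rewrite {c'}e in c'A *.
have mc := matched_cut.
have w'y : conn (cut s w c) A w' y.
  apply: (conn_trans (y := w)); first by rewrite conn_sym // /w' -cut0; apply: conn_step.
  by apply: (conn_trans wx); rewrite -cutx; apply: conn_step.
have [->//|zw] := eqVneq z w.
have [->//|zw'] := eqVneq z w'.
have [->|zx] := eqVneq z x; first by rewrite /x matchedK // conn_sym.
have [->|zy] := eqVneq z y; first by rewrite /y matchedK // conn_sym.
by rewrite -cut_else //; apply: conn_step.
Qed.

Lemma conn0c_w : {in [set w; w'] &, forall u v, conn s [set ord0; c] u v}.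
Proof.
have h : conn s [set ord0; c] w w' by apply: conn_step; rewrite !inE eqxx.
move=> u v; rewrite !inE => /orP[]/eqP-> /orP[]/eqP->; rewrite ?conn_refl //.
by rewrite conn_sym.
Qed.

Lemma ncomp_cut : ncomp (cut s w c) [set ord0; c] = (ncomp s [set ord0; c]).+1.
Proof.
have [h0 h1 h2 h3 h4] := cut_neqs.
rewrite !ncompE; apply: (@ncls_split _ _ _ [set w; w'] w x).
- exact: conn_equiv.
- by rewrite !inE eqxx.
- by rewrite !inE negb_or h1.
- by apply: conn_step; rewrite !inE eqxx orbT.
- exact: conn0c_w.
- exact: conn_cut0c.
Qed.

Lemma ncomp_cut_other c' : c' != c -> ncomp (cut s w c) [set ord0; c'] = ncomp s [set ord0; c'].
Proof.
move=> c'c; rewrite !ncompE; apply: eq_ncls; apply: conn_eqs => d.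
by rewrite !inE => /orP[]/eqP->; [apply: cut0|apply: cut_other].
Qed.

End Cut.

Section Ins.
Variable x : 'I_N.
Hypotheses (fx : fixedc s c w) (xw : x != w) (xw' : x != s ord0 w).

Lemma insw : ins s w c x c w = x.
Proof. by rewrite insE eqxx. Qed.

Lemma nfixed_ins : ~~ fixedc (ins s w c x) c w.
Proof. by rewrite /fixedc insw ins0. Qed.

Lemma ins_neqs : s c x != w /\ s c x != s ord0 w.
Proof.
move/eqP: fx => fx'; split.
  apply: contra xw' => /eqP h; rewrite -fx' -h matchedK //.
by apply: contra xw => /eqP; rewrite -fx' => /(can_inj (matchedK c ms))/eqP.
Qed.

Lemma insw' : ins s w c x c (s ord0 w) = s c x.
Proof. by rewrite insE eqxx (negPf (matched_neq _ _ ms)). Qed.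

Lemma insx : ins s w c x c x = w.
Proof. by rewrite insE eqxx (negPf xw) (negPf xw'). Qed.

Lemma insy : ins s w c x c (s c x) = s ord0 w.
Proof.
have [/negPf h1 /negPf h2] := ins_neqs.
by rewrite insE eqxx h1 h2 (negPf (matched_neq _ _ ms)).
Qed.

Lemma ins_else z : z != w -> z != s ord0 w -> z != x -> z != s c x ->
  ins s w c x c z = s c z.
Proof. by move=> /negPf h1 /negPf h2 /negPf h3 /negPf h4; rewrite insE h1 h2 h3 h4. Qed.

Lemma matched_ins : matched (ins s w c x).
Proof.
have [h1 h2] := ins_neqs.
apply/forallP=> c'; apply/forallP=> z.
have [->{c'}|c'c] := eqVneq c' c; last by rewrite ins_other // matchedK // eqxx matched_neq.
have [->|zw] := eqVneq z w; first by rewrite insw insx eqxx.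
have [->|zw'] := eqVneq z (s ord0 w); first by rewrite insw' insy eqxx.
have [->|zx] := eqVneq z x; first by rewrite insx insw eqxx eq_sym.
have [->|zy] := eqVneq z (s c x); first by rewrite insy insw' eqxx eq_sym.
rewrite (ins_else zw zw' zx zy) matched_neq // andbT.
have cw : s c (s ord0 w) = w by rewrite -(eqP fx) matchedK.
have e1 : s c z != w by apply: contra zw' => /eqP h; rewrite -(eqP fx) -h matchedK.
have e2 : s c z != s ord0 w by rewrite -(eqP fx) (can_eq (matchedK c ms)).
have e3 : s c z != x by apply: contra zy => /eqP <-; rewrite matchedK.
have e4 : s c z != s c x by rewrite (can_eq (matchedK c ms)).
by rewrite (ins_else e1 e2 e3 e4) matchedK.
Qed.

Lemma insK : cut (ins s w c x) w c = s.
Proof.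
have [h1 h2] := ins_neqs.
apply/ffunP=> c'; apply/ffunP=> z.
have [->{c'}|c'c] := eqVneq c' c; last by rewrite cut_other // ins_other.
rewrite cutE ins0 insw insw'.
have cw : s c (s ord0 w) = w by rewrite -(eqP fx) matchedK.
case: eqP => [->|/eqP zw]; first by rewrite (eqP fx).
case: eqP => [->|/eqP zw']; first by rewrite cw.
case: eqP => [->//|/eqP zx].
case: eqP => [->|/eqP zy]; first by rewrite matchedK.
exact: ins_else.
Qed.

End Ins.
End CutIns.

(** * Cycle counts, Euler characteristic and leaves of the incidence graph *)

Definition cycles s A := \sum_(c in A) ncomp s [set ord0; c].

(** Degree of the 0-edge of [z] in the incidence graph once the cycles of length two are dropped;
    the value 1 means a leaf. *)
Definition nonfixed s A (z : 'I_N) := #|[set c in A | ~~ fixedc s c z]|.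

Definition nonbridge s A (w : 'I_N) (c : 'I_q.+1) :=
  [&& c \in A, ~~ fixedc s c w & conn (cut s w c) (ord0 |: A) w (s c w)].

(** Euler characteristic of the incidence graph, doubled to avoid halves: there are [#|A| * N / 2]
    incidences, [N / 2] 0-edges and [cycles s A] cycles. A first Betti number is never negative, so
    the inequality says that it vanishes. *)
Definition forest s A :=
  #|A| * N + 2 * ncomp s (ord0 |: A) <= 2 * cycles s A + N.

Lemma sum_nonfixed s A :
  \sum_z nonfixed s A z = \sum_(c in A) #|[set z | ~~ fixedc s c z]|.
Proof.
rewrite (eq_bigr (fun z => \sum_(c in A | ~~ fixedc s c z) 1)); last first.
  by move=> z _; rewrite sum1dep_card; apply: eq_card => c; rewrite !inE.
rewrite (exchange_big_dep (fun c => c \in A)) /=; last by move=> z c _ /andP[].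
apply: eq_bigr => c cA; rewrite -sum1dep_card.
by apply: eq_bigl => z; rewrite cA.
Qed.

Section Forest.
Variable A : {set 'I_q.+1}.
Hypothesis A0 : ord0 \notin A.

Lemma colA0 c : c \in A -> c != ord0.
Proof. by move=> cA; apply: contra A0 => /eqP <-. Qed.

Lemma fixedc_cut s w c d z : matched s -> c \in A -> ~~ fixedc s c w ->
  fixedc s d z -> fixedc (cut s w c) d z.
Proof.
move=> ms cA nf; have c0 := colA0 cA.
have [_ _ h2 h3 _] := cut_neqs ms nf.
have [->{d}|dc] := eqVneq d c; last by rewrite /fixedc cut_other // cut0.
rewrite /fixedc cut0 //.
have [->|zw] := eqVneq z w; first by rewrite cutw.
have [->|zw'] := eqVneq z (s ord0 w); first by rewrite cutw' // matchedK.
move=> /eqP f; rewrite cut_else // ?f //.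
  apply: contra h2 => /eqP e; move: f; rewrite e matchedK // => {2}->.
  by rewrite matchedK.
apply: contra h3 => /eqP e; move: f; rewrite e matchedK // => f.
by apply/eqP/(can_inj (matchedK ord0 ms)).
Qed.

Lemma cycles_cut s w c : matched s -> c \in A -> ~~ fixedc s c w ->
  cycles (cut s w c) A = (cycles s A).+1.
Proof.
move=> ms cA nf; have c0 := colA0 cA; rewrite /cycles !(bigD1 c cA) /= ncomp_cut //.
by rewrite addSn; congr (_ + _).+1; apply: eq_bigr => d /andP[_ dc]; apply: ncomp_cut_other.
Qed.

Lemma nonfixed_cut s w c z : matched s -> c \in A -> ~~ fixedc s c w ->
  nonfixed (cut s w c) A z <= nonfixed s A z.
Proof.
move=> ms cA nf; apply: subset_leq_card; apply/subsetP=> d.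
by rewrite !inE => /andP[-> /=]; apply: contra; apply: fixedc_cut.
Qed.

Lemma nonfixed_cutw s w c : matched s -> c \in A -> ~~ fixedc s c w ->
  nonfixed (cut s w c) A w < nonfixed s A w.
Proof.
move=> ms cA nf; have c0 := colA0 cA; apply: proper_card; apply/properP; split.
  apply/subsetP=> d; rewrite !inE => /andP[-> /=]; apply: contra.
  have [->{d}|dc] := eqVneq d c; first by rewrite fixed_cut.
  by rewrite /fixedc cut_other // cut0.
by exists c; rewrite !inE cA //= fixed_cut.
Qed.

Lemma sum_nonfixed_cut s w c : matched s -> c \in A -> ~~ fixedc s c w ->
  \sum_z nonfixed (cut s w c) A z < \sum_z nonfixed s A z.
Proof.
move=> ms cA nf; rewrite (bigD1 w) //= [X in _ < X](bigD1 w) //= -addSn.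
by apply: leq_add; [exact: nonfixed_cutw|apply: leq_sum => z _; exact: nonfixed_cut].
Qed.

(** Serves to carry a nonbridge found after other cuts back to the original graph: if the 0d-cycles
    of [s1] refine those of [s], and [w] has already left its 0c-cycle, then [s1] is no better
    connected than [s] with [w] alone cut out. *)
Lemma conn_refines s s1 w c u v : matched s -> matched s1 -> s1 ord0 = s ord0 ->
  (forall d, d \in A -> forall a b, conn s1 [set ord0; d] a b -> conn s [set ord0; d] a b) ->
  c \in A -> ~~ fixedc s c w -> fixedc s1 c w ->
  conn s1 (ord0 |: A) u v -> conn (cut s w c) (ord0 |: A) u v.
Proof.
move=> ms ms1 e0 ref cA nf fx; have c0 := colA0 cA; apply: conn_sub => z d.
rewrite !inE => /orP[/eqP->|dA].
  by rewrite e0 -(cut0 s w c0); apply: conn_step; rewrite setU11.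
have sA : [set ord0; d] \subset ord0 |: A by rewrite subUset !sub1set setU11 setU1r.
apply: (conn_subset sA).
have h : conn s [set ord0; d] z (s1 d z).
  by apply: ref => //; apply: conn_step; rewrite !inE eqxx orbT.
have [dc|dc] := eqVneq d c; last first.
  rewrite (@conn_eqs _ s) // => d'; rewrite !inE => /orP[]/eqP->; first exact: cut0.
  exact: cut_other.
rewrite dc in h *; rewrite conn_cut0c // h andbT.
have s1W : (s1 c z \in [set w; s ord0 w]) = (z \in [set w; s ord0 w]).
  move/eqP: fx; rewrite e0 => f.
  rewrite !inE orbC -f (can_eq (matchedK c ms1)); congr (_ || _).
  by rewrite -{1}[w](matchedK c ms1) f (can_eq (matchedK c ms1)).
by rewrite s1W; case: ifPn.
Qed.

Lemma ncomp_allfixed s (B : {set _}) : matched s -> ord0 \in B -> (forall c z, c \in B -> fixedc s c z) ->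
  2 * ncomp s B = N.
Proof.
move=> ms B0 hB; rewrite ncompE -[RHS]card_ord -sum1_card.
rewrite (sum_cls _ (conn_equiv B ms)) /ncls mulnC -sum_nat_const.
apply: eq_bigr => O /imsetP[z _ ->]; rewrite sum1_card.
have -> : [set y | conn s B z y] = [set z; s ord0 z].
  apply/setP=> y; rewrite !inE; apply/idP/orP.
    move=> h; apply/orP; have : y \in [set z; s ord0 z].
      apply: conn_closed h; last by rewrite !inE eqxx.
      move=> t c tz /(hB _ t)/eqP->; move: tz; rewrite !inE => /orP[]/eqP->.
        by rewrite eqxx orbT.
      by rewrite matchedK // eqxx.
    by rewrite !inE.
  by case=> /eqP->; [apply: conn_refl|apply: conn_step].
by rewrite cards2 eq_sym matched_neq.
Qed.

(** Cut as long as only bridges are met: each such cut adds a cycle and at least one component, so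
    the excess persists, whereas it is absent once all colours are parallel to the 0-edges. A
    nonbridge met on the way is a nonbridge of the original graph by [conn_refines]. *)
Lemma nonbridge_ex s : matched s ->
  2 * cycles s A + N < #|A| * N + 2 * ncomp s (ord0 |: A) ->
  exists w c, nonbridge s A w c.
Proof.
have [k] := ubnP (\sum_z nonfixed s A z); elim: k s => // k IH s /ltnSE lek ms.
have [/existsP[w /existsP[c /andP[cA nf]]] pos|] :=
    boolP [exists w, [exists c, (c \in A) && ~~ fixedc s c w]]; last first.
  rewrite negb_exists => /forallP h.
  have fx c z : c \in ord0 |: A -> fixedc s c z.
    rewrite !inE => /orP[/eqP->|cA]; first by rewrite /fixedc.
    by have := h z; rewrite negb_exists => /forallP/(_ c); rewrite cA negbK.
  rewrite ncomp_allfixed ?setU11 //; rewrite /cycles big_distrr /=.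
  rewrite (eq_bigr (fun=> N)) ?sum_nat_const ?ltnn // => c cA.
  apply: ncomp_allfixed; rewrite ?inE ?eqxx // => d z.
  by rewrite !inE => /orP[]/eqP->; [rewrite /fixedc|apply: fx; rewrite setU1r].
have c0 := colA0 cA.
have [nb|br] := boolP (conn (cut s w c) (ord0 |: A) w (s c w)).
  by exists w, c; rewrite /nonbridge cA nf.
have m1 := matched_cut ms nf.
have [||w2 [c2 /and3P[c2A nf2 nb2]]] := IH (cut s w c) _ m1.
- by apply: leq_trans lek; apply: sum_nonfixed_cut.
- have lt : ncomp s (ord0 |: A) < ncomp (cut s w c) (ord0 |: A).
    rewrite !ncompE; apply: ncls_strict; try exact: conn_equiv.
      by move=> x y; apply: conn_cut_sub; rewrite ?setU11.
    by exists w, (s c w); rewrite br andbT; apply: conn_step; rewrite setU1r.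
  by rewrite cycles_cut //; lia.
have c20 := colA0 c2A.
have m2 := matched_cut m1 nf2.
have ref1 d : d \in A -> forall a b, conn (cut s w c) [set ord0; d] a b -> conn s [set ord0; d] a b.
  by move=> dA a b; apply: conn_cut_sub; rewrite // !inE eqxx.
have ref d : d \in A -> forall a b,
    conn (cut (cut s w c) w2 c2) [set ord0; d] a b -> conn s [set ord0; d] a b.
  by move=> dA a b /conn_cut_sub h; apply: ref1 => //; apply: h; rewrite // !inE eqxx.
have nf2' : ~~ fixedc s c2 w2 by apply: contra nf2; apply: fixedc_cut.
exists w2, c2; rewrite /nonbridge c2A nf2' /=.
set z := cut s w c c2 w2 in nb2.
apply: (conn_trans (y := z)).
  apply: (conn_refines ms m2 _ ref) nb2 => //; first by rewrite !cut0.
  exact: fixed_cut.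
have sA : [set ord0; c2] \subset ord0 |: A by rewrite subUset !sub1set setU11 setU1r.
apply: (conn_subset sA); rewrite conn_cut0c //.
have [_ h1 h2 _ _] := cut_neqs m1 nf2; have [_ h3 h4 _ _] := cut_neqs ms nf2'.
rewrite cut0 // in h2.
rewrite !inE -/z in h1 h2 *; rewrite (negPf h1) (negPf h2) /= (negPf h3) (negPf h4) /=.
have zw2 : conn s [set ord0; c2] w2 z by apply: ref1 => //; apply: conn_step; rewrite !inE eqxx orbT.
rewrite conn_sym // in zw2.
by apply: (conn_trans zw2); apply: conn_step; rewrite !inE eqxx orbT.
Qed.

(** A 0c-cycle has at least four vertices, unless it has two, and then both are counted a second
    time on the right. *)
Lemma ncomp_le_fixed s c : matched s -> c != ord0 ->
  4 * ncomp s [set ord0; c] <= N + #|[set z | fixedc s c z]|.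
Proof.
move=> ms c0; rewrite ncompE.
have -> : N + #|[set z | fixedc s c z]| = \sum_(z : 'I_N) (1 + fixedc s c z).
  rewrite big_split /= sum1_card card_ord -sum1dep_card big_mkcond /=.
  by congr (_ + _); apply: eq_bigr => z _; case: (fixedc _ _ _).
rewrite (sum_cls _ (conn_equiv [set ord0; c] ms)) /ncls mulnC -sum_nat_const.
apply: leq_sum => O /imsetP[z _ ->].
set O' := [set y | _].
have zO : z \in O' by rewrite inE conn_refl.
have clO y d : d \in [set ord0; c] -> y \in O' -> s d y \in O'.
  by move=> dA; rewrite !inE => h; apply: (conn_trans h); apply: conn_step.
have z'O : s ord0 z \in O' by apply: clO; rewrite // !inE eqxx.
have z'z := matched_neq ord0 z ms.
have [f|nf] := boolP (fixedc s c z).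
  rewrite (bigD1 z) //= (bigD1 (s ord0 z)) /=; last by rewrite z'O z'z.
  by rewrite fixedcC // f addnA leq_addr.
have [_ h1 h2 h3 h4] := cut_neqs ms nf.
have xO : s c z \in O' by apply: clO; rewrite // !inE eqxx orbT.
have yO : s c (s ord0 z) \in O' by apply: clO; rewrite // !inE eqxx orbT.
rewrite (bigD1 z) //= (bigD1 (s ord0 z)) /=; last by rewrite z'O z'z.
rewrite (bigD1 (s c z)) /=; last by rewrite xO h1 h2.
rewrite (bigD1 (s c (s ord0 z))) /=; last first.
  by rewrite yO h3 h4 /= (can_eq (matchedK c ms)).
by rewrite !add1n !(addSn, addnS).
Qed.

Lemma nonfixed_le s : matched s ->
  \sum_z nonfixed s A z + 4 * cycles s A <= 2 * (#|A| * N).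
Proof.
move=> ms; rewrite sum_nonfixed /cycles big_distrr -big_split /=.
rewrite mulnCA -sum_nat_const; apply: leq_sum => c cA.
have := ncomp_le_fixed ms (colA0 cA).
have := cardsC [set z | fixedc s c z]; rewrite card_ord.
have -> : #|~: [set z | fixedc s c z]| = #|[set z | ~~ fixedc s c z]|.
  by apply: eq_card => z; rewrite !inE.
move: #|_| #|_| (ncomp _ _) => f nf m; lia.
Qed.

Lemma nonfixedC s z : matched s -> nonfixed s A (s ord0 z) = nonfixed s A z.
Proof.
move=> ms; apply: eq_card => c; rewrite !inE; case cA: (c \in A) => //=.
by rewrite fixedcC //; apply: colA0.
Qed.

Lemma nonfixed0P s z : reflect (forall c, c \in A -> fixedc s c z) (nonfixed s A z == 0).
Proof.
rewrite /nonfixed cards_eq0; apply: (iffP eqP) => [/setP h c cA|h].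
  by have := h c; rewrite !inE cA /= => /negbFE.
by apply/setP=> c; rewrite !inE; apply/negP => /andP[/h->].
Qed.

(** Each 0-edge of degree 0 is a component with two vertices, and [z1] lies in a further
    component. *)
Lemma ncomp_nontrivial s z1 : matched s -> nonfixed s A z1 != 0 ->
  #|[set z | nonfixed s A z == 0]| + 2 <= 2 * ncomp s (ord0 |: A).
Proof.
move=> ms nz1; rewrite ncompE /ncls -sum1dep_card big_mkcond /=.
rewrite (sum_cls _ (conn_equiv (ord0 |: A) ms)) /=.
have hO O : O \in [set [set y | conn s (ord0 |: A) x y] | x : 'I_N] ->
   forall z, z \in O -> nonfixed s A z == 0 -> O = [set z; s ord0 z].
  case/imsetP=> x _ -> z; rewrite inE => xz /nonfixed0P fz.
  have -> : [set y | conn s (ord0 |: A) x y] = [set y | conn s (ord0 |: A) z y].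
    by apply/eqP; rewrite cls_eq //; apply: conn_equiv.
  apply/setP=> y; rewrite !inE; apply/idP/orP.
    move=> h; apply/orP; have : y \in [set z; s ord0 z].
      apply: conn_closed h; last by rewrite !inE eqxx.
      move=> t c; rewrite !inE => tz /orP[/eqP->|cA].
        by case/orP: tz => /eqP->; rewrite ?matchedK ?eqxx ?orbT.
      case/orP: tz => /eqP->; first by rewrite (eqP (fz _ cA)) eqxx orbT.
      by rewrite -(eqP (fz _ cA)) matchedK // eqxx.
    by rewrite !inE.
  by case=> /eqP->; [apply: conn_refl|apply: conn_step; rewrite setU11].
set P := [set _ | _ in _].
have O1 : [set y | conn s (ord0 |: A) z1 y] \in P by apply: imset_f.
rewrite (bigD1 _ O1) /= big1 ?add0n; last first.
  move=> z zO; case: ifP => // fz; have e := hO _ O1 _ zO fz.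
  have : z1 \in [set z; s ord0 z] by rewrite -e inE conn_refl.
  rewrite !inE => /orP[]/eqP e1; rewrite e1 ?nonfixedC // in nz1.
    by rewrite fz in nz1.
  by rewrite fz in nz1.
rewrite (cardsD1 [set y | conn s (ord0 |: A) z1 y] P) O1 mulnDr addnC leq_add2l mulnC -sum_nat_const.
rewrite [X in X <= _](eq_bigl (fun O => O \in P :\ [set y | conn s (ord0 |: A) z1 y])).
  2: by move=> O; rewrite in_setD1 andbC.
apply: leq_sum => O; rewrite in_setD1 => /andP[_ OP].
have [/existsP[z /andP[zO fz]]|] := boolP [exists z in O, nonfixed s A z == 0].
  rewrite (hO O OP z zO fz) big_setU1 ?big_set1 /=; last first.
    by rewrite inE eq_sym matched_neq.
  by rewrite nonfixedC // fz.
rewrite negb_exists => /forallP h; rewrite big1 // => z zO.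
by have := h z; rewrite zO /= => /negPf->.
Qed.

(** Handshake argument: were every nontrivial vertex outside the 0-edge of [v] of degree at least 2,
    the sum of the degrees would exceed what [nonfixed_le], the forest inequality and
    [ncomp_nontrivial] allow. The 0-edge of [v] is spared because it will be the root. *)
Lemma forest_leaf s v z1 : matched s -> forest s A -> nonfixed s A z1 != 0 ->
  exists z c, [/\ z != v, z != s ord0 v, c \in A, ~~ fixedc s c z &
     forall c', c' \in A -> c' != c -> fixedc s c' z].
Proof.
rewrite /forest => ms fo nz1.
have [/existsP[z /and3P[zv zv' /cards1P[c /setP e]]]|] :=
    boolP [exists z, [&& z != v, z != s ord0 v & nonfixed s A z == 1]].
  exists z, c; split=> //.
  - by have := e c; rewrite !inE eqxx => /andP[].
  - by have := e c; rewrite !inE eqxx => /andP[].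
  - by move=> c' c'A c'c; have := e c'; rewrite !inE c'A (negPf c'c) => /negbFE.
rewrite negb_exists => /forallP h; exfalso.
have := ncomp_nontrivial ms nz1; have := nonfixed_le ms.
have card0 : #|[set z | nonfixed s A z == 0]| + #|[set z | nonfixed s A z != 0]| = N.
  rewrite -[RHS]card_ord -(cardsC [set z | nonfixed s A z == 0]); congr (_ + _).
  by apply: eq_card => z; rewrite !inE.
suff : 2 * #|[set z | nonfixed s A z != 0]| <= \sum_z nonfixed s A z + 2 by lia.
have : \sum_z 2 * (nonfixed s A z != 0) <= \sum_z (nonfixed s A z + ((z == v) + (z == s ord0 v))).
  apply: leq_sum => z _; move: (h z); case: (nonfixed s A z) => [|[|m]];
    by case: (z == v); case: (z == s ord0 v).
have s1 (P : pred 'I_N) : \sum_z P z = #|[set z | P z]|.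
  by rewrite -sum1dep_card [RHS]big_mkcond /=; apply: eq_bigr => z _; case: (P z).
have c1 u : #|[set z : 'I_N | z == u]| = 1.
  by rewrite -(cards1 u); apply: eq_card => z; rewrite !inE.
by rewrite -big_distrr /= s1 2!big_split /= !s1 !c1.
Qed.

Lemma forest_cut_leaf s z c : matched s -> forest s A -> c \in A -> ~~ fixedc s c z ->
  (forall c', c' \in A -> c' != c -> fixedc s c' z) -> forest (cut s z c) A.
Proof.
rewrite /forest => ms fo cA nf hl; have c0 := colA0 cA.
suff e : ncomp (cut s z c) (ord0 |: A) = (ncomp s (ord0 |: A)).+1 by rewrite e cycles_cut //; lia.
have [h0 h1 h2 h3 h4] := cut_neqs ms nf.
have zz' : conn s (ord0 |: A) z (s ord0 z) by apply: conn_step; rewrite setU11.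
rewrite !ncompE; apply: (@ncls_split _ _ _ [set z; s ord0 z] z (s c z)).
- exact: conn_equiv.
- by rewrite !inE eqxx.
- by rewrite !inE negb_or h1.
- by apply: conn_step; rewrite setU1r.
- move=> u v; rewrite !inE => /orP[]/eqP-> /orP[]/eqP->; rewrite ?conn_refl //.
  by rewrite conn_sym.
- move=> u v; apply: conn_cut_leaf; rewrite ?setU11 ?setU1r //.
    2: by exists ord0; rewrite ?setU11 // eq_sym.
  by move=> c'; rewrite !inE => /orP[/eqP->|]; [rewrite /fixedc|apply: hl].
Qed.

End Forest.

End Graph.

(** * Clique complexes up to combinatorial equivalence *)

Section Complexes.
Implicit Types X Y : finType.

Lemma is_complexP X (K : {set {set X}}) :
  reflect (set0 \in K /\ forall s t : {set X}, s \in K -> t \subset s -> t \in K) (is_complex K).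
Proof.
apply: (iffP andP) => -[K0 h]; split=> //.
  by move=> s t sK ts; move/forallP/(_ s): h; rewrite sK => /forallP/(_ t)/implyP; apply.
apply/forallP=> s; apply/implyP=> sK; apply/forallP=> t; apply/implyP; exact: h.
Qed.

Lemma comb_refl X (K : {set {set X}}) : is_complex K -> comb_equiv K K.
Proof.
move=> cK; have := CE_iso cK (@inj_id X); congr comb_equiv.
by rewrite -[RHS]imset_id; apply: eq_imset => t; rewrite imset_id.
Qed.

Lemma preSomeE X (T : {set option X}) x : (x \in (@Some X) @^-1: T) = (Some x \in T).
Proof. by rewrite inE. Qed.

Lemma set_optionE X (T : {set option X}) :
  T = if None \in T then None |: (@Some X @: (@Some X @^-1: T)) else @Some X @: (@Some X @^-1: T).
Proof.
apply/setP=> -[x|].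
  have e : (Some x \in @Some X @: (@Some X @^-1: T)) = (Some x \in T).
    by rewrite mem_imset ?preSomeE // => a b [].
  by case: ifP => _; rewrite ?inE e.
case: ifP => _; first by rewrite setU11.
by symmetry; apply/negP => /imsetP[].
Qed.

(** Membership in terms of the old vertices of [T] only; this replaces the decomposition into a face
    of the boundary and a face of the link. *)
Lemma in_stellar X (K : {set {set X}}) (sigma : {set X}) T : is_complex K ->
  (T \in stellar K sigma) = let t := @Some X @^-1: T in
    ~~ (sigma \subset t) && (if None \in T then t :|: sigma \in K else t \in K).
Proof.
case/is_complexP=> K0 sub /=; have Si : injective (@Some X) by move=> a b [].
have preI (t : {set X}) : @Some X @^-1: (@Some X @: t) = t.
  by apply/setP=> x; rewrite preSomeE mem_imset.
have preN (t : {set X}) : @Some X @^-1: (None |: @Some X @: t) = t.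
  by apply/setP=> x; rewrite preSomeE !inE /= mem_imset.
apply/idP/idP.
  rewrite inE => /orP[/imsetP[t]|/imset2P[a b]].
    rewrite inE => /andP[tK nt] ->; rewrite preI nt.
    by case: ifP => // /imsetP[].
  rewrite !inE => /properP[as' [z zs za]] /and3P[bK dis bs] ->.
  rewrite preN setU11; apply/andP; split.
    apply/negP => /subsetP/(_ z zs); rewrite inE (negPf za) /= => zb.
    by move/pred0P: dis => /(_ z); rewrite /= zb zs.
  by rewrite setUAC [a :|: _](setUidPr as') setUC.
move=> /andP[nt]; rewrite [in X in _ -> X](set_optionE T); case: ifP => NT tK; rewrite inE.
  apply/orP; right; set t := _ @^-1: _ in nt tK *.
  rewrite -[t](setID t sigma); apply: imset2_f; rewrite inE.
    rewrite properE subsetIr /=; apply: contra nt => /subset_trans; apply; exact: subsetIl.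
  apply/and3P; split.
  - by apply: sub tK _; apply: subset_trans (subsetDl _ _) (subsetUl _ _).
  - by rewrite disjoint_sym -setI_eq0 setIDA setIC setDIl setDv setI0.
  - by rewrite setDE setUIl [_ :|: sigma]setUC [~: _ :|: _]setUC setUCr setIT setUC.
by apply/orP; left; apply: imset_f; rewrite inE tK.
Qed.

Lemma is_complex_stellar X (K : {set {set X}}) (sigma : {set X}) :
  is_complex K -> sigma != set0 -> is_complex (stellar K sigma).
Proof.
move=> cK s0; have [K0 sub] := is_complexP _ cK; apply/is_complexP; split.
  by rewrite in_stellar //= preimset0 subset0 s0 inE.
move=> T U; rewrite !in_stellar //= => /andP[nT hT] UT.
have pUT : @Some X @^-1: U \subset @Some X @^-1: T by apply: preimsetS.
apply/andP; split; first by apply: contra nT => /subset_trans; apply.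
case: ifP => NU; first by rewrite (subsetP UT _ NU) in hT; apply: sub hT _; apply: setSU.
move: hT; case: ifP => _ hT; last exact: sub hT _.
by apply: sub hT _; apply: subset_trans pUT (subsetUl _ _).
Qed.

Definition join X Y (K : {set {set X}}) (L : {set {set Y}}) : {set {set X + Y}} :=
  [set T : {set X + Y} | (@inl X Y @^-1: T \in K) && (@inr X Y @^-1: T \in L)].

Lemma is_complex_join X Y (K : {set {set X}}) (L : {set {set Y}}) :
  is_complex K -> is_complex L -> is_complex (join K L).
Proof.
move=> /is_complexP[K0 sK] /is_complexP[L0 sL]; apply/is_complexP; split.
  by rewrite inE !preimset0 K0.
move=> T U; rewrite !inE => /andP[TK TL] UT.
by rewrite (sK _ _ TK) ?(sL _ _ TL) //; apply: preimsetS.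
Qed.

(** A stellar subdivision of [K] at [sigma] becomes one of the join at the copy of [sigma], up to
    renaming the new vertex. *)
Lemma comb_equiv_join X X' (K : {set {set X}}) (K' : {set {set X'}}) :
  comb_equiv K K' -> forall Y (L : {set {set Y}}), is_complex L ->
  comb_equiv (join K L) (join K' L).
Proof.
elim=> {X X' K K'}.
- move=> X X' f K cK injf Y L cL.
  pose h (z : X + Y) : X' + Y := match z with inl x => inl (f x) | inr y => inr y end.
  have injh : injective h by move=> [a|a] [b|b] //= [] => [/injf->|->].
  have := CE_iso (is_complex_join cK cL) injh; congr comb_equiv.
  have hl (T : {set X + Y}) : @inl X' Y @^-1: (h @: T) = f @: (@inl X Y @^-1: T).
    apply/setP=> x; rewrite inE; apply/imsetP/imsetP => [[[a|b] aT //= [->]]|[a]].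
      by exists a; rewrite // inE.
    by rewrite inE => aT ->; exists (inl a).
  have hr (T : {set X + Y}) : @inr X' Y @^-1: (h @: T) = @inr X Y @^-1: T.
    apply/setP=> y; rewrite !inE; apply/imsetP/idP => [[[a|b] aT //= [->]]//|yT].
    by exists (inr y).
  apply/setP=> T; rewrite !inE; apply/imsetP/andP.
    case=> U; rewrite inE => /andP[UK UL] ->; rewrite hl hr UL; split=> //.
    exact: imset_f.
  case=> /imsetP[a aK ea] TL; pose U := [set z : X + Y | h z \in T].
  have UT : T = h @: U.
    apply/setP=> -[x|y]; apply/idP/imsetP => [zT|[z]]; rewrite ?inE; try by move=> + ->.
      have : x \in f @: a by rewrite -ea inE.
      by case/imsetP=> b ba ex; exists (inl b) => //=; rewrite ?inE /= -?ex.
    by exists (inr y); rewrite // inE.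
  exists U => //; rewrite inE; apply/andP; split.
    suff -> : @inl X Y @^-1: U = a by [].
    apply/setP=> x; rewrite !inE /=.
    by rewrite -(mem_imset a x injf) -ea inE.
  suff -> : @inr X Y @^-1: U = @inr X' Y @^-1: T by [].
  by apply/setP=> y; rewrite !inE.
- move=> X K sigma cK sK s0 Y L cL; have cKL := is_complex_join cK cL.
  have il : injective (@inl X Y) by move=> a b [].
  have s0' : (@inl X Y) @: sigma != set0.
    by case/set0Pn: s0 => x xs; apply/set0Pn; exists (inl x); apply: imset_f.
  have pil (t : {set X}) : @inl X Y @^-1: (@inl X Y @: t) = t.
    by apply/setP=> x; rewrite inE mem_imset.
  have pir (t : {set X}) : @inr X Y @^-1: (@inl X Y @: t) = set0.
    by apply/setP=> x; rewrite !inE; apply/negP => /imsetP[].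
  have sKL : (@inl X Y) @: sigma \in join K L.
    by rewrite inE pil sK pir; case/is_complexP: cL.
  apply: CE_trans (CE_stellar cKL sKL s0') _.
  pose g (z : option (X + Y)) : option X + Y :=
    match z with None => inl None | Some (inl x) => inl (Some x) | Some (inr y) => inr y end.
  pose g' (z : option X + Y) : option (X + Y) :=
    match z with inl None => None | inl (Some x) => Some (inl x) | inr y => Some (inr y) end.
  have gK : cancel g g' by case=> [[x|y]|].
  have g'K : cancel g' g by case=> [[x|]|y].
  have := CE_iso (is_complex_stellar cKL s0') (can_inj gK); congr comb_equiv.
  apply/setP=> T.
  have -> : (T \in [set g @: t | t : {set option (X + Y)} in stellar (join K L) (inl @: sigma)])
      = (g @^-1: T \in stellar (join K L) (inl @: sigma)).
    have gT : g @: (g @^-1: T) = T.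
      apply/setP=> z; apply/imsetP/idP => [[u]|zT]; first by rewrite inE => uT ->.
      by exists (g' z); rewrite ?inE g'K.
    apply/imsetP/idP => [[U UK ->]|h]; last by exists (g @^-1: T).
    suff -> : g @^-1: (g @: U) = U by [].
    by apply/setP=> z; rewrite inE mem_imset //; apply: can_inj gK.
  have e1 : @inl X Y @^-1: (@Some (X + Y) @^-1: (g @^-1: T)) = @Some X @^-1: (@inl (option X) Y @^-1: T).
    by apply/setP=> x; rewrite !inE.
  have e2 : @inr X Y @^-1: (@Some (X + Y) @^-1: (g @^-1: T)) = @inr (option X) Y @^-1: T.
    by apply/setP=> x; rewrite !inE.
  have sE : (@inl X Y @: sigma \subset @Some (X + Y) @^-1: (g @^-1: T))
      = (sigma \subset @Some X @^-1: (@inl (option X) Y @^-1: T)).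
    apply/subsetP/subsetP => h x; first by move=> xs; have := h (inl x) (imset_f _ xs); rewrite !inE.
    by case/imsetP=> a /h; rewrite !inE => ? ->.
  rewrite in_stellar //= sE [RHS]inE in_stellar //= !inE.
  rewrite !preimsetU pil pir setU0 e1 e2.
  by case: ifP => _; rewrite -?andbA.
- by move=> X Y K L _ IH Z M cM; apply: CE_sym; apply: IH.
- by move=> X Y Z K L M _ IH1 _ IH2 W P cP; apply: CE_trans (IH1 _ _ cP) (IH2 _ _ cP).
Qed.

End Complexes.

(** Flag complexes, which can be compared through their graphs. The relation is consulted at
    distinct vertices only, so a comparability relation may be used as it is. *)
Definition cliques (X : finType) (P : pred X) (r : rel X) : {set {set X}} :=
  [set C : {set X} | [forall x in C, P x] &&
     [forall x in C, forall y in C, (x != y) ==> r x y]].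

Section Cliques.
Implicit Types X Y : finType.

Lemma cliquesP X (P : pred X) (r : rel X) (C : {set X}) :
  reflect ((forall x, x \in C -> P x) /\
           (forall x y, x \in C -> y \in C -> x != y -> r x y)) (C \in cliques P r).
Proof.
rewrite inE; apply: (iffP andP) => -[h1 h2]; split.
- by move=> x xC; move/forallP/(_ x): h1; rewrite xC.
- by move=> x y xC yC; move/forallP/(_ x): h2; rewrite xC => /forallP/(_ y); rewrite yC => /implyP/(_ isT)/implyP.
- by apply/forallP=> x; apply/implyP; apply: h1.
- apply/forallP=> x; apply/implyP=> xC; apply/forallP=> y; apply/implyP=> yC.
  by apply/implyP; apply: h2.
Qed.

Lemma is_complex_cliques X (P : pred X) (r : rel X) : is_complex (cliques P r).
Proof.
apply/is_complexP; split; first by apply/cliquesP; split=> x; rewrite inE.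
move=> s t /cliquesP[h1 h2] /subsetP ts; apply/cliquesP; split=> [x /ts/h1//|x y /ts xs /ts ys].
exact: h2.
Qed.
Hint Resolve is_complex_cliques : core.

Lemma cliques_iso X Y (f : X -> Y) (P : pred X) (r : rel X) (Q : pred Y) (r' : rel Y) :
  (forall x y, P x -> P y -> f x = f y -> x = y) ->
  (forall x, P x -> Q (f x)) -> (forall y, Q y -> exists2 x, P x & f x = y) ->
  (forall x y, P x -> P y -> x != y -> r' (f x) (f y) = r x y) ->
  comb_equiv (cliques P r) (cliques Q r').
Proof.
move=> finj fP fQ fr.
(* [CE_iso] asks for an injection of the whole type, so the points outside [P] are sent to a
   separate copy of [X]. *)
pose f1 x : X + Y := if P x then inr (f x) else inl x.
have f1i : injective f1.
  by move=> x y; rewrite /f1; case Px: (P x); case Py: (P y) => // -[] //; apply: finj.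
have f2i : injective (@inr X Y) by move=> a b [].
apply: CE_trans (CE_iso (is_complex_cliques P r) f1i) _.
apply: CE_sym; have := CE_iso (is_complex_cliques Q r') f2i; congr comb_equiv.
have f1E (C : {set X}) : (forall x, x \in C -> P x) -> f1 @: C = @inr X Y @: (f @: C).
  move=> CP; rewrite -imset_comp; apply: eq_in_imset => x /CP Px /=.
  by rewrite /f1 Px.
apply/setP=> T; apply/imsetP/imsetP => -[C /cliquesP[h1 h2] ->].
  pose D := [set x | P x && (f x \in C)].
  have DP x : x \in D -> P x by rewrite inE => /andP[].
  have fD : f @: D = C.
    apply/setP=> y; apply/imsetP/idP => [[x]|yC]; first by rewrite inE => /andP[_ fC] ->.
    by have [x Px fx] := fQ y (h1 _ yC); exists x; rewrite ?inE ?Px /= fx.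
  exists D; last by rewrite f1E // fD.
  apply/cliquesP; split=> // x y; rewrite !inE => /andP[Px fx] /andP[Py fy] xy.
  by rewrite -fr //; apply: h2 => //; apply: contra xy => /eqP/finj->.
exists (f @: C); last exact: f1E.
apply/cliquesP; split=> [y /imsetP[x xC ->]|y z /imsetP[x xC ->] /imsetP[x' xC' ->] ne].
  exact/fP/h1.
have xx' : x != x' by apply: contra ne => /eqP->.
by rewrite fr //; [apply: h2|apply: h1|apply: h1].
Qed.

Lemma cliques_ext X (P Q : pred X) (r r' : rel X) : P =1 Q ->
  (forall x y, P x -> P y -> x != y -> r x y = r' x y) ->
  cliques P r = cliques Q r'.
Proof.
move=> PQ rr'; apply/setP=> C; apply/cliquesP/cliquesP => -[h1 h2]; split.
- by move=> x xC; rewrite -PQ h1.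
- by move=> x y xC yC xy; rewrite -rr' //; [apply: h2|apply: h1|apply: h1].
- by move=> x xC; rewrite PQ h1.
- by move=> x y xC yC xy; rewrite rr' // ?PQ ?h1 //; apply: h2.
Qed.

(* Stellar subdivision of a clique complex at an edge [u v] is again a clique
   complex, on the graph in which [n] is inserted in the middle of [u v]. *)
Lemma cliques_subdiv X (P P' : pred X) (r r' : rel X) (n u v : X) :
  symmetric r -> symmetric r' -> ~~ P n -> P u -> P v -> u != v -> r u v ->
  (forall x, P' x = P x || (x == n)) ->
  (forall x y, P x -> P y -> x != y ->
     r' x y = r x y && ~~ ((x == u) && (y == v) || (x == v) && (y == u))) ->
  (forall x, P x -> r' x n = (x == u) || (x == v) || (r x u && r x v)) ->
  comb_equiv (cliques P r) (cliques P' r').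
Proof.
move=> rs r's nn Pu Pv uv ruv P'E r'E r'n.
(* [n] is identified with the new vertex [None] of the stellar subdivision. *)
pose g x := if x == n then None else Some x.
have ginj : injective g.
  move=> x y; rewrite /g; case: eqP => [->|nx]; case: eqP => [->|ny] //.
  by case.
have un : u != n by apply: contra nn => /eqP<-.
have vn : v != n by apply: contra nn => /eqP<-.
have sK : [set u; v] \in cliques P r.
  apply/cliquesP; split=> [x|x y]; first by rewrite !inE => /orP[]/eqP->.
  by rewrite !inE => /orP[]/eqP-> /orP[]/eqP->; rewrite ?eqxx // rs.
have s0 : [set u; v] != set0 by apply/set0Pn; exists u; rewrite !inE eqxx.
apply: CE_trans (CE_stellar (is_complex_cliques P r) sK s0) _; apply: CE_sym.
have := CE_iso (is_complex_cliques P' r') ginj; congr comb_equiv.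
apply/setP=> T; rewrite in_stellar //=; set t' := _ @^-1: T.
apply/imsetP/andP.
  case=> t /cliquesP[h1 h2] eT.
  have t'E : t' = t :\ n.
    apply/setP=> x; rewrite !inE eT; apply/imsetP/andP => [[y yt]|[xn xt]].
      by rewrite /g; case: eqP => // /eqP yn [->].
    by exists x => //; rewrite /g (negPf xn).
  have NT : (None \in T) = (n \in t).
    rewrite eT; apply/imsetP/idP => [[y yt]|nt]; last by exists n; rewrite // /g eqxx.
    by rewrite /g; case: eqP => // <-.
  have tP x : x \in t' -> P x.
    by rewrite t'E !inE => /andP[xn /h1]; rewrite P'E (negPf xn) orbF.
  have tr x y : x \in t' -> y \in t' -> x != y -> r x y.
    move=> xt yt xy; have Px := tP x xt; have Py := tP y yt.
    move: xt yt; rewrite t'E !inE => /andP[_ xt] /andP[_ yt].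
    by have := h2 x y xt yt xy; rewrite r'E // => /andP[].
  split.
    apply/negP => /subsetP h.
    have ut : u \in t' by apply: h; rewrite !inE eqxx.
    have vt : v \in t' by apply: h; rewrite !inE eqxx orbT.
    move: ut vt; rewrite t'E !inE => /andP[_ ut] /andP[_ vt].
    by have := h2 u v ut vt uv; rewrite r'E // !eqxx /= andbF.
  rewrite NT; case: ifP => nt; last by apply/cliquesP.
  have rtu x : x \in t' -> [|| x == u, x == v | r x u && r x v].
    move=> xt; have Px := tP x xt; move: xt; rewrite t'E !inE => /andP[xn xt].
    by rewrite orbA -r'n //; apply: h2.
  have rt2 x z : x \in t' -> z \in [set u; v] -> x != z -> r x z.
    move=> /rtu h; rewrite !inE => /orP[]/eqP->.
      by case/or3P: h => [/eqP->|/eqP->|/andP[]//]; rewrite ?eqxx // rs.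
    by case/or3P: h => [/eqP->|/eqP->|/andP[]//]; rewrite ?eqxx.
  apply/cliquesP; split=> [x|x y].
    by rewrite inE => /orP[/tP//|]; rewrite !inE => /orP[]/eqP->.
  rewrite inE => /orP[xt|xs]; rewrite inE => /orP[yt|ys] xy.
  - exact: tr.
  - exact: rt2.
  - by rewrite rs; apply: rt2; rewrite // eq_sym.
  - by case/cliquesP: sK => _; apply.
case=> nt ht.
have tP x : x \in t' -> P x.
  move=> xt; move: ht; case: ifP => _ /cliquesP[h _]; apply: h => //.
  by rewrite inE xt.
have tr x y : x \in t' -> y \in t' -> x != y -> r x y.
  move=> xt yt; move: ht; case: ifP => _ /cliquesP[_ h]; apply: h => //.
    by rewrite inE xt.
  by rewrite inE yt.
pose t := g @^-1: T.
have eT : T = g @: t.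
  apply/setP=> z; apply/idP/imsetP => [zT|[x]]; last by rewrite inE => xT ->.
  case: z zT => [x|] zT; last by exists n; rewrite ?inE /g eqxx.
  have Px : P x by apply: tP; rewrite inE.
  by have xn : x != n; [apply: contra nn => /eqP<-|exists x; rewrite ?inE /g (negPf xn)].
exists t => //; apply/cliquesP.
have tE x : x != n -> (x \in t) = (x \in t') by move=> xn; rewrite !inE /g (negPf xn).
have tn : n \in t -> None \in T by rewrite inE /g eqxx.
have rn x : n \in t -> x \in t' -> r' x n.
  move=> /tn NT xt; rewrite NT in ht; rewrite r'n ?tP //.
  have [//|xu] := eqVneq x u; have [//|xv] := eqVneq x v.
  case/cliquesP: ht => _ h; apply/andP; split; apply: h => //; rewrite !inE ?eqxx ?orbT //; move: xt; rewrite inE => -> //.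
split=> [x|x y].
  have [->|xn] := eqVneq x n; first by rewrite P'E eqxx orbT.
  by rewrite tE // P'E => /tP->.
have [->|xn] := eqVneq x n; have [->|yn] := eqVneq y n; rewrite ?eqxx //.
- by move=> nT; rewrite tE // => yt _; rewrite r's; apply: rn.
- by rewrite tE // => xt nT _; apply: rn.
rewrite !tE // => xt yt xy; rewrite r'E ?tP // tr //=.
apply: contra nt => h; apply/subsetP => z; rewrite !inE => /orP[]/eqP->; move: xt yt; rewrite !inE.
  by case/orP: h => /andP[/eqP-> /eqP->].
by case/orP: h => /andP[/eqP-> /eqP->].
Qed.

Lemma comb_equiv_split X (P P1 P2 : pred X) (r : rel X) : symmetric r ->
  (forall x, P x = P1 x || P2 x) -> (forall x, P1 x -> P2 x -> False) ->
  (forall x y, P1 x -> P2 y -> r x y) ->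
  comb_equiv (cliques P r) (join (cliques P1 r) (cliques P2 r)).
Proof.
move=> rs PE dis cr.
pose f x : X + X := if P1 x then inl x else inr x.
have fi : injective f by move=> x y; rewrite /f; case: ifP => _; case: ifP => // _ [].
have := CE_iso (is_complex_cliques P r) fi; congr comb_equiv.
apply/setP=> T; rewrite inE; apply/imsetP/andP.
  case=> C /cliquesP[h1 h2] ->; split; apply/cliquesP.
    have hC x : x \in @inl X X @^-1: (f @: C) -> (x \in C) && P1 x.
      by rewrite inE => /imsetP[y yC]; rewrite /f; case: ifP => // Py [->]; rewrite yC.
    split=> [x /hC/andP[]//|x y /hC/andP[xC _] /hC/andP[yC _]]; exact: h2.
  have hC x : x \in @inr X X @^-1: (f @: C) -> (x \in C) && P2 x.
    rewrite inE => /imsetP[y yC]; rewrite /f; case: ifP => // Py [->]; rewrite yC.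
    by have := h1 _ yC; rewrite PE Py.
  split=> [x /hC/andP[]//|x y /hC/andP[xC _] /hC/andP[yC _]]; exact: h2.
case=> /cliquesP[a1 a2] /cliquesP[b1 b2].
have fl x : P1 x -> f x = inl x by rewrite /f => ->.
have fr x : P2 x -> f x = inr x.
  by move=> p2; rewrite /f; case: ifP => // p1; case: (dis x).
exists (f @^-1: T).
  have hT x : x \in f @^-1: T -> (P1 x /\ x \in @inl X X @^-1: T) \/ (P2 x /\ x \in @inr X X @^-1: T).
    rewrite !inE {1}/f; case: ifP => p1 xT; first by left.
    by right; split; [apply: b1; rewrite inE|].
  apply/cliquesP; split=> [x /hT[] [h _]|x y]; rewrite ?PE ?h ?orbT //.
  move=> /hT[] [px xT] /hT[] [py yT] xy.
  - exact: a2.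
  - exact: cr.
  - by rewrite rs; apply: cr.
  - exact: b2.
apply/setP=> z; apply/idP/imsetP => [zT|[x]]; last by rewrite inE => + ->.
case: z zT => x xT.
  have p1 : P1 x by apply: a1; rewrite inE.
  by exists x; rewrite ?inE fl.
have p2 : P2 x by apply: b1; rewrite inE.
by exists x; rewrite ?inE fr.
Qed.

Lemma comb_equiv_joinC X Y (K : {set {set X}}) (L : {set {set Y}}) :
  is_complex K -> is_complex L -> comb_equiv (join K L) (join L K).
Proof.
move=> cK cL; pose f (z : X + Y) : Y + X := match z with inl x => inr x | inr y => inl y end.
have fi : injective f by case=> [a|a] [b|b] //= [->].
have := CE_iso (is_complex_join cK cL) fi; congr comb_equiv.
have eL (T : {set Y + X}) : @inl X Y @^-1: (f @^-1: T) = @inr Y X @^-1: T by apply/setP=> x; rewrite !inE.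
have eR (T : {set Y + X}) : @inr X Y @^-1: (f @^-1: T) = @inl Y X @^-1: T by apply/setP=> x; rewrite !inE.
apply/setP=> T; rewrite inE; apply/imsetP/andP.
  case=> C; rewrite inE => /andP[h1 h2] eT.
  have CE : f @^-1: T = C by apply/setP=> z; rewrite inE eT mem_imset.
  by rewrite -CE eL in h1; rewrite -CE eR in h2.
case=> h1 h2; exists (f @^-1: T); first by rewrite inE eL eR h2.
apply/setP=> z; apply/idP/imsetP => [zT|[x]]; last by rewrite inE => + ->.
by case: z zT => x xT; [exists (inr x)|exists (inl x)]; rewrite ?inE.
Qed.

End Cliques.

(* Combinatorial spheres and their joins *)
Hint Resolve is_complex_cliques : core.

(** Boundary of the cross-polytope, the [m]-fold join of a pair of points. With this model of the
    sphere of dimension [m - 1] joins are additive in [m], and [m = 0] gives the complex without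
    vertices. *)
Definition crosspoly (m : nat) : {set {set 'I_m * bool}} :=
  cliques (fun=> true) (fun x y => x.1 != y.1).

Lemma is_complex_crosspoly m : is_complex (crosspoly m).
Proof. exact: is_complex_cliques. Qed.
Hint Resolve is_complex_crosspoly : core.

Definition sphere (m : nat) (X : finType) (K : {set {set X}}) := comb_equiv (crosspoly m) K.

Section Spheres.
Implicit Types X Y : finType.

Lemma sphere_empty X (P : pred X) (r : rel X) : (forall x, ~~ P x) -> sphere 0 (cliques P r).
Proof.
move=> P0; have f : 'I_0 * bool -> X by case=> -[].
by apply: (cliques_iso (f := f)) => [[[]]//|[[]]//|y|[[]]//]; rewrite (negPf (P0 y)).
Qed.

Lemma sphere_pair X (P : pred X) (r : rel X) u v : u != v ->
  (forall x, P x = (x == u) || (x == v)) -> ~~ r u v -> ~~ r v u -> sphere 1 (cliques P r).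
Proof.
move=> uv PE ruv rvu; pose f (z : 'I_1 * bool) := if z.2 then u else v.
apply: (cliques_iso (f := f)).
- move=> [i b] [j c] _ _; rewrite /f (ord1 i) (ord1 j); case: b; case: c => //= e.
    by rewrite e eqxx in uv.
  by rewrite e eqxx in uv.
- by move=> [i b] _; rewrite /f PE; case: b => /=; rewrite eqxx ?orbT.
- move=> y; rewrite PE => /orP[]/eqP->; first by exists (ord0, true).
  by exists (ord0, false).
- move=> [i b] [j c] _ _; rewrite /f (ord1 i) (ord1 j) /= ?eqxx.
  by case: b; case: c => //= _; apply: negPf.
Qed.

Lemma crosspoly_add a b : comb_equiv (crosspoly (a + b)) (join (crosspoly a) (crosspoly b)).
Proof.
set r : rel ('I_(a + b) * bool) := fun x y => x.1 != y.1.
pose P1 (x : 'I_(a + b) * bool) := x.1 < a.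
have h1 : comb_equiv (crosspoly a) (cliques P1 r).
  apply: (cliques_iso (f := fun z => (lshift b z.1, z.2))).
  - by move=> [i c] [j d] _ _ [] /ord_inj-> ->.
  - by move=> [i c] _; rewrite /P1 /=.
  - by move=> [i c] lt; exists (Ordinal lt, c) => //; congr pair; apply: val_inj.
  - by move=> [i c] [j d].
have h2 : comb_equiv (crosspoly b) (cliques (predC P1) r).
  apply: (cliques_iso (f := fun z => (rshift a z.1, z.2))).
  - by move=> [i c] [j d] _ _ [] /eqP; rewrite eqn_add2l => /eqP/ord_inj-> ->.
  - by move=> [i c] _; rewrite /P1 /= -leqNgt leq_addr.
  - move=> [i c]; rewrite /P1 /= -leqNgt => le.
    have lt : i - a < b by rewrite ltn_subLR.
    by exists (Ordinal lt, c) => //; congr pair; apply: val_inj; rewrite /= subnKC.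
  - by move=> [i c] [j d] _ _ _; rewrite /r /= -!val_eqE /= eqn_add2l.
have h3 : comb_equiv (crosspoly (a + b)) (join (cliques P1 r) (cliques (predC P1) r)).
  apply: (@comb_equiv_split _ _ P1 (predC P1)).
  - by move=> x y; rewrite /r eq_sym.
  - by move=> x /=; rewrite orbN.
  - by move=> x /= ->.
  - by move=> x y; rewrite /P1 /r /= -leqNgt => lt le; apply/negP => /eqP e; move: lt; rewrite e ltnNge le.
apply: CE_trans h3 _.
apply: CE_trans (comb_equiv_join (CE_sym h1) (is_complex_cliques _ _)) _.
apply: CE_trans (comb_equiv_joinC _ _) _ => //.
apply: CE_trans (comb_equiv_join (CE_sym h2) (is_complex_cliques _ _)) _.
exact: comb_equiv_joinC.
Qed.

Lemma sphere_join a b X Y (K : {set {set X}}) (L : {set {set Y}}) :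
  is_complex K -> is_complex L -> sphere a K -> sphere b L -> sphere (a + b) (join K L).
Proof.
move=> cK cL hK hL; apply: CE_trans (crosspoly_add a b) _.
apply: CE_trans (comb_equiv_join hK (is_complex_cliques _ _)) _.
apply: CE_trans (comb_equiv_joinC _ _) _ => //.
apply: CE_trans (comb_equiv_join hL cK) _.
exact: comb_equiv_joinC.
Qed.

Lemma sphere_split a b X (P P1 P2 : pred X) (r : rel X) : symmetric r ->
  (forall x, P x = P1 x || P2 x) -> (forall x, P1 x -> P2 x -> False) ->
  (forall x y, P1 x -> P2 y -> r x y) ->
  sphere a (cliques P1 r) -> sphere b (cliques P2 r) -> sphere (a + b) (cliques P r).
Proof.
move=> rs PE dis cr h1 h2.
by apply: CE_trans (sphere_join _ _ h1 h2) (CE_sym (comb_equiv_split rs PE dis cr)).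
Qed.

Lemma is_complex_boundary d : is_complex (simplex_boundary d).
Proof.
apply/is_complexP; split; first by rewrite inE eq_sym -subset0; apply/negP => /subsetP/(_ ord0); rewrite !inE => /(_ isT).
move=> s t; rewrite !inE => sT ts; apply: contra sT => /eqP e.
by rewrite -subTset -e.
Qed.

(* Starring a facet turns the boundary of a simplex into the suspension of
   the boundary of that facet. *)
Lemma simplex_boundary_susp d :
  comb_equiv (simplex_boundary d.+1) (join (simplex_boundary d) (simplex_boundary 0)).
Proof.
set K := simplex_boundary d.+1; have cK : is_complex K := is_complex_boundary _.
pose sigma : {set 'I_d.+3} := [set~ ord_max].
have sK : sigma \in K by rewrite inE; apply/negP => /eqP/setP/(_ ord_max); rewrite !inE eqxx.
have s0 : sigma != set0 by apply/set0Pn; exists ord0; rewrite !inE -val_eqE.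
apply: CE_trans (CE_stellar cK sK s0) _; apply: CE_sym.
pose f (z : 'I_d.+2 + 'I_2) : option 'I_d.+3 :=
  match z with inl i => Some (lift ord_max i)
             | inr j => if j == ord0 then None else Some ord_max end.
have fi : injective f.
  move=> [i|i] [j|j] //=; first by move=> /Some_inj/lift_inj->.
  - by case: eqP => // _ /Some_inj e; have := neq_lift ord_max i; rewrite e eqxx.
  - by case: eqP => // _ /Some_inj e; have := neq_lift ord_max j; rewrite -e eqxx.
  have ord2 (k l : 'I_2) : (k == ord0) = (l == ord0) -> k = l.
    by case: k => -[|[|]] // pk; case: l => -[|[|]] // pl _; apply: val_inj.
  by move=> e; congr inr; apply: ord2; move: e; case: eqP; case: eqP.
have cJ := is_complex_join (is_complex_boundary d) (is_complex_boundary 0).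
have := CE_iso cJ fi; congr comb_equiv.
pose g (z : option 'I_d.+3) : 'I_d.+2 + 'I_2 :=
  if z is Some k then (if unlift ord_max k is Some i then inl i else inr ord_max) else inr ord0.
have gK : cancel g f.
  case=> [k|] //=; case: unliftP => [i ->|->] //=.
apply/setP=> T.
have -> : (T \in [set f @: t | t : {set 'I_d.+2 + 'I_2} in
            join (simplex_boundary d) (simplex_boundary 0)])
    = (f @^-1: T \in join (simplex_boundary d) (simplex_boundary 0)).
  have fT : f @: (f @^-1: T) = T.
    apply/setP=> z; apply/imsetP/idP => [[u]|zT]; first by rewrite inE => + ->.
    by exists (g z); rewrite ?inE gK.
  apply/imsetP/idP => [[U UK ->]|h]; last by exists (f @^-1: T).
  suff -> : f @^-1: (f @: U) = U by [].
  by apply/setP=> z; rewrite inE mem_imset.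
rewrite in_stellar //= !inE.
have -> : (sigma \subset @Some _ @^-1: T) = (@inl _ 'I_2 @^-1: (f @^-1: T) == [set: 'I_d.+2]).
  rewrite -subTset; apply/subsetP/subsetP => h x; last first.
    by rewrite !inE; case: (unliftP ord_max x) => [i ->|->]; rewrite ?eqxx // => _; have := h i; rewrite !inE; apply.
  by move=> _; have := h (lift ord_max x); rewrite !inE /=; apply; rewrite eq_sym neq_lift.
apply: andb_id2l => nT.
have E2 : (@inr 'I_d.+2 'I_2 @^-1: (f @^-1: T) == [set: 'I_2]) = (None \in T) && (Some ord_max \in T).
  rewrite -subTset; apply/subsetP/andP => [h|[hN hM] j _].
    by have := h ord0 (in_setT _); have := h ord_max (in_setT _); rewrite !inE /=.
  by rewrite !inE /=; case: eqP.
rewrite E2; case NT: (None \in T) => /=.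
  congr negb; apply/idP/eqP => [hM|/setP/(_ ord_max)]; last by rewrite !inE eqxx orbF.
  apply/setP=> k; rewrite !inE; case: eqP => [->|]; rewrite ?hM ?orbT //.
apply/esym; apply: contra nT => /eqP/setP e; apply/eqP/setP=> i.
by have := e (lift ord_max i); rewrite !inE.
Qed.

Lemma sphere_boundary d : sphere d.+1 (simplex_boundary d).
Proof.
have h0 : sphere 1 (simplex_boundary 0).
  have -> : simplex_boundary 0 = cliques (fun=> true) (fun _ _ : 'I_2 => false).
    apply/setP=> t; rewrite inE; apply/idP/cliquesP => [nt|[_ h]].
      split=> // x y xt yt xy; case/negP: nt; rewrite -subTset; apply/subsetP=> z _.
      suff : (z == x) || (z == y) by case/orP=> /eqP->.
      by case: x {xt} xy => -[|[|]] // px; case: y {yt} => -[|[|]] // py; case: z => -[|[|]].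
    by apply/negP => /eqP e; have := h ord0 ord_max; rewrite e !inE => /(_ isT isT isT).
  apply: (@sphere_pair _ _ _ ord0 ord_max) => //.
  by case=> -[|[|]].
elim: d => [//|d IH].
have h : sphere (d.+1 + 1) (simplex_boundary d.+1).
  apply: CE_trans (sphere_join _ _ IH h0) (CE_sym (simplex_boundary_susp d)); exact: is_complex_boundary.
by move: h; rewrite /sphere addn1.
Qed.

Lemma pl_sphereP d X (K : {set {set X}}) : sphere d.+1 K -> pl_sphere d K.
Proof. exact: CE_trans (CE_sym (sphere_boundary d)). Qed.

(* The apex [g] is joined to [Q] after collapsing the midpoints [nn q] of the
   edges [g q], in an order compatible with [le]. *)
Lemma cliques_cone X (P Q : pred X) (r le : rel X) (g : X) (nn : X -> X) (rk : X -> nat) :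
  symmetric r -> P g -> ~~ Q g -> (forall q, Q q -> P q) ->
  (forall q, Q q -> [/\ P (nn q), ~~ Q (nn q) & nn q != g]) ->
  (forall q q', Q q -> Q q' -> nn q = nn q' -> q = q') ->
  (forall q, Q q -> ~~ r g q) -> (forall q, Q q -> r g (nn q)) ->
  (forall q, Q q -> le q q) ->
  (forall q q', Q q -> Q q' -> q != q' -> le q q' -> rk q < rk q') ->
  (forall x q, Q x -> Q q -> r x (nn q) = le x q) ->
  (forall x q, Q x -> Q q -> x != q -> r x q = le x q || le q x) ->
  (forall q q', Q q -> Q q' -> q != q' -> r (nn q) (nn q') = le q q' || le q' q) ->
  (forall x q, P x -> ~~ Q x -> x != g -> (forall q', Q q' -> x != nn q') -> Q q ->
     r x (nn q) = r x g && r x q) ->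
  comb_equiv (cliques (fun x => P x && ~~ [exists q, Q q && (x == nn q)])
                (fun x y => r x y || (x == g) && Q y || (y == g) && Q x))
             (cliques P r).
Proof.
move=> rs Pg nQg QP nnP nni rgq rgn le0 lerk rnn rQ rnn2 rother.
(* At stage [D] the midpoint [nn q] is present exactly for the [q] in [D]; for the other [q] the
   edge from [g] to [q] is still whole. [D] grows from the empty set to all of [Q]. *)
pose PD (D : {set X}) x := P x && ~~ [exists q, (q \notin D) && Q q && (x == nn q)].
pose rD (D : {set X}) x y := r x y || (x == g) && (Q y && (y \notin D)) || (y == g) && (Q x && (x \notin D)).
pose good (D : {set X}) := (forall q, q \in D -> Q q) /\
   (forall q q', Q q -> Q q' -> q \in D -> rk q < rk q' -> q' \in D).
have rDs D : symmetric (rD D) by move=> x y; rewrite /rD rs -!orbA; congr (_ || _); rewrite orbC.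
suff main D : good D -> comb_equiv (cliques (PD D) (rD D)) (cliques P r).
  have g0 : good set0 by split=> q; rewrite inE.
  have -> : cliques (fun x => P x && ~~ [exists q, Q q && (x == nn q)])
     (fun x y => r x y || (x == g) && Q y || (y == g) && Q x) = cliques (PD set0) (rD set0).
    apply: cliques_ext => [x|x y _ _ _]; last by rewrite /rD !inE !andbT.
    by congr (_ && ~~ _); apply: eq_existsb => q; rewrite inE.
  exact: main.
have [k] := ubnP #|[set q | Q q] :\: D|; elim: k D => // k IH D /ltnSE lek gD.
have [/eqP|/set0Pn[q0 q0D]] := boolP ([set q | Q q] :\: D == set0).
  move/setP=> e; have QD q : Q q -> q \in D by move=> Qq; have := e q; rewrite !inE Qq andbT => /negbFE.
  rewrite [X in comb_equiv X _](_ : _ = cliques P r); first exact: comb_refl.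
  apply: cliques_ext => [x|x y _ _ _].
    rewrite /PD; have -> : [exists q, (q \notin D) && Q q && (x == nn q)] = false.
      by apply/existsP => -[q /andP[/andP[nD Qq] _]]; rewrite QD in nD.
    by rewrite andbT.
  rewrite /rD; have qD z : Q z && (z \notin D) = false.
    by apply/negP => /andP[/QD->].
  by rewrite !qD !andbF !orbF.
(* Taking [q] of maximal rank gives the edge [g q] the right link: the elements of [Q] in it are
   those below [q], since those above are already in [D] and no longer joined to [g]. *)
case: (@arg_maxnP _ q0 (mem ([set q | Q q] :\: D)) rk q0D) => q; rewrite !inE => /andP[qD Qq] qmax.
have {}qmax q' : Q q' -> q' \notin D -> rk q' <= rk q.
  by move=> Qq' q'D; apply: qmax; rewrite !inE q'D.
have gD' : good (q |: D).
  case: gD => gD1 gD2; split=> [q'|q1 q2 Q1 Q2]; first by rewrite !inE => /orP[/eqP->|/gD1].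
  rewrite !inE => /orP[/eqP-> lt|D1 lt]; last by rewrite (gD2 q1 q2) ?orbT.
  by apply/orP; right; apply: contraTT lt => n2; rewrite -leqNgt qmax.
have lek' : #|[set q | Q q] :\: (q |: D)| < k.
  apply: leq_trans lek; apply: proper_card; apply/properP; split.
    by apply: setDS; apply: subsetUr.
  by exists q; rewrite !inE ?eqxx ?qD ?Qq.
apply: CE_trans _ (IH _ lek' gD').
have [Pn nQn ng] := nnP q Qq.
have qg : q != g by apply: contra nQg => /eqP<-.
have nnq : nn q != q by apply: contra nQn => /eqP->.
apply: (@cliques_subdiv _ _ _ _ _ (nn q) g q) => //.
- rewrite /PD Pn /= negbK; apply/existsP; exists q; by rewrite qD Qq eqxx.
- rewrite /PD Pg /=; apply/negP => /existsP[q' /andP[/andP[_ Q'] /eqP e]].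
  by have [_ _] := nnP q' Q'; rewrite -e eqxx.
- rewrite /PD QP //=; apply/negP => /existsP[q' /andP[/andP[_ Q'] /eqP e]].
  by have [_] := nnP q' Q'; rewrite -e Qq.
- by rewrite eq_sym.
- by rewrite /rD eqxx Qq qD orbT.
- move=> x; rewrite /PD; have [->|xn] := eqVneq x (nn q).
    rewrite Pn orbT /=; apply/negP => /existsP[q' /andP[/andP[nD' Q'] /eqP e]].
    by rewrite (nni _ _ Qq Q' e) !inE eqxx in nD'.
  rewrite orbF; congr (_ && ~~ _); apply/existsP/existsP => -[q' /andP[/andP[nD' Q'] e]]; exists q'.
    by move: nD'; rewrite !inE negb_or => /andP[_ ->]; rewrite Q' e.
  rewrite !inE negb_or nD' Q' e !andbT; apply: contra xn => /eqP h; by rewrite -h.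
- move=> x y Px Py xy; rewrite /rD !inE.
  have [xg|xg] /= := eqVneq x g; have [yg|yg] /= := eqVneq y g.
  + by rewrite xg yg eqxx in xy.
  + have [->|yq] := eqVneq y q; rewrite xg ?Qq ?qD ?(negPf (rgq _ Qq)) ?andbF ?orbF ?andbT //=.
  + have [->|xq] := eqVneq x q; rewrite yg ?Qq ?qD 1?[r q g]rs ?(negPf (rgq _ Qq)) ?andbF ?orbF ?andbT //=.
  + by rewrite !orbF andbF andbT.
- move=> x Px; have [Px1 /negP nex] := andP Px.
  have [xg|xg] := eqVneq x g; first by rewrite /rD xg rgn.
  have [xq|xq] /= := eqVneq x q; first by rewrite /rD xq rnn // le0.
  rewrite /rD (negPf xg) (negPf qg) (negPf ng) eqxx /= !orbF.
  have [Qx|nQx] /= := boolP (Q x).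
    rewrite rnn // rs (negPf (rgq _ Qx)) /=.
    have [xD|xD] /= := boolP (x \in D).
      apply/negP => /(lerk _ _ Qx Qq xq) lt; case: gD => _ /(_ _ _ Qx Qq xD lt).
      by rewrite (negPf qD).
    rewrite rQ //; have [//|_] /= := boolP (le x q).
    apply/esym/negP => le'; have := lerk q x Qq Qx; rewrite eq_sym => /(_ xq le').
    by rewrite ltnNge qmax.
  rewrite orbF.
  have [/existsP[q' /andP[Q' /eqP xe]]|nn'] := boolP [exists q', Q q' && (x == nn q')].
    have q'D : q' \in D.
      by apply/negPn/negP => nD'; apply: nex; apply/existsP; exists q'; rewrite nD' Q' xe eqxx.
    have q'q : q' != q by apply: contra qD => /eqP<-.
    have nle : le q' q = false.
      apply/negP => /(lerk _ _ Q' Qq q'q) lt; case: gD => _ /(_ _ _ Q' Qq q'D lt).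
      by rewrite (negPf qD).
    by rewrite xe rnn2 // nle rs rgn //= rs rnn.
  apply: rother => // q' Q'; apply: contra nn' => /eqP->; apply/existsP; exists q'.
  by rewrite Q' eqxx.
Qed.

End Spheres.

Definition nested (T : finType) (B B' : {set T}) := (B \subset B') || (B' \subset B).

Lemma nestedC (T : finType) : symmetric (@nested T).
Proof. by move=> B B'; rewrite /nested orbC. Qed.

(* The barycentric subdivision of the boundary of a simplex is the suspension
   of that of a facet [E], subdivided along the cone from the opposite vertex. *)
Lemma sphere_subsets (T : finType) (B0 : {set T}) : 0 < #|B0| ->
  sphere #|B0|.-1 (cliques (fun B => (B != set0) && (B \proper B0)) (@nested T)).
Proof.
have [k] := ubnP #|B0|; elim: k B0 => // k IH B0 /ltnSE lek.
rewrite card_gt0 => /set0Pn[c cB0]; set E := B0 :\ c.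
have cE : #|B0| = #|E|.+1 by rewrite (cardsD1 c) cB0.
have cnE : c \notin E by rewrite !inE eqxx.
have B0E : B0 = c |: E by rewrite setD1K.
rewrite cE /=; have [E0|En] := posnP #|E|.
  rewrite E0; apply: sphere_empty => B; apply/negP => /andP[B0' /proper_card].
  by rewrite cE E0 ltnS leqn0 cards_eq0 (negPf B0').
have {}IH := IH E _ En; move: lek; rewrite cE => /IH {}IH.
pose P (B : {set T}) := (B != set0) && (B \proper B0).
pose Q (B : {set T}) := (B != set0) && (B \proper E).
have Qc B : Q B -> c \notin B.
  by case/andP=> _ /proper_sub/subsetP h; apply: contra cnE => /h.
have QP B : Q B -> P B.
  by case/andP=> B0' Bp; rewrite /P B0' (proper_sub_trans Bp) // B0E subsetUr.
have g0 : [set c] != set0 by apply/set0Pn; exists c; rewrite inE.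
have gp : [set c] \proper B0 by rewrite properEcard sub1set cB0 cards1 cE ltnS.
have subc (B B' : {set T}) : c \notin B' -> (c |: B \subset B') = false.
  by move=> nc; apply/negP => /subsetP/(_ c); rewrite setU11 (negPf nc) => /(_ isT).
have subcc (B B' : {set T}) : c \notin B -> (B \subset c |: B') = (B \subset B').
  move=> nc; apply/idP/idP => [/subsetP h|]; last by move=> /subset_trans; apply; apply: subsetUr.
  by apply/subsetP=> z zB; have := h z zB; rewrite !inE => /orP[/eqP e|//]; rewrite -e zB in nc.
have subccc (B B' : {set T}) : c \notin B -> (c |: B \subset c |: B') = (B \subset B').
  by move=> nc; rewrite subUset sub1set setU11 subcc.
have key : comb_equiv (cliques (fun x => P x && ~~ [exists q, Q q && (x == c |: q)])
   (fun x y => nested x y || (x == [set c]) && Q y || (y == [set c]) && Q x)) (cliques P (@nested T)).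
  apply: (@cliques_cone _ P Q (@nested T) (fun B B' => B \subset B') [set c] (fun B => c |: B) (fun B => #|B|)).
  - exact: nestedC.
  - by rewrite /P g0.
  - by apply/negP => /Qc; rewrite inE eqxx.
  - exact: QP.
  - move=> B QB; have cB := Qc _ QB; case/andP: (QB) => B0' Bp; split.
    + rewrite /P; apply/andP; split; first by apply/set0Pn; exists c; rewrite setU11.
      by rewrite properEcard B0E setUS ?(proper_sub Bp) // !cardsU1 cB cnE !add1n ltnS proper_card.
    + by apply/negP => /Qc; rewrite setU11.
    + apply: contra B0' => /eqP e; apply/eqP/setP=> z; rewrite inE; apply/negP => zB.
      have : z \in c |: B by rewrite inE zB orbT.
      by rewrite e inE => /eqP e2; rewrite -e2 zB in cB.
  - move=> B B' /Qc h /Qc h' /setP e; apply/setP=> z; have := e z; rewrite !inE.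
    by have [->|] := eqVneq z c; rewrite ?(negPf h) ?(negPf h').
  - move=> B QB; have cB := Qc _ QB; rewrite /nested sub1set (negPf cB) /=.
    case/andP: QB => /set0Pn[d dB] _; apply/negP => /subsetP/(_ d dB); rewrite inE => /eqP e.
    by rewrite -e dB in cB.
  - by move=> B QB; rewrite /nested sub1set setU11.
  - by [].
  - by move=> B B' _ _ ne s; apply: proper_card; rewrite properEneq ne.
  - by move=> B B' /Qc h /Qc h'; rewrite /nested subc // orbF subcc.
  - by [].
  - by move=> B B' /Qc h /Qc h' _; rewrite /nested !subccc.
  - move=> B B'; case/andP=> B0' Bp nQ nc nn QB'.
    have BE : B = E.
      have [cB|cB] := boolP (c \in B).
        have QB : Q (B :\ c).
          rewrite /Q; apply/andP; split.
            apply: contra nc => /eqP e; apply/eqP/setP=> z; have /setP/(_ z) := e; rewrite !inE.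
            by have [->|_] := eqVneq z c; rewrite ?cB.
          rewrite properEcard (subset_trans (setSD _ (proper_sub Bp))) //=.
          by have := proper_card Bp; rewrite cE (cardsD1 c B) cB ltnS.
        by have := nn _ QB; rewrite setD1K // eqxx.
      apply/eqP; move: nQ; rewrite /Q B0' /= properEneq.
      have -> : B \subset E.
        by apply/subsetP=> z zB; rewrite !inE (subsetP (proper_sub Bp)) // andbT; apply: contra cB => /eqP <-.
      by rewrite andbT negbK.
    rewrite BE /nested subc // orbF subcc // sub1set (negPf cnE) orbF.
    have -> : (E \subset B') = false.
      by apply/negP; case/andP: QB' => _; rewrite properE => /andP[_ /negP].
    have -> : (E \subset [set c]) = false; last by [].
    move: En; rewrite card_gt0 => /set0Pn[d dE]; apply/negP => /subsetP/(_ d dE).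
    by rewrite inE => /eqP e; rewrite -e dE in cnE.
(* Without the midpoints the vertices left are the proper faces of [E], then [E] itself and the apex
   [[set c]]: a suspension with the last two as poles. *)
move: key; set r0 := (X in cliques _ X); set P0 := (X in cliques X r0) => key.
suff : sphere (#|E|.-1 + 1) (cliques P0 r0).
  by rewrite addn1 prednK // => h; apply: CE_trans h key.
have gE : [set c] != E by apply/eqP => e; rewrite -e inE eqxx in cnE.
have E0 : E != set0 by rewrite -card_gt0.
have QE : Q E = false by rewrite /Q properxx andbF.
have Qg : Q [set c] = false by apply/negP => /Qc; rewrite inE eqxx.
have r0s : symmetric r0 by move=> x y; rewrite /r0 [nested y x]nestedC -orbA -[RHS]orbA [X in _ || X]orbC.
apply: (@sphere_split _ _ _ P0 Q (fun B => (B == E) || (B == [set c]))) => //.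
- move=> B; rewrite /P0; apply/andP/idP.
    case=> PB nex; have [//|nQ] /= := boolP (Q B); have [//|nc] /= := eqVneq B [set c]; first by rewrite orbT.
    rewrite orbF; case/andP: PB => B0' Bp.
    have [cB|cB] := boolP (c \in B).
      case/negP: nex; apply/existsP; exists (B :\ c); rewrite setD1K // eqxx andbT.
      rewrite /Q; apply/andP; split.
        apply: contra nc => /eqP e; apply/eqP/setP=> z; have /setP/(_ z) := e; rewrite !inE.
        by have [->|_] := eqVneq z c; rewrite ?cB.
      rewrite properEcard (subset_trans (setSD _ (proper_sub Bp))) //=.
      by have := proper_card Bp; rewrite cE (cardsD1 c B) cB ltnS.
    move: nQ; rewrite /Q B0' /= properEneq.
    have -> : B \subset E.
      by apply/subsetP=> z zB; rewrite !inE (subsetP (proper_sub Bp)) // andbT; apply: contra cB => /eqP <-.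
    by rewrite andbT negbK.
  have nex (z : {set T}) : c \notin z -> ~~ [exists q, Q q && (z == c |: q)].
    by move=> nc; apply/negP => /existsP[q /andP[_ /eqP e]]; rewrite e setU11 in nc.
  case/or3P=> [QB|/eqP->|/eqP->].
  + by rewrite QP // nex // Qc.
  + rewrite nex // /P E0 properEcard cE ltnSn andbT; split=> //.
    by rewrite B0E subsetUr.
  + rewrite /P g0 gp; split=> //; apply/negP => /existsP[q /andP[Qq /eqP/setP e]].
    have := Qc _ Qq; case/andP: Qq => /set0Pn[d dq] _; have := e d; rewrite !inE dq orbT => /eqP<-.
    by rewrite dq.
- by move=> B QB /orP[]/eqP e; rewrite e ?QE ?Qg in QB.
- move=> B B' QB /orP[]/eqP->; rewrite /r0 /nested.
    by case/andP: QB => _ /proper_sub->.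
  by rewrite eqxx QB orbT.
- rewrite [cliques _ _](_ : _ = cliques Q (@nested T)) //.
  apply: cliques_ext => // x y Qx Qy _; rewrite /r0.
  have -> : (x == [set c]) = false by apply/eqP => e; rewrite e Qg in Qx.
  have -> : (y == [set c]) = false by apply/eqP => e; rewrite e Qg in Qy.
  by rewrite !orbF.
have ngE : ~~ r0 E [set c].
  rewrite /r0 QE Qg !andbF !orbF /nested sub1set (negPf cnE) orbF.
  move: En; rewrite card_gt0 => /set0Pn[d dE]; apply/negP => /subsetP/(_ d dE).
  by rewrite inE => /eqP e; rewrite -e dE in cnE.
apply: (@sphere_pair _ _ _ E [set c]) => //; first by rewrite eq_sym.
by rewrite r0s.
Qed.

(** * Dual complexes of forests *)

Section Faces.
Variables (q N : nat).
Implicit Types (s : cgraph q N) (A E : {set 'I_q.+1}) (F : tface q N).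

Definition cls s E z : {set 'I_N} := [set y | conn s E z y].

(* Faces [(E, S)] of the dual complex of a block [S0] with colours [A], indexed
   by the set [E] of the colours kept (the complement of the vertex colours). *)
Definition blockface s A (S0 : {set 'I_N}) F :=
  [&& F.1 \proper A, F.2 \subset S0 & [exists z, F.2 == cls s F.1 z]].

Definition fadj F F' :=
  (F.1 \subset F'.1) && (F.2 \subset F'.2) || (F'.1 \subset F.1) && (F'.2 \subset F.2).

Lemma fadjC : symmetric fadj.
Proof. by move=> F F'; rewrite /fadj orbC. Qed.

Lemma cls_self s E z : z \in cls s E z.
Proof. by rewrite inE conn_refl. Qed.

Lemma cls_same s E z y : matched s -> y \in cls s E z -> cls s E y = cls s E z.
Proof. by move=> ms; rewrite inE => h; apply/esym/eqP; rewrite cls_eq //; apply: conn_equiv. Qed.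

Lemma cls0 s z : cls s set0 z = [set z].
Proof.
apply/setP=> y; rewrite !inE; apply/idP/eqP => [h|->]; last exact: conn_refl.
have : y \in [set z] by apply: conn_closed h; rewrite ?inE // => ? ?; rewrite !inE.
by rewrite inE => /eqP.
Qed.

Lemma cls1 s c z : matched s -> cls s [set c] z = [set z; s c z].
Proof.
move=> ms; apply/setP=> y; rewrite [LHS]inE; apply/idP/idP => [h|].
  apply: conn_closed h; last by rewrite !inE eqxx.
  move=> t d; rewrite !inE => /orP[]/eqP-> /eqP->; rewrite ?eqxx ?orbT //.
  by rewrite matchedK // eqxx.
by rewrite !inE => /orP[]/eqP->; [apply: conn_refl|apply: conn_step; rewrite inE].
Qed.

Lemma cls_subset s E E' z : E \subset E' -> cls s E z \subset cls s E' z.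
Proof. by move=> sE; apply/subsetP=> y; rewrite !inE; apply: conn_subset. Qed.

Lemma eq_cls s s' E z : (forall c, c \in E -> s c = s' c) -> cls s E z = cls s' E z.
Proof. by move=> h; apply/setP=> y; rewrite !inE (conn_eqs h). Qed.

Lemma blockface_cls s A S0 F z : matched s -> blockface s A S0 F -> z \in F.2 -> F.2 = cls s F.1 z.
Proof. by move=> ms /and3P[_ _ /existsP[t /eqP->]] zt; rewrite (cls_same ms zt). Qed.

Lemma fadj_point F x : fadj F (set0, [set x]) = (x \in F.2) || (F == (set0, [set x])) || (F == (set0, set0)).
Proof.
rewrite /fadj sub0set /= sub1set subset0 orbC -orbA; congr (_ || _).
rewrite subset1; case: F => E S; rewrite !xpair_eqE /=.
by case: (E == set0).
Qed.

Lemma sphere_one s c z : matched s ->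
  sphere 1 (cliques (blockface s [set c] (cls s [set c] z)) fadj).
Proof.
move=> ms; have ne := matched_neq c z ms.
have adj u v : u != v -> ~~ fadj (set0, [set u]) (set0, [set v]).
  by move=> uv; rewrite /fadj !sub1set !inE !(eq_sym v) (negPf uv) !andbF.
apply: (@sphere_pair _ _ _ (set0, [set z]) (set0, [set s c z])).
- by rewrite xpair_eqE eqxx /= eqEsubset !sub1set !inE (negPf ne) andbF.
- case=> E S; rewrite /blockface /= cls1 // properE subset1 sub1set.
  have [->|nE] /= := eqVneq E set0; last first.
    by rewrite !xpair_eqE (negPf nE) orbF /=; have [->|] //= := eqVneq E [set c]; rewrite inE eqxx.
  rewrite orbT inE /= !xpair_eqE eqxx /=; apply/andP/orP.
    case=> sS /existsP[y /eqP e]; rewrite e cls0 sub1set !inE in sS.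
    by rewrite e cls0; case/orP: sS => /eqP->; rewrite eqxx; [left|right].
  by case=> /eqP->; rewrite sub1set !inE eqxx ?orbT; split=> //; apply/existsP;
    [exists z|exists (s c z)]; rewrite cls0.
- by apply: adj; rewrite eq_sym.
- exact: adj.
Qed.

Lemma sphere_none s S0 : sphere 0 (cliques (blockface s set0 S0) fadj).
Proof. by apply: sphere_empty => F; apply/negP => /and3P[/proper_card]; rewrite cards0. Qed.

(** In a single melon every nonempty set of colours has the same class [[set z; z']], so these faces
    are distinguished by their colours and form the boundary of a simplex; the two vertices [z] and
    [z'] suspend it. *)
Lemma sphere_melon s A z : matched s -> ord0 \notin A ->
  (forall c y, c \in A -> fixedc s c y) -> A != set0 ->
  sphere #|A| (cliques (blockface s A (cls s A z)) fadj).
Proof.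
move=> ms A0 fx An; pose z' := s ord0 z.
have ne : z' != z := matched_neq ord0 z ms.
have clsE E : E \subset A -> E != set0 -> cls s E z = [set z; z'].
  move=> EA /set0Pn[c cE]; apply/eqP; rewrite eqEsubset; apply/andP; split.
    apply/subsetP=> y; rewrite inE => h; apply: conn_closed h; last by rewrite !inE eqxx.
    move=> t d + dE; rewrite !inE (eqP (fx d t (subsetP EA _ dE))) => /orP[]/eqP->.
      by rewrite eqxx orbT.
    by rewrite /z' matchedK // eqxx.
  rewrite subUset !sub1set cls_self inE /z' -(eqP (fx c z (subsetP EA _ cE))).
  exact: conn_step.
have clsE' E : E \subset A -> E != set0 -> cls s E z' = [set z; z'].
  by move=> EA En; rewrite -(clsE E) //; apply: cls_same => //; rewrite clsE // !inE eqxx orbT.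
pose P1 F := [&& F.1 != set0, F.1 \proper A & F.2 == [set z; z']].
pose P2 F := (F == (set0, [set z])) || (F == (set0, [set z'])).
have An' : 0 < #|A| by rewrite card_gt0.
rewrite -(prednK An') -addn1.
apply: (@sphere_split _ _ _ _ P1 P2).
- exact: fadjC.
- case=> E S; rewrite /blockface /P1 /P2 /= clsE // !xpair_eqE.
  have [->|nE] /= := eqVneq E set0.
    rewrite proper0 An /=; apply/andP/orP.
      case=> sS /existsP[y /eqP e]; rewrite e cls0 sub1set !inE in sS.
      by rewrite e cls0; case/orP: sS => /eqP->; rewrite eqxx; [left|right].
    by case=> /eqP->; rewrite sub1set !inE eqxx ?orbT; split=> //; apply/existsP;
      [exists z|exists z']; rewrite cls0.
  rewrite orbF; have [Ep|//] /= := boolP (E \proper A); apply/andP/eqP.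
    case=> sS /existsP[y /eqP e].
    have : y \in [set z; z'] by apply: (subsetP sS); rewrite e cls_self.
    by rewrite e !inE => /orP[]/eqP->; rewrite ?clsE ?clsE' ?proper_sub.
  move=> ->; split=> //; apply/existsP; exists z.
  by rewrite clsE // proper_sub.
- by move=> F /and3P[n0 _ _] /orP[]/eqP e; rewrite e eqxx in n0.
- move=> F F' /and3P[n0 _ /eqP e] /orP[]/eqP->; rewrite fadj_point e !inE eqxx ?orbT //.
- apply: CE_trans (sphere_subsets An') _.
  apply: (cliques_iso (f := fun B => (B, [set z; z']))).
  + by move=> B B' _ _ [].
  + by move=> B /andP[h1 h2]; rewrite /P1 h1 h2 eqxx.
  + by move=> [E S] /and3P[h1 h2 /eqP h3]; exists E; rewrite ?h1 // -h3.
  + by move=> B B' _ _ _; rewrite /fadj /nested /= subxx !andbT.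
- apply: (@sphere_pair _ _ _ (set0, [set z]) (set0, [set z'])) => //.
  + by rewrite xpair_eqE eqxx /= eqEsubset !sub1set !inE (negPf ne) andbF.
  + by rewrite fadj_point /= inE !xpair_eqE eqxx /= eqEsubset !sub1set !inE (negPf ne) !andbF /= -subset0 sub1set inE.
  + by rewrite fadj_point /= inE !xpair_eqE eqxx /= eqEsubset !sub1set !inE eq_sym (negPf ne) /= -subset0 sub1set inE.
Qed.

(** * A melon insertion as a sequence of stellar moves *)

Section Melon.
Variables (G : cgraph q N) (a : 'I_N) (c c2 : 'I_q.+1) (A : {set 'I_q.+1}).
Hypotheses (mG : matched G) (A0 : ord0 \notin A) (cA : c \in A) (nf : ~~ fixedc G c a).
Hypothesis lf : forall c', c' \in A -> c' != c -> fixedc G c' a.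
Hypotheses (c2A : c2 \in A) (c2c : c2 != c).
Let b := G ord0 a.
Let x := G c a.
Let y := G c b.
Let H := cut G a c.
Let S1 := cls G A a.
Let S0 := cls H A x.
Let xh : tface q N := (set0, [set x]).
Let yh : tface q N := (set0, [set y]).
Let ah : tface q N := (set0, [set a]).
Let bh : tface q N := (set0, [set b]).
Let f1 : tface q N := ([set c], [set x; a]).
Let f2 : tface q N := ([set c], [set b; y]).
Let f : tface q N := ([set c], [set x; y]).
Let g : tface q N := (A :\ c, [set a; b]).
Let faceG := blockface G A S1.
Let faceH := blockface H A S0.
(** The 0-edge [a b] is a leaf attached through [c], so a face containing [a] and keeping [c] and a
    further colour contains all of [x], [a], [b], [y]. To each of them [nn] associates the face on
    [a b] alone obtained by giving up [c]. *)
Let Q F := [&& faceG F, [set c] \proper F.1 & a \in F.2].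
Let nn F : tface q N := (F.1 :\ c, [set a; b]).

Let ba : b != a. Proof. by have [] := cut_neqs mG nf. Qed.
Let xa : x != a. Proof. by have [] := cut_neqs mG nf. Qed.
Let xb : x != b. Proof. by have [] := cut_neqs mG nf. Qed.
Let ya : y != a. Proof. by have [] := cut_neqs mG nf. Qed.
Let yb : y != b. Proof. by have [] := cut_neqs mG nf. Qed.
Let xy : x != y. Proof. by rewrite /x /y (can_eq (matchedK c mG)) eq_sym. Qed.
Let c0 : c != ord0. Proof. exact: colA0 cA. Qed.
Let mH : matched H. Proof. exact: matched_cut. Qed.
Let Gx : G c x = a. Proof. by rewrite /x matchedK. Qed.
Let Gy : G c y = b. Proof. by rewrite /y matchedK. Qed.
Let Hx : H c x = y. Proof. exact: cutx. Qed.
Let Hy : H c y = x. Proof. exact: cuty. Qed.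

Let properc E : ([set c] \proper E) = (c \in E) && (E != [set c]).
Proof. by rewrite properEneq sub1set andbC eq_sym. Qed.

Let properc_ex E : [set c] \proper E -> exists2 c1, c1 \in E & c1 != c.
Proof. by case/properP=> _ [c1 c1E]; rewrite inE => h; exists c1. Qed.

Let Gother c' : c' \in A -> c' != c -> G c' a = b.
Proof. by move=> h1 h2; apply/eqP; apply: lf. Qed.

Let Gother' c' : c' \in A -> c' != c -> G c' b = a.
Proof. by move=> h1 h2; rewrite -(Gother h1 h2) matchedK. Qed.

Let conHG E u v : E \subset A -> [set c] \proper E -> u \notin [set a; b] ->
  conn H E u v = (v \notin [set a; b]) && conn G E u v.
Proof.
move=> /subsetP EA Ep uab; rewrite conn_cut_leaf //.
- by rewrite -/b (negPf uab).
- by move: Ep; rewrite properc => /andP[].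
- by move=> c' /EA; apply: lf.
- exact: properc_ex.
Qed.

Let conQ E : E \subset A -> [set c] \proper E ->
  [/\ conn G E a b, conn G E a x & conn G E a y].
Proof.
move=> /subsetP EA Ep; have [c1 c1E c1c] := properc_ex Ep.
have cE : c \in E by move: Ep; rewrite properc => /andP[].
have ab : conn G E a b by rewrite -(Gother (EA _ c1E) c1c); apply: conn_step.
split=> //; first exact: conn_step.
by apply: (conn_trans ab); apply: conn_step.
Qed.

Let clsHG E z : E \subset A -> [set c] \proper E -> z \notin [set a; b] ->
  cls H E z = cls G E z :\: [set a; b].
Proof.
move=> EA Ep zab; apply/setP=> v; rewrite [LHS]inE conHG // in_setD; congr (_ && _).
by rewrite [RHS]inE.
Qed.

Let clsGab E : E \subset A -> c \notin E -> E != set0 -> cls G E a = [set a; b].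
Proof.
move=> /subsetP EA cE /set0Pn[d dE].
have dc e : e \in E -> e != c by move=> eE; apply: contra cE => /eqP<-.
apply/eqP; rewrite eqEsubset; apply/andP; split.
  apply/subsetP=> z; rewrite inE => h; apply: conn_closed h; last by rewrite !inE eqxx.
  move=> t e; rewrite !inE => /orP[]/eqP-> eE; rewrite ?Gother ?Gother' ?eqxx ?orbT //; by [apply: EA|apply: dc].
rewrite subUset !sub1set cls_self inE -(Gother (EA _ dE) (dc _ dE)); exact: conn_step.
Qed.

Let Aproper : [set c] \proper A.
Proof. by apply/properP; rewrite sub1set; split=> //; exists c2; rewrite // inE. Qed.

Let Ac0 : A :\ c != set0.
Proof. by apply/set0Pn; exists c2; rewrite !inE c2c. Qed.

Let inS1 : [/\ a \in S1, b \in S1, x \in S1 & y \in S1].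
Proof.
by have [h1 h2 h3] := conQ (subxx A) Aproper; split; rewrite inE // conn_refl.
Qed.

Let S0E : S0 = S1 :\: [set a; b].
Proof.
rewrite /S0 clsHG ?inE ?negb_or ?xa //; congr (_ :\: _).
by apply: cls_same => //; have [] := inS1.
Qed.

Let Qcls F : Q F -> F.2 = cls G F.1 a.
Proof. by case/and3P=> fF _ aF; apply: blockface_cls fF aF. Qed.

Let QA F : Q F -> F.1 \subset A.
Proof. by case/and3P=> /and3P[/proper_sub]. Qed.

Let Qmem F : Q F -> [/\ a \in F.2, b \in F.2, x \in F.2 & y \in F.2].
Proof.
move=> QF; have FA := QA QF; case/and3P: (QF) => fF Fp aF.
by have [h1 h2 h3] := conQ FA Fp; rewrite (Qcls QF) !inE conn_refl.
Qed.

Let mkQ E : E \proper A -> [set c] \proper E -> Q (E, cls G E a).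
Proof.
move=> EA Ep; rewrite /Q /faceG /blockface /= EA Ep cls_self cls_subset ?proper_sub //=.
by rewrite andbT; apply/existsP; exists a.
Qed.

Let face_ne F : faceG F -> F.2 != set0.
Proof. by case/and3P=> _ _ /existsP[z /eqP->]; apply/set0Pn; exists z; apply: cls_self. Qed.

Let face_proper F : faceG F -> F.1 \proper A. Proof. by case/and3P. Qed.

Let face_a F : faceG F -> a \in F.2 ->
  [|| F == ah, F == f1, Q F | [&& F.2 == [set a; b], c \notin F.1 & F.1 != set0]].
Proof.
move=> fF aF; have e := blockface_cls mG fF aF; have FA := proper_sub (face_proper fF).
rewrite /Q fF aF andbT /=; case: F e {aF fF} FA => E S /= -> FA.
have [->|E0] := eqVneq E set0; first by rewrite cls0 /ah eqxx.
have [cE|cE] := boolP (c \in E); last by rewrite clsGab // eqxx !orbT.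
have [->|Ec] := eqVneq E [set c]; last by rewrite properc cE Ec !orbT.
by rewrite cls1 // setUC eqxx !orbT.
Qed.

Let face_b F : faceG F -> b \in F.2 ->
  [|| F == bh, F == f2, Q F | [&& F.2 == [set a; b], c \notin F.1 & F.1 != set0]].
Proof.
move=> fF aF; have e := blockface_cls mG fF aF; have FA := proper_sub (face_proper fF).
rewrite /Q fF /=; case: F e {aF fF} FA => E S /= -> FA.
have [->|E0] := eqVneq E set0; first by rewrite cls0 /bh eqxx.
have [cE|cE] := boolP (c \in E); last first.
  have bab : b \in cls G E a by rewrite clsGab // !inE eqxx orbT.
  by rewrite (cls_same mG bab) clsGab // eqxx !orbT.
have [->|Ec] := eqVneq E [set c]; first by rewrite cls1 // eqxx !orbT.
have Ep : [set c] \proper E by rewrite properc cE Ec.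
have [ab _ _] := conQ FA Ep.
by rewrite Ep inE conn_sym // ab !orbT.
Qed.

Let P1 F := faceG F && ~~ [exists q, Q q && (F == nn q)].

Let ab_nn F : P1 F -> F.2 == [set a; b] -> c \notin F.1 -> F.1 != set0 -> F == g.
Proof.
case/andP=> fF nex /eqP e2 cF F0; have Fp := face_proper fF.
have [e1|ne] := eqVneq F.1 (A :\ c); first by rewrite [F]surjective_pairing e1 e2.
case/negP: nex; apply/existsP; exists (c |: F.1, cls G (c |: F.1) a).
apply/andP; split; last first.
  by rewrite [F]surjective_pairing /nn /= setU1K // e2.
apply: mkQ.
  rewrite properEneq subUset sub1set cA proper_sub // !andbT.
  by apply: contra ne => /eqP <-; rewrite setU1K.
rewrite properc setU11 /=; case/set0Pn: F0 => d dF.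
apply/eqP => /setP/(_ d); rewrite !inE dF orbT => /esym/eqP e; by rewrite -e dF in cF.
Qed.

Let P1_a F : P1 F -> (a \in F.2) = [|| F == ah, F == f1, F == g | Q F].
Proof.
move=> PF; have fF : faceG F by case/andP: PF.
apply/idP/idP => [/(face_a fF)/or4P[->|->|->|/and3P[h1 h2 h3]]|]; rewrite ?orbT //.
  by rewrite ab_nn ?orbT.
case/or4P=> [/eqP->|/eqP->|/eqP->|/Qmem[]//]; by rewrite /= !inE eqxx ?orbT.
Qed.

Let P1_b F : P1 F -> (b \in F.2) = [|| F == bh, F == f2, F == g | Q F].
Proof.
move=> PF; have fF : faceG F by case/andP: PF.
apply/idP/idP => [/(face_b fF)/or4P[->|->|->|/and3P[h1 h2 h3]]|]; rewrite ?orbT //.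
  by rewrite ab_nn ?orbT.
case/or4P=> [/eqP->|/eqP->|/eqP->|/Qmem[]//]; by rewrite /= !inE eqxx ?orbT.
Qed.

Let fadjp F z : faceG F -> fadj F (set0, [set z]) = (z \in F.2).
Proof.
move=> fF; rewrite fadj_point; have [->|_] := eqVneq F (set0, [set z]); first by rewrite /= inE eqxx.
have [e|_] := eqVneq F (set0, set0); last by rewrite !orbF.
by have := face_ne fF; rewrite e eqxx.
Qed.

Let neE : ([set c] == set0 :> {set 'I_q.+1}) = false.
Proof. by apply/negP => /eqP/setP/(_ c); rewrite !inE eqxx. Qed.

Let neE' : (set0 == [set c] :> {set 'I_q.+1}) = false.
Proof. by rewrite eq_sym neE. Qed.

Let neAc : (A :\ c == [set c]) = false.
Proof. by apply/negP => /eqP/setP/(_ c); rewrite !inE eqxx. Qed.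

Let neAc' : ([set c] == A :\ c) = false.
Proof. by rewrite eq_sym neAc. Qed.

Let ne0Ac : (set0 == A :\ c) = false.
Proof. by rewrite eq_sym (negPf Ac0). Qed.

Let set1_eq (u v : 'I_N) : ([set u] == [set v]) = (u == v).
Proof. by apply/eqP/eqP => [/setP/(_ u)|->//]; rewrite !inE eqxx => /esym/eqP. Qed.

Let feq := (xpair_eqE, set1_eq, neE, neE', neAc, neAc', ne0Ac, negPf Ac0, andFb, andbF,
  negPf xa, negPf xb, negPf ya, negPf yb, negPf ba, negPf xy).

Let ax : (a == x) = false. Proof. by rewrite eq_sym (negPf xa). Qed.
Let bx : (b == x) = false. Proof. by rewrite eq_sym (negPf xb). Qed.
Let ay : (a == y) = false. Proof. by rewrite eq_sym (negPf ya). Qed.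
Let by' : (b == y) = false. Proof. by rewrite eq_sym (negPf yb). Qed.
Let ab : (a == b) = false. Proof. by rewrite eq_sym (negPf ba). Qed.
Let yx : (y == x) = false. Proof. by rewrite eq_sym (negPf xy). Qed.
Let feq' := (feq, ax, bx, ay, by', ab, yx).

Let Qno F : c \notin F.1 -> Q F = false.
Proof. by move=> cF; apply/negP => /and3P[_]; rewrite properc (negPf cF). Qed.
Let Q0 S : Q (set0, S) = false. Proof. by apply: Qno; rewrite inE. Qed.
Let Qg : Q g = false. Proof. by apply: Qno; rewrite !inE eqxx. Qed.
Let Qc S : Q ([set c], S) = false.
Proof. by apply/negP => /and3P[_]; rewrite properc eqxx andbF. Qed.

Let fadj_f1 F : faceG F -> fadj F f1 = [|| F == xh, F == ah, F == f1 | Q F].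
Proof.
move=> fF; apply/idP/idP.
  case/orP=> /andP[]; rewrite /f1 /=.
    rewrite subset1 => /orP[/eqP e1|/eqP e1] sF.
      have /set0Pn[z zF] := face_ne fF; have e := blockface_cls mG fF zF.
      move: (subsetP sF _ zF) e; rewrite e1 cls1 // !inE => /orP[]/eqP->.
        by rewrite Gx => e; rewrite [F]surjective_pairing e1 e eqxx !orbT.
      by rewrite -/x setUC => e; rewrite [F]surjective_pairing e1 e eqxx !orbT.
    have /set0Pn[z zF] := face_ne fF; have e := blockface_cls mG fF zF.
    move: (subsetP sF _ zF) e; rewrite e1 cls0 !inE => /orP[]/eqP-> e.
      by rewrite [F]surjective_pairing e1 e eqxx.
    by rewrite [F]surjective_pairing e1 e eqxx orbT.
  rewrite sub1set subUset !sub1set => cF /andP[_ aF].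
  case/or4P: (face_a fF aF) => [->|->|->|/and3P[_]]; rewrite ?orbT //.
  by rewrite cF.
case/or4P=> [/eqP->|/eqP->|/eqP->|QF].
- by rewrite /fadj /f1 /= sub0set sub1set !inE eqxx.
- by rewrite /fadj /f1 /= sub0set sub1set !inE eqxx orbT.
- by rewrite /fadj !subxx.
have [aF _ xF _] := Qmem QF; case/and3P: QF => _ Fp _.
by rewrite /fadj /f1 /= (proper_sub Fp) subUset !sub1set aF xF orbT.
Qed.

Let fadj_f2 F : faceG F -> fadj F f2 = [|| F == bh, F == yh, F == f2 | Q F].
Proof.
move=> fF; apply/idP/idP.
  case/orP=> /andP[]; rewrite /f2 /=.
    rewrite subset1 => /orP[/eqP e1|/eqP e1] sF.
      have /set0Pn[z zF] := face_ne fF; have e := blockface_cls mG fF zF.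
      move: (subsetP sF _ zF) e; rewrite e1 cls1 // !inE => /orP[]/eqP->.
        by rewrite -/y => e; rewrite [F]surjective_pairing e1 e eqxx !orbT.
      by rewrite Gy setUC => e; rewrite [F]surjective_pairing e1 e eqxx !orbT.
    have /set0Pn[z zF] := face_ne fF; have e := blockface_cls mG fF zF.
    move: (subsetP sF _ zF) e; rewrite e1 cls0 !inE => /orP[]/eqP-> e.
      by rewrite [F]surjective_pairing e1 e eqxx.
    by rewrite [F]surjective_pairing e1 e eqxx orbT.
  rewrite sub1set subUset !sub1set => cF /andP[bF _].
  case/or4P: (face_b fF bF) => [->|->|->|/and3P[_]]; rewrite ?orbT //.
  by rewrite cF.
case/or4P=> [/eqP->|/eqP->|/eqP->|QF].
- by rewrite /fadj /f2 /= sub0set sub1set !inE eqxx.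
- by rewrite /fadj /f2 /= sub0set sub1set !inE eqxx orbT.
- by rewrite /fadj !subxx.
have [_ bF _ yF] := Qmem QF; case/and3P: QF => _ Fp _.
by rewrite /fadj /f2 /= (proper_sub Fp) subUset !sub1set bF yF orbT.
Qed.

Let fadj_g F : P1 F -> fadj F g = [|| F == ah, F == bh | F == g].
Proof.
move=> PF; have fF : faceG F by case/andP: PF.
apply/idP/idP; last first.
  by case/or3P=> /eqP->; rewrite /fadj /= ?sub0set ?sub1set ?inE ?eqxx ?orbT ?subxx.
case/orP=> /andP[]; rewrite /g /=.
  move=> sE sS; have cF : c \notin F.1 by apply/negP => /(subsetP sE); rewrite !inE eqxx.
  have /set0Pn[z zF] := face_ne fF.
  have : z \in [set a; b] := subsetP sS _ zF; rewrite !inE => /orP[]/eqP ez; rewrite ez in zF.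
    move: zF; rewrite P1_a // Qno // orbF => /or3P[->//|/eqP e|->]; last by rewrite !orbT.
    by rewrite e inE eqxx in cF.
  move: zF; rewrite P1_b // Qno // orbF => /or3P[->|/eqP e|->]; rewrite ?orbT //.
  by rewrite e inE eqxx in cF.
move=> sE; rewrite subUset !sub1set => /andP[aF bF].
move: aF; rewrite P1_a // => /or4P[->//|/eqP e|->|]; rewrite ?orbT //.
  by rewrite e /= !inE ?eqxx bx (negPf ba) in bF.
case/and3P=> _; rewrite properc => /andP[cF _] _; have := face_proper fF.
rewrite properE => /andP[_ /negP[]]; apply/subsetP=> d dA.
have [->//|dc] := eqVneq d c; apply: (subsetP sE); by rewrite !inE dc.
Qed.

Let faceg : faceG g.
Proof.
have [aS bS _ _] := inS1.
rewrite /faceG /blockface /= properD1 // subUset !sub1set aS bS /=.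
by apply/existsP; exists a; rewrite clsGab // ?subD1set // !inE eqxx.
Qed.

Let r1 F F' := fadj F F' || (F == g) && Q F' || (F' == g) && Q F.

(** A face [nn F] is the midpoint of an edge from [g] to [F], and [cliques_cone] removes all of them
    at once. The order on [Q] is the reversed inclusion of colours, hence the rank
    [#|A| - #|F.1|]. *)
Let cone_step : comb_equiv (cliques P1 r1) (cliques faceG fadj).
Proof.
have cQ F : Q F -> c \in F.1 by case/and3P=> _; rewrite properc => /andP[].
have Qinj F F' : Q F -> Q F' -> F.1 = F'.1 -> F = F'.
  move=> QF QF' e; rewrite [F]surjective_pairing [F']surjective_pairing.
  by rewrite (Qcls QF) (Qcls QF') e.
have [aS bS _ _] := inS1.
apply: (@cliques_cone _ faceG Q fadj (fun F F' => F'.1 \subset F.1) g nn (fun F => #|A| - #|F.1|)).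
- exact: fadjC.
- exact: faceg.
- by rewrite Qg.
- by move=> F /and3P[].
- move=> F QF; have cF := cQ _ QF; case/and3P: (QF) => fF Fp _; have FA := face_proper fF.
  split.
  + rewrite /faceG /blockface /=.
    rewrite (sub_proper_trans _ FA) ?subD1set //= subUset !sub1set aS bS /=.
    apply/existsP; exists a; rewrite clsGab //.
    * exact: subset_trans (subD1set _ _) (proper_sub FA).
    * by rewrite !inE eqxx.
    * by have [d dF dc] := properc_ex Fp; apply/set0Pn; exists d; rewrite !inE dc.
  + by rewrite Qno //= !inE eqxx.
  + apply/eqP => -[/setP e]; move: FA; rewrite properE => /andP[_ /negP[]].
    apply/subsetP=> d dA; have [->//|dc] := eqVneq d c.
    by have := e d; rewrite !inE dc dA => /andP[].
- move=> F F' QF QF' [/setP e]; apply: Qinj => //; apply/setP=> d.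
  by have [->|dc] := eqVneq d c; [rewrite !cQ|have := e d; rewrite !inE dc].
- move=> F QF; have cF := cQ _ QF; rewrite fadjC /fadj /=.
  case/and3P: QF => /face_proper; rewrite properE => /andP[_ nA] _ _.
  have -> : (F.1 \subset A :\ c) = false by apply/negP => /subsetP/(_ c cF); rewrite !inE eqxx.
  rewrite /=; apply: contra nA => /andP[sA _]; apply/subsetP=> d dA.
  by have [->//|dc] := eqVneq d c; apply: (subsetP sA); rewrite !inE dc.
- by move=> F QF; rewrite fadjC /fadj /= subxx setSD // QA.
- by move=> F QF; apply: subxx.
- move=> F F' QF QF' ne s; have : #|F'.1| < #|F.1|.
    by apply: proper_card; rewrite properEneq s andbT; apply: contra ne => /eqP e; rewrite (Qinj F F').
  by move=> lt; apply: ltn_sub2l => //; apply: leq_trans lt (subset_leq_card (QA QF)).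
- move=> F F' QF QF'; have cF := cQ _ QF; have [aF bF _ _] := Qmem QF.
  rewrite /fadj /= subUset !sub1set aF bF !andbT.
  have -> : (F.1 \subset F'.1 :\ c) = false by apply/negP => /subsetP/(_ c cF); rewrite !inE eqxx.
  apply/idP/idP => s; last exact: subset_trans (subD1set _ _) s.
  by apply/subsetP=> d dF'; have [->//|dc] := eqVneq d c; apply: (subsetP s); rewrite !inE dc.
- move=> F F' QF QF' _; rewrite /fadj orbC (Qcls QF) (Qcls QF').
  by congr (_ || _); apply: andb_idr => /cls_subset.
- move=> F F' QF QF' _; rewrite /fadj /= subxx !andbT orbC.
  have sD (E E' : {set 'I_q.+1}) : c \in E' -> (E :\ c \subset E' :\ c) = (E \subset E').
    move=> cE'; apply/idP/idP => s; last exact: setSD.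
    apply/subsetP=> d dE; have [->//|dc] := eqVneq d c.
    by have : d \in E' :\ c by [apply: (subsetP s); rewrite !inE dc]; rewrite !inE => /andP[].
  by rewrite !sD ?cQ.
- move=> F F' fF nQ ng nnF QF'; have [aF' bF' _ _] := Qmem QF'.
  have PF : P1 F.
    by rewrite /P1 fF; apply/negP => /existsP[q' /andP[Qq' /eqP e]]; have := nnF q' Qq'; rewrite e eqxx.
  have noab : ~~ (F.2 \subset [set a; b]) -> ~~ ([set a; b] \subset F.2) -> forall E,
      fadj F (E, [set a; b]) = false.
    by move=> /negPf h1 /negPf h2 E; rewrite /fadj /= h1 h2 !andbF.
  have fin : ~~ (F.2 \subset [set a; b]) -> ~~ ([set a; b] \subset F.2) ->
      fadj F (nn F') = fadj F g && fadj F F'.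
    by move=> h1 h2; rewrite /g /nn !noab.
  have [aF|aF] := boolP (a \in F.2).
    move: aF; rewrite P1_a // (negPf nQ) (negPf ng) !orbF => /orP[/eqP->|/eqP e].
      by rewrite /g /nn ![fadj ah _]fadjC !fadj_point /= aF' !inE eqxx.
    apply: fin; rewrite e; first by apply/negP => /subsetP/(_ x); rewrite !inE eqxx (negPf xa) (negPf xb) => /(_ isT).
    by apply/negP => /subsetP/(_ b); rewrite !inE eqxx orbT bx (negPf ba) => /(_ isT).
  have [bF|bF] := boolP (b \in F.2).
    move: bF; rewrite P1_b // (negPf nQ) (negPf ng) !orbF => /orP[/eqP->|/eqP e].
      by rewrite /g /nn ![fadj bh _]fadjC !fadj_point /= bF' !inE eqxx orbT.
    apply: fin; rewrite e; first by apply/negP => /subsetP/(_ y); rewrite !inE eqxx orbT (negPf ya) (negPf yb) => /(_ isT).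
    by apply/negP => /subsetP/(_ a); rewrite !inE eqxx ay ab => /(_ isT).
  apply: fin.
    have /set0Pn[z zF] := face_ne fF; apply/negP => /subsetP/(_ z zF); rewrite !inE => /orP[]/eqP e.
      by rewrite -e zF in aF.
    by rewrite -e zF in bF.
  by rewrite subUset !sub1set (negPf aF).
Qed.

Let edge (u v F F' : tface q N) := (F == u) && (F' == v) || (F == v) && (F' == u).
(** Along the melon the faces form the path [xh], [f1], [ah], [g], [bh], [f2], [yh]. Removing [f1],
    [ah], [f2], [bh] in this order, and joining the two neighbours each time, leaves [xh], [g],
    [yh], which corresponds to the path [xh], [f], [yh] in [H]. *)
Let r2 F F' := r1 F F' || edge xh ah F F'.
Let r3 F F' := r2 F F' || edge xh g F F'.
Let r4 F F' := r3 F F' || edge bh yh F F'.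
Let r5 F F' := r4 F F' || edge g yh F F'.
Let P2 F := P1 F && (F != f1).
Let P3 F := P2 F && (F != ah).
Let P4 F := P3 F && (F != f2).
Let P5 F := P4 F && (F != bh).

Let edgeC u v : symmetric (edge u v).
Proof. by move=> F F'; rewrite /edge andbC orbC [X in X || _]andbC. Qed.
Let r1C : symmetric r1.
Proof. by move=> F F'; rewrite /r1 [fadj F' F]fadjC -orbA -[RHS]orbA [X in _ || X]orbC. Qed.
Let r2C : symmetric r2. Proof. by move=> F F'; rewrite /r2 r1C edgeC. Qed.
Let r3C : symmetric r3. Proof. by move=> F F'; rewrite /r3 r2C edgeC. Qed.
Let r4C : symmetric r4. Proof. by move=> F F'; rewrite /r4 r3C edgeC. Qed.
Let r5C : symmetric r5. Proof. by move=> F F'; rewrite /r5 r4C edgeC. Qed.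

Let edge_cond (r : rel (tface q N)) u v F F' : symmetric r -> ~~ r u v ->
  r F F' = (r F F' || edge u v F F') && ~~ edge u v F F'.
Proof.
move=> rC nr; have [/orP[]/andP[/eqP-> /eqP->]|] := boolP (edge u v F F'); rewrite ?orbT ?orbF ?andbT //=.
  exact: negPf.
by rewrite rC; apply: negPf.
Qed.

Let faceP z S : z \in S1 -> S = [set z] -> faceG (set0, S).
Proof.
move=> zS ->; rewrite /faceG /blockface /= proper0 sub1set zS.
rewrite (_ : A != set0) /=; last by apply/set0Pn; exists c.
by apply/existsP; exists z; rewrite cls0.
Qed.

Let notnn F : c \in F.1 \/ F.2 != [set a; b] -> faceG F -> P1 F.
Proof.
move=> h fF; rewrite /P1 fF; apply/negP => /existsP[q' /andP[_ /eqP e]].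
by case: h; rewrite e ?eqxx // !inE eqxx.
Qed.

Let ne12 (u : 'I_N) : [set u] != [set a; b].
Proof. by apply/negP => /eqP e; have := cards1 u; rewrite e cards2 ab. Qed.

Let P1_xh : P1 xh.
Proof. by have [? ? ? ?] := inS1; apply: notnn; [right; apply: ne12|apply: (@faceP x)]. Qed.
Let P1_yh : P1 yh.
Proof. by have [? ? ? ?] := inS1; apply: notnn; [right; apply: ne12|apply: (@faceP y)]. Qed.
Let P1_ah : P1 ah.
Proof. by have [? ? ? ?] := inS1; apply: notnn; [right; apply: ne12|apply: (@faceP a)]. Qed.
Let P1_bh : P1 bh.
Proof. by have [? ? ? ?] := inS1; apply: notnn; [right; apply: ne12|apply: (@faceP b)]. Qed.

Let P1_f1 : P1 f1.
Proof.
have [aS bS xS yS] := inS1; apply: notnn; first by left; rewrite inE.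
rewrite /faceG /blockface /= Aproper subUset !sub1set aS xS /=.
by apply/existsP; exists x; rewrite cls1 // Gx.
Qed.

Let P1_f2 : P1 f2.
Proof.
have [aS bS xS yS] := inS1; apply: notnn; first by left; rewrite inE.
rewrite /faceG /blockface /= Aproper subUset !sub1set yS bS /=.
by apply/existsP; exists b; rewrite cls1.
Qed.

Let P1_g : P1 g.
Proof.
rewrite /P1 faceg; apply/negP => /existsP[q' /andP[QF /eqP[/setP e]]].
move: (QF) => /and3P[/face_proper]; rewrite properE => /andP[_ /negP nA] _ _; apply: nA.
have cF : c \in q'.1 by case/and3P: QF => _; rewrite properc => /andP[].
apply/subsetP=> d dA; have [->//|dc] := eqVneq d c.
by have := e d; rewrite !inE dc dA => /esym.
Qed.

Let mems := (inE, negPf xa, negPf xb, negPf ya, negPf yb, negPf ba, negPf xy, ax, bx, ay, by', ab, yx, eqxx).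

Let f21 : f2 != f1.
Proof. by apply/eqP => -[] /setP/(_ y); rewrite !mems. Qed.

Let step1 : comb_equiv (cliques P2 r2) (cliques P1 r1).
Proof.
apply: (@cliques_subdiv _ _ _ _ _ f1 xh ah) => //.
- by rewrite /P2 ?eqxx ?andbF.
- by rewrite /P2 P1_xh !feq'.
- by rewrite /P2 P1_ah !feq'.
- by rewrite !feq'.
- by rewrite /r2 /edge ?eqxx ?orbT.
- by move=> F; rewrite /P2; have [->|_] := eqVneq F f1; rewrite ?P1_f1 ?orbT ?orbF ?andbT.
- move=> F F' _ _ _; apply: edge_cond => //.
  by rewrite /r1 !Q0 ?andbF ?orbF fadjp ?mems //; case/andP: P1_xh.
move=> F /andP[PF Ff1]; have fF : faceG F by case/andP: PF.
rewrite {1}/r1 Qc ?andbF fadj_f1 // (negPf Ff1) !feq' ?orbF.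
have [Fx|Fx] //= := eqVneq F xh; have [Fa|Fa] //= := eqVneq F ah.
rewrite /r2 /r1 /edge !Q0 ?andbF !fadjp // P1_a // (negPf Fx) (negPf Fa) (negPf Ff1) !feq' ?orbF /=.
have [QF|nQ] := boolP (Q F); first by have [_ _ -> _] := Qmem QF; rewrite ?orbT.
by rewrite ?orbF; have [->|] := eqVneq F g; rewrite /= ?mems ?andbF.
Qed.

Let step2 : comb_equiv (cliques P3 r3) (cliques P2 r2).
Proof.
apply: (@cliques_subdiv _ _ _ _ _ ah xh g) => //.
- by rewrite /P3 ?eqxx ?andbF.
- by rewrite /P3 /P2 P1_xh !feq'.
- by rewrite /P3 /P2 P1_g !feq'.
- by rewrite !feq'.
- by rewrite /r3 /edge ?eqxx ?orbT.
- move=> F; rewrite /P3; have [->|_] := eqVneq F ah; rewrite ?orbT ?orbF ?andbT //.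
  by rewrite /P2 P1_ah !feq'.
- move=> F F' _ _ _; apply: edge_cond => //.
  by rewrite /r2 /r1 /edge !Q0 ?andbF ?orbF !feq' /= fadjC fadjp ?mems.
move=> F /andP[/andP[PF Ff1] Fa]; have fF : faceG F by case/andP: PF.
rewrite {1}/r2 {1}/r1 Q0 ?andbF fadjp // P1_a // /edge (negPf Fa) (negPf Ff1) !feq' ?eqxx /= ?orbF ?andbT.
have [Fx|Fx] //= := eqVneq F xh; first by rewrite ?orbT.
have [Fg|Fg] //= := eqVneq F g.
rewrite /r3 /r2 /r1 /edge !Q0 Qg ?andbF !fadjp // fadj_g // (negPf Fx) (negPf Fa) (negPf Fg) !feq' ?eqxx ?orbF /=.
have [QF|nQ] := boolP (Q F); first by have [_ _ -> _] := Qmem QF; rewrite ?eqxx ?orbT.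
by rewrite ?eqxx ?andbF ?orbF; have [->|] := eqVneq F bh; rewrite /= ?mems ?andbF.
Qed.

Let step3 : comb_equiv (cliques P4 r4) (cliques P3 r3).
Proof.
apply: (@cliques_subdiv _ _ _ _ _ f2 bh yh) => //.
- by rewrite /P4 ?eqxx ?andbF.
- by rewrite /P4 /P3 /P2 P1_bh !feq'.
- by rewrite /P4 /P3 /P2 P1_yh !feq'.
- by rewrite !feq'.
- by rewrite /r4 /edge ?eqxx ?orbT.
- move=> F; rewrite /P4; have [->|_] := eqVneq F f2; rewrite ?orbT ?orbF ?andbT //.
  by rewrite /P3 /P2 P1_f2 f21 !feq'.
- move=> F F' _ _ _; apply: edge_cond => //.
  rewrite /r3 /r2 /r1 /edge !Q0 ?andbF ?orbF !feq' /= fadjp ?mems //; by case/andP: P1_bh.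
move=> F /andP[/andP[/andP[PF Ff1] Fa] Ff2]; have fF : faceG F by case/andP: PF.
rewrite {1}/r3 {1}/r2 {1}/r1 Qc ?andbF fadj_f2 // /edge (negPf Fa) (negPf Ff2) !feq' /= ?orbF.
have [Fx|Fx] //= := eqVneq F bh; have [Fy|Fy] //= := eqVneq F yh.
rewrite /r4 /r3 /r2 /r1 /edge !Q0 ?andbF !fadjp // P1_b // (negPf Fx) (negPf Fy) (negPf Fa) (negPf Ff2) !feq' ?andbF ?orbF /=.
have [QF|nQ] := boolP (Q F); first by have [_ _ _ ->] := Qmem QF; rewrite ?eqxx ?orbT.
by rewrite ?eqxx ?andbF ?orbF; have [->|] := eqVneq F g; rewrite /= ?mems ?andbF.
Qed.

Let step4 : comb_equiv (cliques P5 r5) (cliques P4 r4).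
Proof.
apply: (@cliques_subdiv _ _ _ _ _ bh g yh) => //.
- by rewrite /P5 ?eqxx ?andbF.
- by rewrite /P5 /P4 /P3 /P2 P1_g !feq'.
- by rewrite /P5 /P4 /P3 /P2 P1_yh !feq'.
- by rewrite !feq'.
- by rewrite /r5 /edge ?eqxx ?orbT.
- move=> F; rewrite /P5; have [->|_] := eqVneq F bh; rewrite ?orbT ?orbF ?andbT //.
  by rewrite /P4 /P3 /P2 P1_bh !feq'.
- move=> F F' _ _ _; apply: edge_cond => //.
  by rewrite /r4 /r3 /r2 /r1 /edge !Q0 ?andbF ?orbF !feq' /= fadjp ?mems // faceg.
move=> F /andP[/andP[/andP[/andP[PF Ff1] Fa] Ff2] Fb]; have fF : faceG F by case/andP: PF.
rewrite {1}/r4 {1}/r3 {1}/r2 {1}/r1 Q0 ?andbF fadjp // P1_b // /edge (negPf Fa) (negPf Fb) (negPf Ff2) !feq' ?eqxx /= ?andbF ?orbF ?andbT.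
have [Fg|Fg] //= := eqVneq F g; have [Fy|Fy] //= := eqVneq F yh; first by rewrite ?orbT.
rewrite /r5 /r4 /r3 /r2 /r1 /edge !Q0 Qg ?andbF !fadjp // fadj_g // (negPf Fg) (negPf Fy) (negPf Fa) (negPf Fb) !feq' ?eqxx ?andbF ?orbF /=.
have [QF|nQ] := boolP (Q F); first by have [_ _ _ ->] := Qmem QF; rewrite ?eqxx ?orbT.
by rewrite ?eqxx ?andbF ?orbF; have [->|] := eqVneq F xh; rewrite /= ?mems ?andbF.
Qed.

(** Identifies the faces of [H] with those of [G] that survive the moves: [g] takes the place of the
    edge [f], and a larger face containing the edge [x y] of colour [c] regains the melon. *)
Let phi F : tface q N :=
  if F == f then g else if (c \in F.1) && (x \in F.2) then (F.1, F.2 :|: [set a; b]) else F.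

Let faceH_ab F : faceH F -> (a \notin F.2) && (b \notin F.2).
Proof.
case/and3P=> _ /subsetP sF _; apply/andP; split; apply/negP => /sF; rewrite S0E !mems //.
Qed.

Let phiQ F : faceH F -> F != f -> c \in F.1 -> x \in F.2 ->
  Q (phi F) /\ phi F = (F.1, F.2 :|: [set a; b]).
Proof.
move=> fF Ff cF xF; have e : phi F = (F.1, F.2 :|: [set a; b]) by rewrite /phi (negPf Ff) cF xF.
split=> //; rewrite e; have eF := blockface_cls mH fF xF; have FA : F.1 \proper A by case/and3P: fF.
have Fp : [set c] \proper F.1.
  rewrite properc cF; apply: contra Ff => /eqP e1; apply/eqP.
  by rewrite [F]surjective_pairing eF e1 cls1 // Hx.
have [ca _ _] := conQ (proper_sub FA) Fp; have [_ cx _] := conQ (proper_sub FA) Fp.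
have -> : F.2 :|: [set a; b] = cls G F.1 a; last exact: mkQ.
rewrite eF clsHG ?proper_sub ?inE ?negb_or ?xa // (cls_same mG (z := a)) ?inE //.
apply/setP=> z; rewrite !inE; have [->|] := eqVneq z a; first by rewrite conn_refl.
by have [->|] := eqVneq z b; rewrite ?ca ?andbT ?orbT ?orbF.
Qed.

Let cls_plain F z : F.1 \subset A -> a \notin cls G F.1 z -> b \notin cls G F.1 z ->
  z \notin [set a; b] -> cls H F.1 z = cls G F.1 z.
Proof.
move=> FA az bz zab; have [cF|cF] := boolP (c \in F.1); last first.
  by apply: eq_cls => d dF; apply: cut_other; apply: contra cF => /eqP<-.
have [e|ne] := eqVneq F.1 [set c].
  rewrite e !cls1 // in az bz *; move: az bz; rewrite !inE !negb_or => /andP[az1 az2] /andP[bz1 bz2].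
  have zx : z != x by apply: contra az2 => /eqP->; rewrite Gx.
  have zy : z != y by apply: contra bz2 => /eqP->; rewrite Gy.
  by congr [set z; _]; apply: cut_else; rewrite // eq_sym.
rewrite clsHG ?properc ?cF //; apply/setP=> t; rewrite in_setD.
have [tz|] := boolP (t \in cls G F.1 z); rewrite ?andbF // ?andbT.
by rewrite !inE; apply/norP; split; apply/eqP => e; [rewrite -e tz in az|rewrite -e tz in bz].
Qed.

Let plainG F : faceG F -> a \notin F.2 -> b \notin F.2 -> faceH F /\ phi F = F.
Proof.
move=> fF aF bF; have /set0Pn[z zF] := face_ne fF; have e := blockface_cls mG fF zF.
case/and3P: (fF) => Fp sF _.
have zab : z \notin [set a; b].
  by rewrite !inE; apply/norP; split; apply/eqP => ez; [rewrite -ez zF in aF|rewrite -ez zF in bF].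
split.
  rewrite /faceH /blockface Fp /=; apply/andP; split.
    apply/subsetP=> t tF; rewrite S0E in_setD (subsetP sF) // ?andbT !inE.
    by apply/norP; split; apply/eqP => et; [rewrite -et tF in aF|rewrite -et tF in bF].
  by apply/existsP; exists z; rewrite cls_plain ?proper_sub -?e.
have ncx : ~~ ((c \in F.1) && (x \in F.2)).
  apply/negP => /andP[cF xF]; case/negP: aF; rewrite (blockface_cls mG fF xF) inE -Gx.
  exact: conn_step.
rewrite /phi (negPf ncx); case: eqP => // ef; case/negP: ncx.
by rewrite ef /f /= !mems.
Qed.

Let plainH F : faceH F -> F != f -> ~~ ((c \in F.1) && (x \in F.2)) ->
  [/\ faceG F, a \notin F.2, b \notin F.2 & phi F = F].
Proof.
move=> fF Ff ncx; have /andP[aF bF] := faceH_ab fF; split=> //; last by rewrite /phi (negPf Ff) (negPf ncx).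
case/and3P: (fF) => Fp sF /existsP[z /eqP e].
have zF : z \in F.2 by rewrite e cls_self.
have zab : z \notin [set a; b].
  by rewrite !inE; apply/norP; split; apply/eqP => ez; [rewrite -ez zF in aF|rewrite -ez zF in bF].
rewrite /faceG /blockface Fp /=; apply/andP; split.
  by apply: subset_trans sF _; rewrite S0E subsetDl.
apply/existsP; exists z; rewrite e.
have [cF|cF] := boolP (c \in F.1); last first.
  by apply/eqP; apply: eq_cls => d dF; apply: cut_other; apply: contra cF => /eqP<-.
rewrite cF /= in ncx.
have [ec|ne] := eqVneq F.1 [set c].
  apply/eqP; rewrite ec !cls1 // in e *; rewrite e !inE negb_or in ncx.
  case/andP: ncx => xz xHz.
  move: zab; rewrite !inE negb_or => /andP[za zb].
  congr [set z; _]; apply: cut_else => //; first by rewrite eq_sym.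
  by apply: contra xHz => /eqP ->; rewrite Hy.
have Fpc : [set c] \proper F.1 by rewrite properc cF ne.
have [cab cax _] := conQ (proper_sub Fp) Fpc.
have xz : x \notin cls G F.1 z.
  apply: contra ncx => xz; rewrite e clsHG ?proper_sub // in_setD xz ?andbT !inE.
  by rewrite (negPf xa) (negPf xb).
rewrite clsHG ?proper_sub //; apply/eqP/setP=> t; rewrite in_setD.
have [tz|] := boolP (t \in cls G F.1 z); rewrite ?andbF // ?andbT !inE.
rewrite inE in xz; rewrite inE in tz.
apply/norP; split; apply: contra xz => /eqP et; rewrite et in tz; apply: (conn_trans tz) => //.
by apply: conn_trans cax; rewrite conn_sym.
Qed.

Let fP : faceH f.
Proof.
have [aS bS xS yS] := inS1.
rewrite /faceH /blockface /= Aproper subUset !sub1set S0E !in_setD xS yS !mems /=.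
by apply/existsP; exists x; rewrite cls1 // Hx.
Qed.

Let phif : phi f = g. Proof. by rewrite /phi ?eqxx. Qed.

Let Q_P5 F : Q F -> P5 F.
Proof.
move=> QF; have cF : c \in F.1 by case/and3P: QF => _; rewrite properc => /andP[].
have PF : P1 F by apply: notnn; [left|case/and3P: QF].
rewrite /P5 /P4 /P3 /P2 PF /=; apply/andP; split; [apply/andP; split; [apply/andP; split|]|];
  by apply/negP => /eqP e; move: QF; rewrite e ?Qc ?Q0.
Qed.

Let plain_P5 F : faceG F -> a \notin F.2 -> b \notin F.2 -> P5 F.
Proof.
move=> fF aF bF.
have PF : P1 F by apply: notnn => //; right; apply: contra aF => /eqP->; rewrite !inE ?eqxx.
rewrite /P5 /P4 /P3 /P2 PF /=; apply/andP; split; [apply/andP; split; [apply/andP; split|]|];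
  by apply/negP => /eqP e; move: aF bF; rewrite e !mems.
Qed.

Let kind F : faceH F -> [\/ F = f, [/\ F != f, c \in F.1, x \in F.2, Q (phi F) & phi F = (F.1, F.2 :|: [set a; b])] |
   [/\ F != f, ~~ ((c \in F.1) && (x \in F.2)), [/\ faceG F, a \notin F.2 & b \notin F.2] & phi F = F]].
Proof.
move=> fF; have [->|Ff] := eqVneq F f; first by apply: Or31.
have [/andP[cF xF]|ncx] := boolP ((c \in F.1) && (x \in F.2)).
  by apply: Or32; have [] := phiQ fF Ff cF xF.
by apply: Or33; have [? ? ? ?] := plainH fF Ff ncx.
Qed.

Let fadj_f F : faceH F -> F != f -> ~~ ((c \in F.1) && (x \in F.2)) ->
  fadj f F = (F == xh) || (F == yh).
Proof.
move=> fF Ff ncx; have /and3P[_ _ /existsP[z /eqP e]] := fF.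
apply/idP/idP => [/orP[]/andP[]|].
- by rewrite sub1set /= subUset !sub1set => cF /andP[xF _]; rewrite cF xF in ncx.
- rewrite /= subset1 => /orP[/eqP e1|/eqP e1] sF.
    case/negP: Ff; have zF : z \in [set x; y] by apply: (subsetP sF); rewrite e cls_self.
    rewrite [F]surjective_pairing e e1 cls1 //; move: zF; rewrite !inE => /orP[]/eqP->.
      by rewrite Hx.
    by rewrite Hy setUC.
  have zF : z \in [set x; y] by apply: (subsetP sF); rewrite e cls_self.
  rewrite [F]surjective_pairing e e1 cls0; move: zF; rewrite !inE => /orP[]/eqP->; rewrite ?eqxx ?orbT //.
- by case/orP=> /eqP->; rewrite fadj_point /= !inE ?eqxx ?orbT.
Qed.

Let iso_step : comb_equiv (cliques faceH fadj) (cliques P5 r5).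
Proof.
have notQ F : a \notin F.2 -> Q F = false by move=> aF; apply/negP => /and3P[_ _]; rewrite (negPf aF).
have cQ F : Q F -> c \in F.1 by case/and3P=> _; rewrite properc => /andP[].
have cg : c \notin g.1 by rewrite !inE ?eqxx.
have P5g : P5 g by rewrite /P5 /P4 /P3 /P2 P1_g !feq'.
have sU (S S' : {set 'I_N}) : a \notin S -> b \notin S -> (S \subset S' :|: [set a; b]) = (S \subset S').
  move=> aS bS; apply/idP/idP => [/subsetP s|]; last by move=> /subset_trans; apply; apply: subsetUl.
  apply/subsetP=> z zS; have := s z zS; rewrite !inE => /or3P[//|/eqP ez|/eqP ez].
    by rewrite -ez zS in aS.
  by rewrite -ez zS in bS.
have sUU (S S' : {set 'I_N}) : a \notin S -> b \notin S ->
    (S :|: [set a; b] \subset S' :|: [set a; b]) = (S \subset S').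
  by move=> aS bS; rewrite subUset subsetUr ?andbT sU.
have eU (S S' : {set 'I_N}) : a \notin S -> b \notin S -> a \notin S' -> b \notin S' ->
    S :|: [set a; b] = S' :|: [set a; b] -> S = S'.
  move=> aS bS aS' bS' e; have eD (S2 : {set 'I_N}) : a \notin S2 -> b \notin S2 ->
      (S2 :|: [set a; b]) :\: [set a; b] = S2.
    move=> aS2 bS2; apply/setP=> z; rewrite !inE; have [->|_] := eqVneq z a; first by rewrite (negPf aS2).
    by have [->|_] := eqVneq z b; rewrite ?(negPf bS2) //= orbF.
  by rewrite -(eD S) // e eD.
have r5Q F F' : F != g -> F' != g -> a \notin F'.2 -> b \notin F'.2 -> F != ah -> F != bh -> r5 F F' = fadj F F'.
  move=> Fg F'g aF' bF' Fa Fb; rewrite /r5 /r4 /r3 /r2 /r1 /edge (negPf Fg) (negPf F'g) (negPf Fa) (negPf Fb) /=.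
  have -> : (F' == ah) = false by apply/eqP => e; rewrite e !mems in aF'.
  have -> : (F' == bh) = false by apply/eqP => e; rewrite e !mems in bF'.
  by rewrite ?andbF ?orbF.
have gab F : a \notin F.2 -> F != g by move=> aF; apply: contra aF => /eqP->; rewrite !mems.
have aab F : a \notin F.2 -> F != ah by move=> aF; apply: contra aF => /eqP->; rewrite !mems.
have bab F : b \notin F.2 -> F != bh by move=> aF; apply: contra aF => /eqP->; rewrite !mems.
have Qne F : Q F -> [/\ F != g, F != ah, F != bh, F != xh & F != yh].
  by move=> QF; split; apply/eqP => e; move: QF; rewrite e ?Qg ?Q0.
apply: (cliques_iso (f := phi)).
- move=> F F' fF fF'; have /andP[aF bF] := faceH_ab fF; have /andP[aF' bF'] := faceH_ab fF'.
  case: (kind fF) => [->|[_ cF xF QF ->]|[_ _ [gF _ _] ->]];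
  case: (kind fF') => [->|[_ cF' xF' QF' ->]|[_ _ [gF' _ _] ->]] //.
  + by rewrite phif /g => -[e _]; rewrite -e in cF'; rewrite !inE ?eqxx in cF'.
  + by rewrite phif => e; rewrite -e !mems in aF'.
  + by rewrite phif /g => -[e _]; rewrite e in cF; rewrite !inE ?eqxx in cF.
  + by move=> [e1 /eU e2]; rewrite [F]surjective_pairing [F']surjective_pairing e1 e2.
  + by move=> e; rewrite -e /= !mems ?orbT in aF'.
  + by rewrite phif => e; rewrite e !mems in aF.
  + by move=> e; rewrite e /= !mems ?orbT in aF.
- move=> F fF; case: (kind fF) => [->|[_ _ _ QF _]|[_ _ [gF aF bF] ->]].
  + by rewrite phif.
  + exact: Q_P5.
  + exact: plain_P5.
- move=> F PF5; have /andP[/andP[/andP[/andP[PF Ff1] Fa] Ff2] Fb] := PF5.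
  have fF : faceG F by case/andP: PF.
  have : (F == g) || Q F || (a \notin F.2) && (b \notin F.2).
    rewrite P1_a // P1_b // (negPf Fa) (negPf Fb) (negPf Ff1) (negPf Ff2) /=.
    by case: (F == g); case: (Q F).
  case/orP=> [/orP[/eqP->|QF]|/andP[aF bF]].
  + by exists f; rewrite ?phif ?fP.
  + have [aF bF xF yF] := Qmem QF; have cF := cQ _ QF; have FA := QA QF.
    case/and3P: (QF) => _ Fp _.
    have FAp := face_proper fF.
    have xS : x \in F.2 :\: [set a; b] by rewrite in_setD xF !mems.
    have eD : F.2 :\: [set a; b] = cls H F.1 x.
      by rewrite clsHG // ?mems // -(blockface_cls mG fF xF).
    have fH : faceH (F.1, F.2 :\: [set a; b]).
      rewrite /faceH /blockface /= FAp S0E setSD /=; last by case/and3P: fF.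
      by apply/existsP; exists x; rewrite eD.
    exists (F.1, F.2 :\: [set a; b]) => //.
    have -> : phi (F.1, F.2 :\: [set a; b]) = (F.1, F.2 :\: [set a; b] :|: [set a; b]).
      rewrite /phi /= cF xS; case: eqP => // -[e _]; by rewrite e properxx in Fp.
    rewrite [RHS]surjective_pairing; congr pair; apply/setP=> z; rewrite !inE.
    by have [->|] := eqVneq z a; rewrite ?aF //=; have [->|] := eqVneq z b; rewrite ?bF // ?orbF.
  + by have [fH e] := plainG fF aF bF; exists F.
- have g_plain F : faceH F -> F != f -> ~~ ((c \in F.1) && (x \in F.2)) -> faceG F -> a \notin F.2 -> b \notin F.2 ->
     r5 g F = fadj f F.
    move=> fF Ff ncx gF aF bF; rewrite fadj_f //.
    have /andP[/andP[/andP[/andP[PF Ff1] Fa] Ff2] Fb] := plain_P5 gF aF bF.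
    rewrite /r5 /r4 /r3 /r2 /r1 /edge notQ // Qg ?andbF fadjC fadj_g // (negPf Fa) (negPf Fb) (negPf (gab _ aF)) !feq' ?eqxx /= ?andbF ?orbF.
    by rewrite ?orbF ?andbT.
  have g_Q F : Q F -> r5 g F by move=> QF; rewrite /r5 /r4 /r3 /r2 /r1 QF ?eqxx ?orbT.
  have f_Q F : faceH F -> c \in F.1 -> x \in F.2 -> fadj f F.
    move=> fF cF xF; rewrite /fadj /= !sub1set subUset !sub1set cF xF /=.
    by rewrite (blockface_cls mH fF xF) inE -Hx conn_step.
  have Q_plain F F' : faceH F -> faceH F' -> c \in F.1 -> x \in F.2 -> Q (phi F) ->
      phi F = (F.1, F.2 :|: [set a; b]) -> ~~ ((c \in F'.1) && (x \in F'.2)) ->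
      r5 (phi F) F' = fadj F F'.
    move=> fF fF' cF xF QF e ncx; have /andP[aF' bF'] := faceH_ab fF'; have [h1 h2 h3 _ _] := Qne _ QF.
    rewrite r5Q // ?gab // e /fadj /= sU // subUset subUset !sub1set (negPf aF') ?andbF.
    have -> // : (F.1 \subset F'.1) && (F.2 \subset F'.2) = false.
    by apply/negP => /andP[s1 s2]; rewrite (subsetP s1) ?(subsetP s2) in ncx.
  move=> F F' fF fF' ne; have /andP[aF bF] := faceH_ab fF; have /andP[aF' bF'] := faceH_ab fF'.
  case: (kind fF) => [eF|[nf1 cF xF QF eF]|[nf1 ncF [gF _ _] eF]];
  case: (kind fF') => [eF'|[nf2 cF' xF' QF' eF']|[nf2 ncF' [gF' _ _] eF']].
  + by rewrite eF eF' ?eqxx in ne.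
  + by rewrite eF phif g_Q // f_Q.
  + by rewrite eF phif eF' g_plain.
  + by rewrite eF' phif r5C g_Q // fadjC f_Q.
  + have [h1 h2 h3 _ _] := Qne _ QF; have [k1 k2 k3 _ _] := Qne _ QF'.
    rewrite /r5 /r4 /r3 /r2 /r1 /edge (negPf h1) (negPf h2) (negPf h3) (negPf k1) (negPf k2) (negPf k3) ?andbF ?orbF.
    by rewrite eF eF' /fadj /= !sUU.
  + by rewrite eF'; apply: Q_plain.
  + by rewrite eF' phif r5C eF g_plain // fadjC.
  + by rewrite eF r5C fadjC; apply: Q_plain.
  + by rewrite eF eF' r5Q // ?gab ?aab ?bab.
Qed.

Lemma melon_insertion : comb_equiv (cliques (blockface (cut G a c) A (cls (cut G a c) A (G c a))) fadj)
  (cliques (blockface G A (cls G A a)) fadj).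
Proof.
apply: CE_trans iso_step _; apply: CE_trans step4 _; apply: CE_trans step3 _.
by apply: CE_trans step2 _; apply: CE_trans step1 _; apply: cone_step.
Qed.

End Melon.
End Faces.

(** * Links in the dual complex *)

Section Manifold.
Variables (q N : nat).
Implicit Types (s : cgraph q N) (A E : {set 'I_q.+1}) (F : tface q N).

Lemma cls_agree s s' E (S : {set 'I_N}) z :
  (forall u d, u \in S -> d \in E -> s d u \in S) ->
  (forall u d, u \in S -> d \in E -> s d u = s' d u) -> z \in S -> cls s E z = cls s' E z.
Proof.
move=> cl ag zS; apply/setP=> v; rewrite !inE; apply/idP/idP => h.
  have [] // : v \in S /\ conn s' E z v; move: zS.
  apply: (conn_min (R := fun u v => u \in S -> v \in S /\ conn s' E u v)) h.
  - by move=> u uS; split=> //; apply: conn_refl.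
  - by move=> u w t h1 h2 /h1[/h2[tS wt] uw]; split=> //; apply: conn_trans wt.
  - by move=> u d dE uS; split; [apply: cl|rewrite ag //; apply: conn_step].
have [] // : v \in S /\ conn s E z v; move: zS.
apply: (conn_min (R := fun u v => u \in S -> v \in S /\ conn s E u v)) h.
- by move=> u uS; split=> //; apply: conn_refl.
- by move=> u w t h1 h2 /h1[/h2[tS wt] uw]; split=> //; apply: conn_trans wt.
- by move=> u d dE uS; rewrite -ag //; split; [apply: cl|apply: conn_step].
Qed.

Lemma blockface_agree s s' A (S : {set 'I_N}) :
  (forall E u, E \subset A -> u \in S -> cls s E u = cls s' E u) ->
  blockface s A S =1 blockface s' A S.
Proof.
move=> h F; rewrite /blockface; have [/= Fp|//] := boolP (F.1 \proper A).
have [/= sS|//] := boolP (F.2 \subset S).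
apply/existsP/existsP => -[z /eqP e]; exists z; apply/eqP; rewrite e.
  by apply: h; [exact: proper_sub|apply: (subsetP sS); rewrite e cls_self].
have zS : z \in S by apply: (subsetP sS); rewrite e cls_self.
by symmetry; apply: h; [exact: proper_sub|].
Qed.

Section Induction.
Variable A : {set 'I_q.+1}.
Hypothesis A0 : ord0 \notin A.

(** Pruning leaves ends with disjoint melons, since the sum of the degrees drops at each cut. *)
Lemma forest_ind (P : cgraph q N -> Prop) :
  (forall s, matched s -> (forall c z, c \in A -> fixedc s c z) -> P s) ->
  (forall s a c, matched s -> c \in A -> ~~ fixedc s c a ->
     (forall c', c' \in A -> c' != c -> fixedc s c' a) -> P (cut s a c) -> P s) ->
  forall s, matched s -> forest s A -> P s.
Proof.
move=> h0 h1 s; have [k] := ubnP (\sum_z nonfixed s A z); elim: k s => // k IH s /ltnSE lek ms fo.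
have [/existsP[z1 nz1]|] := boolP [exists z, nonfixed s A z != 0]; last first.
  rewrite negb_exists => /forallP h; apply: h0 => // c z cA.
  by have := h z; rewrite negbK => /nonfixed0P/(_ c cA).
have [a [c [_ _ cA nf lf]]] := forest_leaf A0 z1 ms fo nz1.
apply: (h1 s a c) => //; apply: IH.
- by apply: leq_trans lek; apply: sum_nonfixed_cut.
- exact: matched_cut.
- exact: forest_cut_leaf.
Qed.

(** Induction by pruning with respect to [A], for all subsets [A'] together. If [c] is in [A'], a
    leaf attached through [c] is one for [A'] as well, and a block either gains a melon or is not
    touched; without [c] nothing changes. The case of [A'] reduced to [c] is separate, because
    [melon_insertion] needs a second colour. *)
Lemma sphere_faces s : matched s -> forest s A -> forall A' z, A' \subset A ->
  sphere #|A'| (cliques (blockface s A' (cls s A' z)) (@fadj q N)).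
Proof.
move: s; apply: forest_ind => [s ms fx A' z sA'|s a c ms cA nf lf IH A' z sA'].
  have [->|An] := eqVneq A' set0; first by rewrite cards0; apply: sphere_none.
  apply: sphere_melon => // [|c y cA']; first by apply: contra A0 => /(subsetP sA').
  by apply: fx; apply: (subsetP sA').
have c0 := colA0 A0 cA.
have [cA'|cA'] := boolP (c \in A'); last first.
  have e E u : E \subset A' -> cls s E u = cls (cut s a c) E u.
    move=> sE; apply: eq_cls => d dE; rewrite cut_other //.
    by apply: contra cA' => /eqP <-; apply: (subsetP sE).
  rewrite e //; set K := cliques _ _.
  rewrite (_ : K = cliques (blockface (cut s a c) A' (cls (cut s a c) A' z)) (@fadj q N)); first exact: IH.
  by apply: cliques_ext => //; apply: blockface_agree => E u sE _; apply: e.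
have [->|ne] := eqVneq A' [set c]; first by rewrite cards1; apply: sphere_one.
have [c2 c2A' c2c] : exists2 c2, c2 \in A' & c2 != c.
  have : [set c] \proper A' by rewrite properEneq eq_sym ne sub1set.
  by case/properP=> _ [c2 h1]; rewrite inE => h2; exists c2.
have A'0 : ord0 \notin A' by apply: contra A0 => /(subsetP sA').
have lf' c' : c' \in A' -> c' != c -> fixedc s c' a by move=> /(subsetP sA'); apply: lf.
have [za|nza] := boolP (z \in cls s A' a).
  rewrite (cls_same ms za).
  by apply: CE_trans (IH A' (s c a) sA') _; apply: melon_insertion c2A' c2c.
have ab : conn s A' a (s ord0 a).
  by rewrite -(eqP (lf' _ c2A' c2c)); apply: conn_step.
set S := cls s A' z.
have clS u d : u \in S -> d \in A' -> s d u \in S.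
  by rewrite !inE => zu dA; apply: (conn_trans zu); apply: conn_step.
have nS u : conn s A' a u -> u \notin S.
  move=> au; apply: contra nza => uS; rewrite inE; apply: (conn_trans au).
  by rewrite conn_sym //; rewrite inE in uS.
have agS u d : u \in S -> d \in A' -> s d u = cut s a c d u.
  move=> uS dA; have [->|dc] := eqVneq d c; last by rewrite cut_other.
  rewrite cut_else //; apply: contraL uS => /eqP->; apply: nS => //; try exact: conn_refl.
    exact: conn_step.
  by apply: (conn_trans ab); apply: conn_step.
have eS E u : E \subset A' -> u \in S -> cls s E u = cls (cut s a c) E u.
  move=> /subsetP sE uS; apply: cls_agree uS => v d vS dE; first by apply: clS => //; apply: sE.
  by apply: agS => //; apply: sE.
set K := cliques _ _.
rewrite (_ : K = cliques (blockface (cut s a c) A' (cls (cut s a c) A' z)) (@fadj q N)); first exact: IH.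
apply: cliques_ext => // F; rewrite -eS ?cls_self //; exact: blockface_agree.
Qed.

(** At a leaf attached through [c] a second colour is parallel to the 0-edge, and pruning creates no
    connection between the remaining vertices. This allows colour 0 to be replaced along paths,
    which gives the SYK property. *)
Lemma forest_zero_edge s : 1 < #|A| -> matched s -> forest s A -> forall z, conn s A z (s ord0 z).
Proof.
move=> A2 ms fo; move: s ms fo; apply: forest_ind => [s ms fx z|s a c ms cA nf lf IH z].
  have /card_gt0P[c cA] : 0 < #|A| by apply: leq_trans A2.
  by rewrite -(eqP (fx c z cA)); apply: conn_step.
have c0 := colA0 A0 cA.
have [c2 c2A c2c] : exists2 c2, c2 \in A & c2 != c.
  have /card_gt0P[c2] : 0 < #|A :\ c| by move: A2; rewrite (cardsD1 c A) cA.
  by rewrite !inE => /andP[h1 h2]; exists c2.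
have ab : conn s A a (s ord0 a) by rewrite -(eqP (lf c2 c2A c2c)); apply: conn_step.
have [|zab] := boolP (z \in [set a; s ord0 a]).
  by rewrite !inE => /orP[]/eqP->; rewrite ?matchedK // conn_sym.
have := IH z; rewrite conn_cut_leaf //; last by exists c2.
by rewrite (negPf zab) cut0 // => /andP[].
Qed.

End Induction.

Lemma link_cliques (X : finType) (P : pred X) (r : rel X) v : symmetric r -> P v ->
  link (cliques P r) [set v] = cliques (fun x => [&& P x, x != v & r x v]) r.
Proof.
move=> rs Pv; apply/setP=> C; rewrite inE; apply/and3P/cliquesP.
  case=> /cliquesP[h1 h2]; rewrite disjoint_sym disjoints1 => vC /cliquesP[h3 h4]; split=> // x xC.
  have xv : x != v by apply: contra vC => /eqP<-.
  by rewrite h1 // xv h4 // !inE ?xC ?eqxx ?orbT.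
case=> h1 h2.
have vC : v \notin C by apply/negP => /h1/and3P[_]; rewrite eqxx.
split.
- by apply/cliquesP; split=> // x /h1/and3P[].
- by rewrite disjoint_sym disjoints1.
- apply/cliquesP; split=> [x|x y]; rewrite !inE; first by case/orP=> [/h1/and3P[]//|/eqP->].
  case/orP=> [xC|/eqP->]; case/orP=> [yC|/eqP->]; rewrite ?eqxx //.
  + exact: h2.
  + by case/and3P: (h1 _ xC).
  + by rewrite rs; case/and3P: (h1 _ yC).
Qed.

Lemma card_nonzero : #|nonzero_colors q| = q.
Proof.
have := cardsC [set (ord0 : 'I_q.+1)]; rewrite cards1 card_ord add1n => -[e].
by rewrite -[RHS]e; apply: eq_card => c; rewrite !inE.
Qed.

Definition fcomp (F F' : tface q N) := face_le F F' || face_le F' F.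

Lemma bary_cliques s : bary_T0 s = cliques (is_face s) fcomp.
Proof.
apply/setP=> C; apply/idP/cliquesP => [|[h1 h2]].
  rewrite inE => /andP[/forallP h1 /forallP h2]; split=> [F FC|F F' FC FC' _].
    by have /implyP := h1 F; apply.
  by have /implyP/(_ FC)/forallP/(_ F')/implyP := h2 F; apply.
rewrite inE; apply/andP; split; apply/forallP=> F; apply/implyP=> FC; first exact: h1.
apply/forallP=> F'; apply/implyP=> FC'.
have [->|ne] := eqVneq F F'; last exact: h2.
by rewrite /face_le !subxx.
Qed.

(** The link of a face with vertex colours [B0] is the join of the faces inside it, the boundary of
    a simplex, with the faces around it, the dual complex of a residue whose colours are outside
    [B0]. Such a residue misses some [i] in [B0], so the forest without [i] governs it. *)
Lemma good_forest s : 2 < q -> matched s ->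
  (forall i, i != ord0 -> forest s (nonzero_colors q :\ i)) ->
  connectedA s setT -> is_SYK s /\ pl_manifold q.-1 (bary_T0 s).
Proof.
move=> q3 ms fo con; set nz := nonzero_colors q.
have nz0 : ord0 \notin nz by rewrite inE eqxx.
have nzi0 i : ord0 \notin nz :\ i by rewrite !inE eqxx andbF.
split.
  (* Any nonzero colour serves; as [q] is at least 3, two colours or more remain beside it. *)
  pose i : 'I_q.+1 := inord 1.
  have i0 : i != ord0 by rewrite -val_eqE /= inordK // ltnS; lia.
  have inz : i \in nz by rewrite inE.
  have c2 : 1 < #|nz :\ i|.
    by have e := cardsD1 i nz; rewrite inz card_nonzero add1n in e; rewrite -ltnS -e.
  apply/forallP=> x; apply/forallP=> y; move/forallP/(_ x)/forallP/(_ y): con.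
  apply: conn_sub => z c _; have [->|c0] := eqVneq c ord0; last by apply: conn_step; rewrite inE.
  apply: (conn_subset (subD1set nz i)); apply: forest_zero_edge => //; exact: fo.
split; first by rewrite bary_cliques.
move=> F0; rewrite bary_cliques => /cliquesP[/(_ F0)]; rewrite inE eqxx => /(_ isT) fF0 _.
have fs : symmetric fcomp by move=> F F'; rewrite /fcomp orbC.
rewrite link_cliques //.
case/and3P: (fF0) => B0n B0nz /existsP[z0 /eqP S0E].
set B0 := F0.1 in B0n B0nz S0E *; set A' := nz :\: B0 in S0E.
have z0S : z0 \in F0.2 by rewrite S0E inE connect0.
have B0gt : 0 < #|B0| by rewrite card_gt0.
have cA' : #|A'| = q - #|B0|.
  by rewrite cardsD (setIidPr B0nz) card_nonzero.
have B0q : #|B0| <= q by have := subset_leq_card B0nz; rewrite card_nonzero.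
apply: pl_sphereP.
(* The index of [sphere] is the dimension plus one; the two factors of the join have dimensions
   [#|B0| - 2] and [#|A'| - 1]. *)
have -> : q.-2.+1 = #|B0|.-1 + #|A'|.
  by rewrite cA'; move: #|_| B0gt B0q q3 => m; clear; case: m; case: q => [|[|p]] //= m; lia.
pose P1 F := [&& is_face s F, F.1 \proper B0 & F0.2 \subset F.2].
pose P2 F := [&& is_face s F, B0 \proper F.1 & F.2 \subset F0.2].
have fcls F z : is_face s F -> z \in F.2 -> F.2 = cls s (nz :\: F.1) z.
  by case/and3P=> _ _ /existsP[y /eqP e] zF; rewrite e in zF *; apply/esym; apply: cls_same.
have fne F : is_face s F -> exists z, z \in F.2.
  by case/and3P=> _ _ /existsP[y /eqP e]; exists y; rewrite e inE connect0.
have funiq F F' z : is_face s F -> is_face s F' -> F.1 = F'.1 -> z \in F.2 -> z \in F'.2 -> F = F'.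
  move=> h1 h2 e z1 z2; rewrite [F]surjective_pairing [F']surjective_pairing.
  by rewrite (fcls F z) // (fcls F' z) // e.
apply: (@sphere_split _ _ _ _ P1 P2) => //.
- move=> F; rewrite /P1 /P2; have [fF /=|//] := boolP (is_face s F).
  have [z zF] := fne F fF.
  apply/andP/orP.
    case=> ne /orP[]/andP[s1 s2]; [left|right]; rewrite s2 andbT properEneq s1 andbT.
      by apply: contra ne => /eqP e; rewrite (funiq F F0 z0) // (subsetP s2).
    by apply: contra ne => /eqP e; rewrite (funiq F F0 z) // (subsetP s2).
  case=> /andP[p s2]; split.
  + by apply/eqP => e; rewrite e properxx in p.
  + by rewrite /fcomp /face_le (proper_sub p) s2.
  + by apply/eqP => e; rewrite e properxx in p.
  + by rewrite /fcomp /face_le (proper_sub p) s2 orbT.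
- by move=> F /and3P[_ p1 _] /and3P[_ p2 _]; have := proper_trans p1 p2; rewrite properxx.
- move=> F F' /and3P[_ p1 s1] /and3P[_ p2 s2].
  by rewrite /fcomp /face_le (proper_sub (proper_trans p1 p2)) (subset_trans s2 s1).
- apply: CE_trans (sphere_subsets B0gt) _.
  have clsS (B B' : {set 'I_q.+1}) : B \subset B' -> cls s (nz :\: B') z0 \subset cls s (nz :\: B) z0.
    by move=> sB; apply: cls_subset; apply: setDS.
  apply: (cliques_iso (f := fun B => (B, cls s (nz :\: B) z0))).
  + by move=> B B' _ _ [].
  + move=> B /andP[Bn Bp]; rewrite /P1 /is_face /= Bn Bp /=.
    rewrite (subset_trans (proper_sub Bp) B0nz) /=; apply/andP; split; first by apply/existsP; exists z0.
    by rewrite (fcls F0 z0) //; apply: clsS; apply: proper_sub.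
  + move=> F /and3P[fF p sF]; exists F.1; first by rewrite p; case/and3P: fF => ->.
    by rewrite -(fcls F z0) // -?surjective_pairing // (subsetP sF).
  + move=> B B' _ _ _; rewrite /fcomp /face_le /nested /=.
    by congr (_ || _); apply: andb_idr; apply: clsS.
- have [i iB0] : exists i, i \in B0 by apply/set0Pn.
  have i0 : i != ord0 by have := subsetP B0nz i iB0; rewrite inE.
  have sA' : A' \subset nz :\ i by apply: setDS; rewrite sub1set.
  apply: CE_trans (sphere_faces (nzi0 i) ms (fo i i0) z0 sA') _.
  have S0c : F0.2 = cls s A' z0 by rewrite S0E.
  have dd (E : {set 'I_q.+1}) : E \subset nz -> nz :\: (nz :\: E) = E.
    by move=> sE; rewrite setDDr setDv set0U; apply/setIidPr.
  have bA F : blockface s A' (cls s A' z0) F -> F.1 \subset nz.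
    by case/and3P=> /proper_sub h _ _; apply: subset_trans h (subsetDl _ _).
  have sD (E E' : {set 'I_q.+1}) : E \subset nz -> E' \subset nz ->
      (nz :\: E \subset nz :\: E') = (E' \subset E).
    by move=> h h'; apply/idP/idP => sE; [rewrite -(dd E') // -(dd E) //|]; apply: setDS.
  (* Block faces are indexed by the colours kept, faces of the dual complex by the colours of their
     vertices; the complement in [nz] passes from one to the other. *)
  apply: (cliques_iso (f := fun F => (nz :\: F.1, F.2))).
  + move=> F F' /bA h /bA h' [e1 e2]; rewrite [F]surjective_pairing [F']surjective_pairing e2.
    by rewrite -(dd F.1) // -(dd F'.1) // e1.
  + move=> F bF; have Fnz := bA _ bF; case/and3P: bF => Fp FS /existsP[z ez].
    have B0E : B0 = nz :\: A' by rewrite dd.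
    have A'nz : A' \subset nz by apply: subsetDl.
    have Bp : B0 \proper nz :\: F.1.
      by rewrite B0E properE !sD // -properE.
    rewrite /P2 /is_face /= Bp S0c FS subsetDl !andbT /=; apply/andP; split.
      by apply/set0Pn; have /properP[_ [d h _]] := Bp; exists d.
    by apply/existsP; exists z; rewrite dd.
  + move=> F /and3P[fF p sF]; have [z zF] := fne F fF; case/and3P: (fF) => Fn Fnz _.
    exists (nz :\: F.1, F.2); last by rewrite /= dd // -surjective_pairing.
    rewrite /blockface /= -S0c sF /A' /=; apply/andP; split.
      by rewrite properE !sD // -properE.
    by apply/existsP; exists z; rewrite -(fcls F z).
  + move=> F F' /bA h /bA h' _; rewrite /fcomp /face_le /= !sD // /fadj orbC.
    by [].
Qed.

End Manifold.

(** * Growing trees *)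

Section Growth.
Variables (q N : nat) (iota : {ffun 'I_N -> 'I_N}).
Implicit Types (s t : cgraph q N) (B : {set 'I_N}).
Let nz := nonzero_colors q.
Let slot := ('I_N * 'I_q.+1)%type.
Implicit Types st : seq slot.

Definition slots (b : 'I_N) : seq slot := [seq (b, c) | c <- enum nz].

(** [B] records one end only of each 0-edge reached so far; the other end counts as reached with
    it. *)
Definition used_by B (z : 'I_N) := (z \in B) || (iota z \in B).

(* [grow s st B t Bf]: starting from the tree [s] on the 0-edges of [B], the tree
   [t] on the 0-edges of [Bf] is obtained by treating the slots of [st] in order;
   a slot [(x, c)] is the edge of colour [c] at [x], and it is either closed or
   receives a new 0-edge [a, iota a], whose slots are the edges at [iota a]. *)
Inductive grow : cgraph q N -> seq slot -> {set 'I_N} -> cgraph q N -> {set 'I_N} -> Prop :=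
| grow_nil s B : grow s [::] B s B
| grow_none s e st B t Bf : grow s st B t Bf -> grow s (e :: st) B t Bf
| grow_some s x c st B t Bf a : ~~ used_by B a ->
    grow (ins s a c x) (slots (iota a) ++ st) (iota a |: B) t Bf ->
    grow s ((x, c) :: st) B t Bf.

(** Every colour exchanges the reached vertices in [B] with those outside [B], and the 0-edges not
    reached are isolated melons. Hence a tree is bipartite with [B] as one class, and the slots at
    vertices of [B] name each edge between reached vertices once. *)
Definition wf s st B :=
  [/\ matched s, s ord0 = iota, (forall z c, ~~ used_by B z -> s c z = iota z),
      (forall z c, used_by B z -> used_by B (s c z) /\ (s c z \in B) = (z \notin B)) &
      uniq st /\ (forall x c, (x, c) \in st -> x \in B /\ c \in nz)].

Lemma mem_slots b x c : ((x, c) \in slots b) = (x == b) && (c \in nz).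
Proof.
apply/mapP/andP => [[d]|[/eqP-> cn]]; last by exists c; rewrite ?mem_enum.
by rewrite mem_enum => dn [-> ->].
Qed.

Lemma uniq_slots b : uniq (slots b).
Proof. by rewrite map_inj_uniq ?enum_uniq // => c d []. Qed.

Lemma size_slots b : size (slots b) = q.
Proof.
rewrite size_map -cardE; have := cardsC [set (ord0 : 'I_q.+1)]; rewrite cards1 card_ord add1n => -[e].
by rewrite -[RHS]e; apply: eq_card => c; rewrite !inE.
Qed.

Lemma wf_iota s st B : wf s st B -> involutive iota /\ forall z, iota z != z.
Proof. by case=> ms <- _ _ _; split; [apply: matchedK|move=> z; apply: matched_neq]. Qed.

Lemma usedC s st B z : wf s st B -> used_by B (iota z) = used_by B z.
Proof. by case/wf_iota=> iK _; rewrite /used_by iK orbC. Qed.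

Lemma wf_perm s st st' B : perm_eq st st' -> wf s st B -> wf s st' B.
Proof.
move=> p [h1 h2 h3 h4 [h5 h6]]; split=> //; split; first by rewrite -(perm_uniq p).
by move=> x c; rewrite -(perm_mem p); apply: h6.
Qed.

Lemma wf_sub s st st' B : uniq st' -> {subset st' <= st} -> wf s st B -> wf s st' B.
Proof. by move=> u sub [h1 h2 h3 h4 [h5 h6]]; split=> //; split=> // x c /sub; apply: h6. Qed.

Lemma wf_behead s e st B : wf s (e :: st) B -> wf s st B.
Proof.
move=> w; apply: wf_sub (w); last by move=> z; rewrite inE orbC => ->.
by case: w => _ _ _ _ [/=/andP[]].
Qed.

Section Step.
Variables (s : cgraph q N) (B : {set 'I_N}) (st : seq slot) (x a : 'I_N) (c : 'I_q.+1).
Hypotheses (w : wf s st B) (xB : x \in B) (cn : c \in nz) (fa : ~~ used_by B a).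

Let ms : matched s. Proof. by case: w. Qed.
Let s0 : s ord0 = iota. Proof. by case: w. Qed.
Lemma fresh_neqs : [/\ a \notin B, iota a \notin B, x != a, x != iota a & iota a != a].
Proof.
have [iK ine] := wf_iota w; move: fa; rewrite /used_by negb_or => /andP[h1 h2].
by split=> //; apply: contraL xB => /eqP->.
Qed.

Lemma col_nz : c != ord0. Proof. by move: cn; rewrite inE. Qed.

Lemma fresh_fixed : fixedc s c a.
Proof. by rewrite /fixedc s0; case: w => _ _ -> // _ _. Qed.

Lemma step_side : (s c x \notin B) && used_by B (s c x).
Proof.
by case: w => _ _ _ /(_ x c) h _; have [] := h; rewrite /used_by ?xB // => -> ->.
Qed.

Lemma used_neq u v : used_by B u -> ~~ used_by B v -> u != v.
Proof. by move=> h1; apply: contra => /eqP <-. Qed.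

Lemma matched_step : matched (ins s a c x).
Proof. by have [_ _ h3 h4 _] := fresh_neqs; apply: matched_ins; rewrite ?s0 // fresh_fixed. Qed.

Lemma ins_a : ins s a c x c a = x. Proof. exact: insw. Qed.
Lemma ins_b : ins s a c x c (iota a) = s c x. Proof. by rewrite -s0 insw'. Qed.
Lemma ins_x : ins s a c x c x = a.
Proof. by have [_ _ h3 h4 _] := fresh_neqs; apply: insx; rewrite ?s0. Qed.
Lemma ins_y : ins s a c x c (s c x) = iota a.
Proof. by have [_ _ h3 h4 _] := fresh_neqs; rewrite insy ?s0 ?fresh_fixed. Qed.
Lemma ins_z z d : (d == c -> [/\ z != a, z != iota a, z != x & z != s c x]) -> ins s a c x d z = s d z.
Proof.
have [->{d}|dc] := eqVneq d c; last by rewrite ins_other.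
by move=> /(_ isT)[h1 h2 h3 h4]; rewrite ins_else // s0.
Qed.

Lemma wf_step : (x, c) \notin st -> wf (ins s a c x) (slots (iota a) ++ st) (iota a |: B).
Proof.
have [iK ine] := wf_iota w; have [aB bB xa xb ba] := fresh_neqs.
have /andP[yB yU] := step_side; have c0 := col_nz.
have [_ _ out bip [ust hst]] := w; move=> xst.
have us z : used_by (iota a |: B) z = [|| z == a, z == iota a | used_by B z].
  rewrite /used_by !inE (can_eq iK) /= [z == iota a]eq_sym.
  by case: (z == a); case: (iota a == z); case: (z \in B); case: (iota z \in B).
have bU : ~~ used_by B (iota a) by rewrite (usedC a w).
have ya : s c x != a by apply: used_neq.
have yb : s c x != iota a by apply: used_neq.
split.
- exact: matched_step.
- by rewrite ins0.
- move=> z d; rewrite us => /norP[za /norP[zb zU]]; rewrite ins_z; first exact: out.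
  move=> _; split=> //; first by apply: contra zU => /eqP->; rewrite /used_by xB.
  by apply: contra zU => /eqP->.
- move=> z d; rewrite !us !inE.
  have [->{d}|dc] := eqVneq d c; last first.
    rewrite ins_other //; case/or3P=> [/eqP->|/eqP->|zU].
    + by rewrite out // !eqxx orbT eq_sym (negPf ba) (negPf aB).
    + by rewrite out // iK !eqxx /= (negPf aB) eq_sym (negPf ba).
    + have [h1 h2] := bip z d zU; have -> : (s d z == iota a) = false by apply: negPf; apply: used_neq.
      have -> : (z == iota a) = false by apply: negPf; apply: used_neq.
      by rewrite h1 h2 !orbT.
  case/or3P=> [/eqP->|/eqP->|zU].
  + by rewrite ins_a (negPf xa) (negPf xb) xB /used_by xB (eq_sym a) (negPf ba) (negPf aB).
  + by rewrite ins_b (negPf ya) (negPf yb) yU (negPf yB) eqxx.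
  have za : z != a by apply: used_neq.
  have zb : z != iota a by apply: used_neq.
  have [->|zx] := eqVneq z x.
    by rewrite ins_x eqxx (eq_sym a) (negPf ba) (negPf aB) (negPf xb) xB.
  have [->|zy] := eqVneq z (s c x).
    by rewrite ins_y eqxx orbT (negPf yb) (negPf yB).
  rewrite ins_z //; have [h1 h2] := bip z c zU.
  have -> : (s c z == iota a) = false by apply: negPf; apply: used_neq.
  by rewrite (negPf zb) h1 h2 !orbT.
- split.
    rewrite cat_uniq uniq_slots ust andbT /=; apply/hasPn => -[u d] /hst[uB _].
    by rewrite mem_slots negb_and; apply/orP; left; apply: contra bB => /eqP<-.
  move=> u d; rewrite mem_cat mem_slots => /orP[/andP[/eqP-> dn]|/hst[uB dn]]; split=> //.
    by rewrite !inE eqxx.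
  by rewrite !inE uB orbT.
Qed.

End Step.

Lemma wf_some s x c st B a : wf s ((x, c) :: st) B -> ~~ used_by B a ->
  wf (ins s a c x) (slots (iota a) ++ st) (iota a |: B).
Proof.
move=> w fa; case: (w) => _ _ _ _ [/=/andP[xst _] /(_ x c)]; rewrite inE eqxx => /(_ isT)[xB cn].
exact: (wf_step (wf_behead w)).
Qed.

Lemma grow_sub s st B t Bf : grow s st B t Bf -> B \subset Bf.
Proof.
elim=> // {s st B t Bf} s x c st B t Bf a _ _; apply: subset_trans; exact: subsetUr.
Qed.

Lemma grow_wf s st B t Bf : grow s st B t Bf -> wf s st B -> wf t [::] Bf.
Proof.
elim=> // {s st B t Bf}.
- by move=> s e st B t Bf _ IH /wf_behead.
- by move=> s x c st B t Bf a fa _ IH w; apply: IH; apply: wf_some.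
Qed.

(** An edge changes only through an open slot at one of its ends, and slots opened later sit at new
    vertices. Thanks to this a history can be read off its result. *)
Lemma grow_frozen s st B t Bf : grow s st B t Bf -> wf s st B ->
  forall z c, used_by B z -> (z, c) \notin st -> (s c z, c) \notin st -> t c z = s c z.
Proof.
elim=> // {s st B t Bf}.
- move=> s e st B t Bf _ IH w z c zU; rewrite !inE !negb_or => /andP[_ h1] /andP[_ h2].
  by apply: IH => //; apply: wf_behead w.
move=> s x c st B t Bf a fa _ IH w z d zU; rewrite !inE !negb_or => /andP[zx h1] /andP[zy h2].
have w' := wf_some w fa; have wb := wf_behead w.
case: (w) => ms s0 _ bip [/=/andP[xst _] /(_ x c)]; rewrite inE eqxx => /(_ isT)[xB cn].
have bU : ~~ used_by B (iota a) by rewrite (usedC a w).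
have e : ins s a c x d z = s d z.
  apply: (ins_z w) => /eqP dc; rewrite dc in zx zy *.
  split; [exact: used_neq zU fa|exact: used_neq zU bU|by apply: contra zx => /eqP->|].
  by apply: contra zy => /eqP->; rewrite matchedK.
rewrite -e; apply: IH => //.
- by move: zU; rewrite /used_by !inE => /orP[]->; rewrite ?orbT.
- rewrite mem_cat mem_slots (negPf h1) orbF negb_and; apply/orP; left; exact: used_neq zU bU.
- rewrite e mem_cat mem_slots (negPf h2) orbF negb_and; apply/orP; left.
  by apply: used_neq bU; have [] := bip z d zU.
Qed.

(* The first slot is closed exactly when [t c x] is already in use. *)
Lemma grow_cons s x c st B t Bf : grow s ((x, c) :: st) B t Bf -> wf s ((x, c) :: st) B ->
  if used_by B (t c x) then grow s st B t Bf else
  grow (ins s (t c x) c x) (slots (iota (t c x)) ++ st) (iota (t c x) |: B) t Bf.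
Proof.
move=> g w; have wb := wf_behead w.
case: (w) => ms s0 _ bip [/=/andP[xst _] hst]; have [xB cn] := hst x c (mem_head _ _).
have xU : used_by B x by rewrite /used_by xB.
have /andP[yB yU] := step_side c wb xB.
inversion g as [|s1 e1 st1 B1 t1 Bf1 g1 e2 e3|s1 x1 c1 st1 B1 t1 Bf1 a fa g1 e2 e3].
  have -> : t c x = s c x.
    apply: (grow_frozen g1) => //; apply: contra yB => h.
    by have [] := hst (s c x) c; rewrite // inE h orbT.
  by rewrite yU.
have w' := wf_some w fa; have [aB bB xa xb ba] := fresh_neqs wb xB fa.
have -> : t c x = a.
  have e : ins s a c x c x = a := ins_x c wb xB fa.
  rewrite -[RHS]e; apply: (grow_frozen g1) => //.
  - by rewrite /used_by !inE xB orbT.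
  - by rewrite mem_cat mem_slots (negPf xb) /= (negPf xst).
  - rewrite e mem_cat mem_slots eq_sym (negPf ba) /=; apply: contra aB => h.
    by have [] := hst a c; rewrite // inE h orbT.
by rewrite (negPf fa).
Qed.

(** Different slots at vertices of [B] are different edges, so neither insertion affects the edge
    used by the other. All rearrangements of histories rest on this. *)
Lemma ins_comm s st B x c x' c' a a' : wf s st B -> x \in B -> x' \in B -> c \in nz -> c' \in nz ->
  (x, c) != (x', c') -> ~~ used_by B a -> ~~ used_by B a' -> a' != a -> a' != iota a ->
  ins (ins s a c x) a' c' x' = ins (ins s a' c' x') a c x.
Proof.
move=> w xB x'B cn c'n ne fa fa' aa ab.
have [iK ine] := wf_iota w.
have [aB bB xa xb ba] := fresh_neqs w xB fa; have [_ _ x'a x'b _] := fresh_neqs w x'B fa.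
have [aB' bB' xa' xb' ba'] := fresh_neqs w xB fa'; have [_ _ x'a' x'b' _] := fresh_neqs w x'B fa'.
have ms : matched s by case: w. have s0 : s ord0 = iota by case: w.
have c0 := col_nz cn; have c0' := col_nz c'n.
apply/ffunP=> d; apply/ffunP=> z.
have [cc|cc] := eqVneq c c'; last first.
  have e1 : ins s a c x c' = s c' by rewrite ins_other // eq_sym.
  have e2 : ins s a' c' x' c = s c by rewrite ins_other.
  have [->{d}|dc] := eqVneq d c.
    rewrite (ins_other (ins s a c x) a' x' cc) [RHS]insE e2 ins0 // s0.
    by rewrite insE s0.
  have [->{d dc}|dc'] := eqVneq d c'; last by rewrite !ins_other.
  have e3 : ins (ins s a' c' x') a c x c' = ins s a' c' x' c' by rewrite ins_other // eq_sym.
  by rewrite e3 insE [RHS]insE e1 ins0 // !s0.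
rewrite -cc in c'n c0' ne *; have xx : x' != x by apply: contra ne => /eqP->.
have [->{d}|dc] := eqVneq d c; last by rewrite !ins_other.
have /andP[yB yU] := step_side c w xB; have /andP[yB' yU'] := step_side c w x'B.
have bU : ~~ used_by B (iota a) by rewrite (usedC a w).
have bU' : ~~ used_by B (iota a') by rewrite (usedC a' w).
have xU : used_by B x by rewrite /used_by xB. have xU' : used_by B x' by rewrite /used_by x'B.
have yy : s c x' != s c x by rewrite (can_eq (matchedK c ms)).
have x'y : x' != s c x by apply: contraL x'B => /eqP->.
have xy' : x != s c x' by apply: contraL xB => /eqP->.
have e1 : ins s a c x c x' = s c x' by apply: (ins_z w) => _; split.
have e2 : ins s a' c x' c x = s c x.
  by apply: (ins_z w) => _; split; rewrite // eq_sym.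
have bb : iota a' != iota a by rewrite (can_eq iK).
have a'b : iota a' != a by apply: contra ab => /eqP <-; rewrite iK.
rewrite insE [in RHS]insE !ins0 // !s0 e1 e2 !insE !s0.
have y'a := used_neq yU' fa; have y'b := used_neq yU' bU.
have ya' := used_neq yU fa'; have yb' := used_neq yU bU'.
have [->|za'] := eqVneq z a'.
  by rewrite (negPf aa) (negPf ab) eq_sym (negPf xa') eq_sym (negPf ya').
have [->|zb'] := eqVneq z (iota a').
  by rewrite (negPf a'b) (negPf bb) eq_sym (negPf xb') eq_sym (negPf yb').
have [->|zx'] := eqVneq z x'.
  by rewrite (negPf x'a) (negPf x'b) (negPf xx) (negPf x'y).
have [->|zy'] := eqVneq z (s c x').
  by rewrite (negPf y'a) (negPf y'b) eq_sym (negPf xy') (negPf yy).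
by [].
Qed.

End Growth.

Section Growth.
Variables (q N : nat) (iota : {ffun 'I_N -> 'I_N}).
Implicit Types (s t : cgraph q N) (B : {set 'I_N}).
Notation nz := (nonzero_colors q).
Notation slot := ('I_N * 'I_q.+1)%type.
Implicit Types st : seq slot.
Notation grow := (grow iota).
Notation wf := (wf iota).
Notation used := (used_by iota).
Notation slots := (@slots q N).

Lemma usedU B a z : involutive iota -> used (iota a |: B) z = [|| z == a, z == iota a | used B z].
Proof.
move=> iK; rewrite /used_by !inE (can_eq iK) /=.
by case: (z == a); case: (z == iota a); case: (z \in B); case: (iota z \in B).
Qed.

Lemma wf_head s x c st B : wf s ((x, c) :: st) B -> [/\ x \in B, c \in nz & (x, c) \notin st].
Proof. by case=> _ _ _ _ [/=/andP[h _] /(_ x c (mem_head _ _))[]]. Qed.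

Lemma fresh_B B a : ~~ used B a -> iota a \notin B.
Proof. by rewrite /used_by negb_or => /andP[]. Qed.

Lemma card_fresh B a k : ~~ used B a -> #|~: B| <= k.+1 -> #|~: (iota a |: B)| <= k.
Proof.
move=> /fresh_B bB; rewrite (cardsD1 (iota a) (~: B)) in_setC bB add1n ltnS.
by have -> : ~: (iota a |: B) = (~: B) :\ iota a by apply/setP=> z; rewrite !inE negb_or.
Qed.

Lemma grow_none_cat s st st' B t Bf : grow s st B t Bf -> grow s (st' ++ st) B t Bf.
Proof. by elim: st' => //= e st' IH g; apply: grow_none; apply: IH. Qed.

Lemma perm_mid (T : eqType) (e : T) (l1 l2 : seq T) : perm_eq (l1 ++ e :: l2) (e :: l1 ++ l2).
Proof. by apply/permPl; apply: (perm_catCA l1 [:: e] l2). Qed.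

(** Two slots are exchanged by [ins_comm]. Each insertion lowers the number of vertices outside [B],
    and induction on this number permits reordering the lists enlarged by new slots. *)
Lemma grow_perm s st st' B t Bf : wf s st B -> perm_eq st st' -> grow s st B t Bf -> grow s st' B t Bf.
Proof.
move: (leqnn #|~: B|); move: {2}#|~: B| => k.
elim: k s st st' B t Bf => [|k IH] s st st' B t Bf lek w p g.
  have full a : used B a.
    have : #|~: B| == 0 by rewrite -leqn0.
    rewrite cards_eq0 => /eqP/setP/(_ a); rewrite !inE => /negbFE aB.
    by rewrite /used_by aB.
  have g0 st0 : grow s st0 B t Bf -> wf s st0 B -> grow s [::] B t Bf.
    elim: st0 => // -[x c] st0 IH g1 w1; have := grow_cons g1 w1.
    by rewrite full => g2; apply: IH g2 (wf_behead w1).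
  by rewrite -[st']cats0; apply: grow_none_cat; apply: g0 g w.
(* A slot is brought to the front past the slots of [st1] one by one; the delicate case is that both
   slots concerned receive an insertion. *)
have front st1 e st2 : wf s (st1 ++ e :: st2) B -> grow s (st1 ++ e :: st2) B t Bf ->
    grow s (e :: st1 ++ st2) B t Bf.
  elim: st1 => // -[x1 c1] st1 IH1 w1 g1; case: e => x c in IH1 w1 g1 *.
  have we : wf s ((x, c) :: (x1, c1) :: st1 ++ st2) B.
    exact: wf_perm (perm_mid (x, c) ((x1, c1) :: st1) st2) w1.
  have [xB cn xst] := wf_head we; have [x1B c1n x1st] := wf_head w1.
  have ne : (x, c) != (x1, c1) by move: xst; rewrite inE negb_or => /andP[].
  have wb := wf_behead we; have [iK ine] := wf_iota w.
  have w2 : wf s ((x, c) :: st1 ++ st2) B.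
    apply: wf_sub (we); last by move=> z; rewrite !inE => /orP[->|->]; rewrite ?orbT.
    by case: we => _ _ _ _ [/= /and3P[h1 _ ->] _]; move: h1; rewrite inE negb_or => /andP[_ ->].
  have := grow_cons g1 w1; case: ifPn => u1 g2.
    have {}g2 := IH1 (wf_behead w1) g2.
    have := grow_cons g2 w2; case: ifPn => u2 g3.
      by apply: grow_none; apply: grow_none.
    apply: (grow_some u2); move: u2 g3; set a := t c x => u2 g3.
    have ws := wf_some w2 u2; have ws' := wf_some we u2.
    apply: (IH _ ((x1, c1) :: slots (iota a) ++ st1 ++ st2)).
    - exact: card_fresh.
    - exact: wf_perm (perm_mid _ _ _) ws'.
    - by rewrite perm_sym perm_mid.
    - exact: grow_none.
  move: u1 g2; set a1 := t c1 x1 => u1 g2; have ws := wf_some w1 u1.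
  have p1 : perm_eq (slots (iota a1) ++ st1 ++ (x, c) :: st2) ((x, c) :: slots (iota a1) ++ st1 ++ st2).
    by rewrite catA [in X in perm_eq _ X]catA perm_mid.
  have g3 := IH _ _ _ _ _ _ (card_fresh u1 lek) ws p1 g2.
  have ws2 := wf_perm p1 ws.
  have := grow_cons g3 ws2; case: ifPn => u2 g4.
    by apply: grow_none; apply: (grow_some u1).
  move: u2 g4; set a := t c x => u2 g4; have ws3 := wf_some ws2 u2.
  move: (u2); rewrite usedU // => /norP[aa1 /norP[ab1 ua]].
  have u1' : ~~ used (iota a |: B) a1.
    rewrite usedU // (negPf u1) orbF; apply/norP; split; first by rewrite eq_sym.
    by apply: contra ab1 => /eqP->; rewrite iK.
  apply: (grow_some ua).
  have wsa := wf_some we ua; have wsa2 : wf (ins s a c x) ((x1, c1) :: slots (iota a) ++ st1 ++ st2) (iota a |: B).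
    exact: wf_perm (perm_mid _ _ _) wsa.
  apply: (IH _ ((x1, c1) :: slots (iota a) ++ st1 ++ st2)) => //.
  - exact: card_fresh.
  - by rewrite perm_sym perm_mid.
  apply: (grow_some u1').
  have com : ins (ins s a c x) a1 c1 x1 = ins (ins s a1 c1 x1) a c x.
    by apply/esym; apply: (ins_comm w) => //; rewrite eq_sym.
  have Bc : iota a1 |: (iota a |: B) = iota a |: (iota a1 |: B) by rewrite setUCA.
  rewrite com Bc; apply: IH ws3 _ g4.
    exact: card_fresh u2 (leqW (card_fresh u1 lek)).
  by rewrite !catA perm_cat2r perm_cat2r perm_catC.
elim: st' s st p w g lek front => [|[x c] st' IH'] s st p w g lek front.
  by move/perm_nilP: p g => ->.
have xst : (x, c) \in st by rewrite (perm_mem p) mem_head.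
case/splitPr: xst p w g => st1 st2 p w g.
have p' : perm_eq (st1 ++ st2) st'.
  by rewrite -(perm_cons (x, c)) -(permPr p) perm_sym perm_mid.
have wx : wf s ((x, c) :: st1 ++ st2) B.
  exact: wf_perm (perm_mid _ _ _) w.
have := grow_cons (front _ _ _ w g) wx; case: ifPn => u g2.
  by apply: grow_none; apply: IH' g2 _ _ => //; apply: wf_behead wx.
apply: (grow_some u); apply: IH (wf_some wx u) _ g2; first exact: card_fresh.
by rewrite perm_cat2l.
Qed.

(** A slot absent from the list is never treated, so an insertion there may precede the growth
    instead of following it. *)
Lemma grow_ins_frozen s st B t Bf x c a : grow s st B t Bf -> wf s st B -> x \in B -> c \in nz ->
  (x, c) \notin st -> ~~ used Bf a ->
  grow (ins s a c x) st (iota a |: B) (ins t a c x) (iota a |: Bf).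
Proof.
move=> g; elim: g x c a => {s st B t Bf}.
- by move=> *; apply: grow_nil.
- move=> s e st B t Bf _ IH x c a w xB cn; rewrite inE negb_or => /andP[_ xst] ua.
  by apply: grow_none; apply: IH => //; apply: wf_behead w.
move=> s x0 c0 st B t Bf a0 fa0 g IH x c a w xB cn; rewrite inE negb_or => /andP[ne xst] ua.
have [x0B c0n x0st] := wf_head w; have [iK ine] := wf_iota w.
have ws := wf_some w fa0; have bB := fresh_B fa0.
have sub := grow_sub g.
have subU z : used (iota a0 |: B) z -> used Bf z.
  by rewrite /used_by => /orP[]/(subsetP sub)->; rewrite ?orbT.
have ua0 : ~~ used (iota a0 |: B) a by apply: contra ua; apply: subU.
move: (ua0); rewrite usedU // => /norP[aa0 /norP[ab0 uaB]].
have fa0' : ~~ used (iota a |: B) a0.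
  rewrite usedU // (negPf fa0) orbF; apply/norP; split; first by rewrite eq_sym.
  by apply: contra ab0 => /eqP->; rewrite iK.
apply: (grow_some fa0').
have -> : ins (ins s a c x) a0 c0 x0 = ins (ins s a0 c0 x0) a c x.
  apply: (ins_comm w) => //; first by rewrite eq_sym.
  by apply: contra ab0 => /eqP->; rewrite iK.
rewrite setUCA; apply: IH => //; first by rewrite !inE xB orbT.
rewrite mem_cat mem_slots (negPf xst) orbF negb_and; apply/orP; left.
by apply: contraL xB => /eqP->.
Qed.

Lemma slots_perm b c : c \in nz -> perm_eq (slots b) ((b, c) :: rem (b, c) (slots b)).
Proof. by move=> cn; apply: perm_to_rem; rewrite mem_slots eqxx. Qed.

(** Histories are closed under adding a leaf. The last hypothesis says that the slot is still to be
    treated or still to be opened. If the history fills it with some [a0], the new 0-edge goes there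
    instead and [a0] moves to the slot behind it. *)
Lemma grow_insert s st B t Bf x c a : grow s st B t Bf -> wf s st B -> x \in Bf -> c \in nz ->
  ~~ used Bf a -> ((x, c) \in st) || (x \notin B) ->
  grow s st B (ins t a c x) (iota a |: Bf).
Proof.
move=> g; elim: g x c a => {s st B t Bf}.
- by move=> s B x c a _ ->.
- move=> s [x0 c0] st B t Bf g IH x c a w xBf cn ua.
  have [x0B c0n x0st] := wf_head w; have wb := wf_behead w.
  have uaB : ~~ used B a.
    by apply: contra ua; rewrite /used_by => /orP[]/(subsetP (grow_sub g))->; rewrite ?orbT.
  rewrite inE; have [[-> ->] _|_ h] := eqVneq (x, c) (x0, c0); last by apply: grow_none; apply: IH.
  apply: (grow_some uaB); apply: grow_none_cat.
  exact: grow_ins_frozen.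
move=> s x0 c0 st B t Bf a0 fa0 g IH x c a w xBf cn ua.
have [x0B c0n x0st] := wf_head w; have wb := wf_behead w; have [iK ine] := wf_iota w.
have ws := wf_some w fa0.
have subU z : used (iota a0 |: B) z -> used Bf z.
  by rewrite /used_by => /orP[]/(subsetP (grow_sub g))->; rewrite ?orbT.
have ua0 : ~~ used (iota a0 |: B) a by apply: contra ua; apply: subU.
move: (ua0); rewrite usedU // => /norP[aa0 /norP[ab0 uaB]].
have bB0 := fresh_B fa0.
rewrite inE; have [[ex ec] _|ne h] := eqVneq (x, c) (x0, c0); last first.
  apply: (grow_some fa0); apply: IH => //; rewrite mem_cat mem_slots cn andbT !inE negb_or.
  by have [->|_] := eqVneq x (iota a0); rewrite // orbC.
(* Insert [a] at the slot first, and [a0] in the new slot [(iota a, c)]. *)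
rewrite ex ec in xBf cn *.
have wsa := wf_some w uaB.
apply: (grow_some uaB); set b := iota a.
have pb : perm_eq ((b, c0) :: rem (b, c0) (slots b) ++ st) (slots b ++ st).
  by rewrite -cat_cons perm_cat2r perm_sym slots_perm.
apply: (grow_perm _ pb); first by apply: wf_perm wsa; rewrite perm_sym.
have fa0' : ~~ used (b |: B) a0.
  rewrite usedU // (negPf fa0) orbF; apply/norP; split; first by rewrite eq_sym.
  by apply: contra ab0 => /eqP->; rewrite iK.
apply: (grow_some fa0').
have g1 : grow (ins (ins s a0 c0 x0) a c0 x0) (slots (iota a0) ++ st) (iota a |: (iota a0 |: B))
    (ins t a c0 x0) (iota a |: Bf).
  apply: grow_ins_frozen => //; first by rewrite !inE x0B orbT.
  rewrite mem_cat mem_slots (negPf x0st) orbF negb_and; apply/orP; left.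
  by apply: contraL x0B => /eqP->.
(* Either way the 0c-cycle reads [x0], [a], [iota a], [a0], [iota a0], [s c0 x0]. *)
have sw : ins (ins s a c0 x0) a0 c0 b = ins (ins s a0 c0 x0) a c0 x0.
  have ms : matched s by case: w. have s0 : s ord0 = iota by case: w.
  have c00 := col_nz c0n.
  apply/ffunP=> d; apply/ffunP=> z; have [->{d}|dc] := eqVneq d c0; last by rewrite !ins_other.
  have [aB bB xa xb ba] := fresh_neqs wb x0B uaB; have [aB0 _ xa0 xb0 ba0] := fresh_neqs wb x0B fa0.
  have /andP[yB yU] := step_side c0 wb x0B.
  have bU : ~~ used B (iota a) by rewrite (usedC a w).
  have bU0 : ~~ used B (iota a0) by rewrite (usedC a0 w).
  have ya := used_neq yU uaB; have yb := used_neq yU bU.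
  have ya0 := used_neq yU fa0; have yb0 := used_neq yU bU0.
  have a0b : a0 != b by apply: contra ab0 => /eqP->; rewrite iK.
  have bb0 : b != iota a0 by rewrite (can_eq iK).
  have e1 : ins s a c0 x0 c0 b = s c0 x0 by apply: (ins_b _ _ _ wb).
  have e2 : ins s a0 c0 x0 c0 x0 = a0 by apply: (ins_x c0 wb).
  have xy : x0 != s c0 x0 by apply: contraL x0B => /eqP->.
  rewrite insE [in RHS]insE !ins0 // !s0 e1 e2 !insE !s0 -/b.
  have [->|z1] := eqVneq z a0.
    by rewrite eq_sym (negPf aa0) (negPf a0b) eq_sym (negPf xa0).
  have [->|z2] := eqVneq z (iota a0).
    have -> : (iota a0 == a) = false by rewrite eq_sym (negPf ab0).
    have -> : (iota a0 == b) = false by rewrite eq_sym (negPf bb0).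
    by have -> : (iota a0 == x0) = false by rewrite eq_sym (negPf xb0).
  have [->|z3] := eqVneq z b; first by rewrite (negPf ba).
  have [->|z4] := eqVneq z (s c0 x0).
    by rewrite (negPf ya) eq_sym (negPf xy).
  by case: (z == a); case: (z == x0).
have perm2 : perm_eq (rem (b, c0) (slots b) ++ slots (iota a0) ++ st)
    (slots (iota a0) ++ rem (b, c0) (slots b) ++ st).
  by rewrite !catA perm_cat2r perm_catC.
have Bc : iota a0 |: (b |: B) = b |: (iota a0 |: B) by rewrite setUCA.
rewrite Bc sw; apply: grow_perm (perm2) _; last exact: grow_none_cat.
have w1 : wf (ins s a c0 x0) ((b, c0) :: rem (b, c0) (slots b) ++ st) (b |: B).
  by apply: wf_perm wsa; rewrite perm_sym.
have := wf_some w1 fa0'; rewrite Bc sw.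
by apply: wf_perm; rewrite perm_sym; exact: perm2.
Qed.

End Growth.

Section Growth.
Variables (q N : nat) (iota : {ffun 'I_N -> 'I_N}).
Implicit Types (s t : cgraph q N) (B : {set 'I_N}).
Notation nz := (nonzero_colors q).
Notation slot := ('I_N * 'I_q.+1)%type.
Implicit Types st : seq slot.
Notation grow := (grow iota).
Notation wf := (wf iota).
Notation used := (used_by iota).
Notation slots := (@slots q N).

(** Starting point of every growth: all colours coincide, and nothing but isolated melons is
    present. *)
Definition melons : cgraph q N := [ffun=> iota].

Lemma nz0 : ord0 \notin nz. Proof. by rewrite inE eqxx. Qed.

Lemma card_used s st B : wf s st B -> #|[set z | used B z]| = 2 * #|B|.
Proof.
move=> w; have [iK ine] := wf_iota w; case: w => _ s0 _ bip _.
have -> : [set z | used B z] = B :|: (iota @: B).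
  apply/setP=> z; rewrite !inE /used_by; congr (_ || _).
  by rewrite -[z in RHS]iK mem_imset //; apply: can_inj iK.
rewrite cardsU (_ : B :&: (iota @: B) = set0) ?cards0 ?subn0.
  by rewrite card_imset ?mul2n ?addnn //; apply: can_inj iK.
apply/setP=> z; rewrite !inE; apply/negP => /andP[zB /imsetP[y yB e]].
by have [] := bip y ord0; rewrite /used_by ?yB // s0 -e zB.
Qed.

Lemma full_used s st B : wf s st B -> (forall z, used B z) -> 2 * #|B| = N.
Proof.
move=> w h; rewrite -(card_used w) -[RHS]card_ord -cardsT; apply: eq_card => z.
by rewrite !inE h.
Qed.

Lemma used_full s st B : wf s st B -> 2 * #|B| = N -> forall z, used B z.
Proof.
move=> w e z; have : [set z | used B z] == setT by rewrite eqEcard subsetT cardsT card_ord (card_used w) e leqnn.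
by move/eqP/setP/(_ z); rewrite !inE.
Qed.

Section Root.
Hypotheses (iK : involutive iota) (ine : forall z, iota z != z).

Lemma matched_melons : matched melons.
Proof. by apply/forallP=> c; apply/forallP=> z; rewrite ffunE iK eqxx ine. Qed.

Lemma wf_melons v : wf melons (slots v) [set v].
Proof.
split.
- exact: matched_melons.
- by rewrite ffunE.
- by move=> z c _; rewrite ffunE.
- move=> z c; rewrite ffunE /used_by !inE iK => h; split; first by rewrite orbC.
  case/orP: h => /eqP h; first by rewrite h eqxx (negPf (ine v)).
  by rewrite h eqxx; apply/esym/eqP => e; have := ine z; rewrite h e eqxx.
- split; first exact: uniq_slots.
  by move=> x c; rewrite mem_slots => /andP[/eqP-> cn]; rewrite set11.
Qed.

End Root.

Lemma cutC s w c : matched s -> c != ord0 -> cut s (s ord0 w) c = cut s w c.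
Proof.
move=> ms c0; apply/ffunP=> d; apply/ffunP=> z.
have [->{d}|dc] := eqVneq d c; last by rewrite !cut_other.
rewrite !cutE !matchedK //; set w' := s ord0 w.
have ne : w' != w := matched_neq ord0 w ms.
have [->|_] := eqVneq z w; first by rewrite eq_sym (negPf ne).
have [//|_] := eqVneq z w'.
have [->|_] := eqVneq z (s c w).
  by rewrite (can_eq (matchedK c ms)) eq_sym (negPf ne).
by [].
Qed.

(** A leaf other than the root is peeled off and put back by [grow_insert]. The components not
    containing [v] are allowed to be isolated melons, because a peeled 0-edge becomes one. *)
Lemma grow_root t v : matched t -> t ord0 = iota -> forest t nz ->
  (forall z, nonfixed t nz z != 0 -> conn t (ord0 |: nz) v z) ->
  exists2 Bf, grow melons (slots v) [set v] t Bf & forall z, used Bf z = conn t (ord0 |: nz) v z.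
Proof.
have [k] := ubnP (\sum_z nonfixed t nz z); elim: k t => // k IH t /ltnSE lek mt t0 fo hc.
have iK : involutive iota by rewrite -t0; apply: matchedK.
have ine z : iota z != z by rewrite -t0; apply: matched_neq.
have [/existsP[z1 nz1]|] := boolP [exists z, nonfixed t nz z != 0]; last first.
  rewrite negb_exists => /forallP h.
  have tE c z : t c z = iota z.
    have [->|c0] := eqVneq c ord0; first by rewrite t0.
    have cn : c \in nz by rewrite inE.
    by have := h z; rewrite negbK => /nonfixed0P/(_ c cn)/eqP->; rewrite t0.
  have -> : t = melons by apply/ffunP=> c; apply/ffunP=> z; rewrite ffunE tE.
  exists [set v]; first by rewrite -[slots v]cats0; apply: grow_none_cat; apply: grow_nil.
  move=> z; rewrite /used_by !inE; apply/orP/idP.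
    case=> [/eqP->|/eqP<-]; first exact: conn_refl.
    rewrite conn_sym; last exact: matched_melons.
    have -> : iota z = melons ord0 z by rewrite ffunE.
    by apply: conn_step; rewrite setU11.
  move=> h'; have : z \in [set v; iota v].
    apply: conn_closed h'; last by rewrite !inE eqxx.
    by move=> u c; rewrite ffunE !inE => /orP[]/eqP-> _; rewrite ?iK eqxx ?orbT.
  by rewrite !inE => /orP[/eqP->|/eqP->]; [left|right; rewrite iK].
have [a [c [av av' cA nf lf]]] := forest_leaf nz0 v mt fo nz1.
have c0 : c != ord0 by move: cA; rewrite inE.
rewrite t0 in av'.
have m' := matched_cut mt nf; have t0' : cut t a c ord0 = iota by rewrite cut0.
have fo' := forest_cut_leaf nz0 mt fo cA nf lf.
have [ba xa xb ya yb] := cut_neqs mt nf; rewrite t0 in ba xb ya yb.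
have conE u w : conn (cut t a c) (ord0 |: nz) u w =
    if u \in [set a; iota a] then w \in [set a; iota a] else
    (w \notin [set a; iota a]) && conn t (ord0 |: nz) u w.
  rewrite conn_cut_leaf ?t0 //; first by rewrite setU1r.
    by move=> c'; rewrite !inE => /orP[/eqP->|c'n] c'c; [rewrite /fixedc|apply: lf; rewrite ?inE].
  by exists ord0; rewrite ?setU11 // eq_sym.
have vab : v \notin [set a; iota a].
  rewrite !inE; apply/norP; split; first by rewrite eq_sym.
  by apply: contra av' => /eqP->; rewrite iK.
have fa d : d \in nz -> fixedc (cut t a c) d a.
  have [-> _|dc] := eqVneq d c; first exact: fixed_cut.
  by move=> dn; rewrite /fixedc cut_other // t0' -t0; apply: lf.
have hc' z : nonfixed (cut t a c) nz z != 0 -> conn (cut t a c) (ord0 |: nz) v z.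
  move=> nz'; rewrite conE (negPf vab); apply/andP; split.
    apply: contra nz'; rewrite !inE => /orP[]/eqP->; first exact/nonfixed0P.
    by rewrite -t0' nonfixedC ?nz0 //; apply/nonfixed0P.
  apply: hc; apply: contra nz' => /eqP e; have := nonfixed_cut nz0 z mt cA nf.
  by rewrite e leqn0.
have [Bf gB uB] := IH _ (leq_trans (sum_nonfixed_cut nz0 mt cA nf) lek) m' t0' fo' hc'.
have wB := grow_wf gB (wf_melons iK ine v).
have va : conn t (ord0 |: nz) v a.
  by apply: hc; apply/negP => /nonfixed0P/(_ c cA); rewrite (negPf nf).
have vx : conn t (ord0 |: nz) v (t c a) by apply: (conn_trans va); apply: conn_step; rewrite setU1r.
have xU : used Bf (t c a).
  by rewrite uB conE (negPf vab) vx andbT !inE (negPf xa) (negPf xb).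
have abU z : z \in [set a; iota a] -> ~~ used Bf z.
  by move=> zab; rewrite uB conE (negPf vab) zab.
(* The inserted end has to be the one whose neighbour lies in [Bf]; exactly which end this is
   depends on [t], and the cut is the same for both. *)
have fin a1 : a1 \in [set a; iota a] -> t c a1 \in Bf -> cut t a1 c = cut t a c -> ~~ fixedc t c a1 ->
  (a1 == a) || (iota a1 == a) ->
  exists2 Bf', grow melons (slots v) [set v] t Bf' & forall z, used Bf' z = conn t (ord0 |: nz) v z.
  move=> a1ab xB ec nf1 ea; exists (iota a1 |: Bf).
    have <- : ins (cut t a c) a1 c (t c a1) = t by rewrite -ec cutK.
    apply: (grow_insert gB) => //; first exact: wf_melons.
      exact: abU.
    by rewrite mem_slots cA andbT inE orbN.
  move=> z; rewrite usedU // uB conE (negPf vab).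
  have -> : (z == a1) || ((z == iota a1) || ((z \notin [set a; iota a]) && conn t (ord0 |: nz) v z))
     = (z \in [set a; iota a]) || conn t (ord0 |: nz) v z.
    case/orP: ea => /eqP e; rewrite ?e.
      by rewrite !inE; case: (z == a); case: (z == iota a).
    have -> : a1 = iota a by rewrite -e iK.
    by rewrite ?iK !inE; case: (z == a); case: (z == iota a).
  case zab: (z \in [set a; iota a]) => //=; symmetry; move: zab; rewrite !inE => /orP[]/eqP-> //.
  by apply: (conn_trans va); rewrite -t0; apply: conn_step; rewrite setU11.
have [xB|xB] := boolP (t c a \in Bf); first by apply: (fin a); rewrite ?inE ?eqxx.
apply: (fin (iota a)).
- by rewrite !inE eqxx orbT.
- have [_ _ _ bip _] := wB; have [_] := bip (t c a) c xU.
  by rewrite xB cutx // t0.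
- by rewrite -t0 cutC.
- by rewrite -t0 fixedcC.
- by rewrite iK eqxx orbT.
Qed.

(** Converse of [grow_root]: an insertion joins the new 0-edge to the component of [v] and merges
    two cycles, so that the order is 0 when all vertices are reached. *)
Lemma grow_tree s st B t Bf v : grow s st B t Bf -> wf s st B ->
  (forall z, used B z -> conn s (ord0 |: nz) v z) ->
  2 * cycles s nz + 2 * #|B| = q * N + 2 ->
  (forall z, used Bf z -> conn t (ord0 |: nz) v z) /\ 2 * cycles t nz + 2 * #|Bf| = q * N + 2.
Proof.
elim=> // {s st B t Bf}.
  by move=> s e st B t Bf _ IH /wf_behead w; apply: IH.
move=> s x c st B t Bf a fa _ IH w hc hz.
have [xB cn xst] := wf_head w; have ws := wf_some w fa; have wb := wf_behead w.
have [iK ine] := wf_iota w; have c0 := col_nz cn.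
have [aB bB xa xb ba] := fresh_neqs wb xB fa.
have ms : matched s by case: w. have s0 : s ord0 = iota by case: w.
have m1 : matched (ins s a c x) by case: ws.
have fx := fresh_fixed c wb fa.
have ck : cut (ins s a c x) a c = s by apply: insK; rewrite ?s0.
have nf1 : ~~ fixedc (ins s a c x) c a by apply: nfixed_ins; rewrite ?s0.
have up u z : conn s (ord0 |: nz) u z -> conn (ins s a c x) (ord0 |: nz) u z.
  by rewrite -{1}ck; apply: conn_cut_sub; rewrite ?setU11.
apply: IH => //.
- have va : conn (ins s a c x) (ord0 |: nz) v a.
    apply: (conn_trans (y := x)); first by apply/up/hc; rewrite /used_by xB.
    by rewrite -{2}(ins_x c wb xB fa); apply: conn_step; rewrite setU1r.
  move=> z; rewrite usedU // => /or3P[/eqP->//|/eqP->|/hc/up//].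
  apply: (conn_trans va); have -> : iota a = ins s a c x ord0 a by rewrite ins0 // s0.
  by apply: conn_step; rewrite setU11.
- have := cycles_cut nz0 m1 cn nf1; rewrite ck => e.
  by rewrite cardsU1 bB -hz e mulnS mulnDr muln1 addnCA addnA.
Qed.

Lemma cycles_melons : involutive iota -> (forall z, iota z != z) -> 2 * cycles melons nz = q * N.
Proof.
move=> iK ine; rewrite /cycles big_distrr /= (eq_bigr (fun=> N)).
  rewrite sum_nat_const; congr (_ * _); have := cardsC [set (ord0 : 'I_q.+1)].
  rewrite cards1 card_ord add1n => -[e]; by rewrite -[RHS]e; apply: eq_card => c; rewrite !inE.
move=> c cn; apply: ncomp_allfixed; rewrite ?inE ?eqxx //; first exact: matched_melons.
by move=> d z _; rewrite /fixedc !ffunE.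
Qed.

End Growth.

(** * Long chains and large components in a growth *)

Section Growth.
Variables (q N : nat) (iota : {ffun 'I_N -> 'I_N}).
Hypothesis q_gt0 : 0 < q.
Implicit Types (s t : cgraph q N) (B : {set 'I_N}).
Notation nz := (nonzero_colors q).
Notation slot := ('I_N * 'I_q.+1)%type.
Implicit Types st : seq slot.
Notation grow := (grow iota).
Notation wf := (wf iota).
Notation used := (used_by iota).
Notation slots := (@slots q N).

(* The slot [e] is the origin of a chain of [j] successive nested insertions. *)
Fixpoint deep j s (e : slot) st B t Bf : Prop :=
  if j is j'.+1 then
    exists a c', [/\ ~~ used B a, c' \in nz &
      deep j' (ins s a e.2 e.1) (iota a, c') (rem (iota a, c') (slots (iota a)) ++ st)
        (iota a |: B) t Bf]
  else grow s (e :: st) B t Bf.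

Lemma wf_deep s x c st B a c' : wf s ((x, c) :: st) B -> ~~ used B a -> c' \in nz ->
  wf (ins s a c x) ((iota a, c') :: rem (iota a, c') (slots (iota a)) ++ st) (iota a |: B).
Proof.
move=> w fa cn; apply: wf_perm (wf_some w fa).
by rewrite -cat_cons perm_cat2r slots_perm.
Qed.

Lemma deep_grow j s e st B t Bf : wf s (e :: st) B -> deep j s e st B t Bf -> grow s (e :: st) B t Bf.
Proof.
elim: j s e st B => //= j IH s [x c] st B w [a [c' [fa cn d]]].
apply: (grow_some fa); have w' := wf_deep w fa cn.
apply: grow_perm (w') _ (IH _ _ _ _ w' d).
by rewrite -cat_cons perm_cat2r perm_sym slots_perm.
Qed.

Lemma deep_perm j s e st st' B t Bf : wf s (e :: st) B -> perm_eq st st' ->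
  deep j s e st B t Bf -> deep j s e st' B t Bf.
Proof.
elim: j s e st st' B => /= [|j IH] s [x c] st st' B w p.
  by apply: grow_perm w _; rewrite perm_cons.
case=> a [c' [fa cn d]]; exists a, c'; split=> //; apply: IH d; first exact: wf_deep.
by rewrite perm_cat2l.
Qed.

Lemma wf_swap s e e' st B : wf s (e :: e' :: st) B -> wf s (e' :: e :: st) B.
Proof. by apply: wf_perm; apply: (perm_mid e' [:: e] st). Qed.

Lemma perm_rem2 (e e' : slot) st : e \in st -> perm_eq (e' :: st) (e :: e' :: rem e st).
Proof.
move=> est; apply: (@perm_trans _ (e' :: e :: rem e st)); first by rewrite perm_cons perm_to_rem.
exact: (perm_mid e [:: e'] _).
Qed.

Lemma deep_none j s e e' st B t Bf : wf s (e :: e' :: st) B ->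
  deep j s e st B t Bf -> deep j s e (e' :: st) B t Bf.
Proof.
elim: j s e st B => /= [|j IH] s [x c] st B w.
  move=> g; apply: grow_perm (wf_swap w) _ (grow_none _ g).
  exact: (perm_mid (x, c) [:: e'] st).
case=> a [c' [fa cn d]]; exists a, c'; split=> //.
have w' := wf_deep w fa cn.
apply: (@deep_perm _ _ _ (e' :: rem (iota a, c') (slots (iota a)) ++ st)).
- by apply: wf_perm w'; rewrite perm_cons perm_mid.
- by rewrite perm_sym perm_mid.
- by apply: IH => //; apply: wf_perm w'; rewrite perm_cons perm_mid.
Qed.

Lemma deep_some j s e x c a st B t Bf : wf s (e :: (x, c) :: st) B -> ~~ used B a ->
  deep j (ins s a c x) e (slots (iota a) ++ st) (iota a |: B) t Bf ->
  deep j s e ((x, c) :: st) B t Bf.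
Proof.
elim: j s e st B => /= [|j IH] s [x' c'] st B w fa.
  move=> g; have ws := wf_swap w.
  apply: grow_perm (ws) _ _; first exact: (perm_mid (x', c') [:: (x, c)] st).
  apply: (grow_some fa); apply: grow_perm g; last by rewrite perm_sym perm_mid.
  by apply: wf_perm (wf_some ws fa); rewrite perm_mid.
have ws := wf_swap w; have [x'B c'n x'st] := wf_head w; have [xB cn xst] := wf_head ws.
have [iK ine] := wf_iota w.
case=> a' [d [fa' dn dp]]; move: (fa'); rewrite usedU // => /norP[aa /norP[ab ua']].
exists a', d; split=> //.
have fa2 : ~~ used (iota a' |: B) a.
  rewrite usedU // (negPf fa) orbF; apply/norP; split; first by rewrite eq_sym.
  by apply: contra ab => /eqP->; rewrite iK.
have w' := wf_deep w ua' dn.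
set r := rem _ _ in dp w' *.
have wp : wf (ins s a' c' x') ((iota a', d) :: (x, c) :: r ++ st) (iota a' |: B).
  by apply: wf_perm w'; rewrite perm_cons perm_mid.
apply: (@deep_perm _ _ _ ((x, c) :: r ++ st)) => //; first by rewrite perm_sym perm_mid.
apply: IH => //.
have ne : (x', c') != (x, c) by move: x'st; rewrite inE negb_or => /andP[].
have com : ins (ins s a' c' x') a c x = ins (ins s a c x) a' c' x'.
  apply/esym; apply: (ins_comm w) => //; by rewrite eq_sym.
rewrite com setUCA; apply: deep_perm dp; last first.
  by rewrite !catA perm_cat2r perm_catC.
have w1 : wf (ins s a c x) ((x', c') :: slots (iota a) ++ st) (iota a |: B).
  by apply: wf_perm (wf_some ws fa); rewrite perm_mid.
exact: wf_deep.
Qed.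

(* [p z] and [par z]: the colour and the top vertex of the parent cycle of the
   0-edge of [z]; [rep z]: the representative of this 0-edge. *)
Definition top (p : 'I_N -> option 'I_q.+1) (par rep : 'I_N -> 'I_N) c z :=
  if p z == Some c then par z else rep z.

(** Certificate of bounded height. The last clause makes [top] constant along each 0c-cycle. [dep]
    is the depth in the history: it grows along the successive members of a cycle although they
    share their parent, and what is required of it is the bound [h] and the strict decrease along
    [par]. *)
Definition layered s (U : 'I_N -> bool) (h : nat) (p : 'I_N -> option 'I_q.+1)
    (par rep : 'I_N -> 'I_N) (dep : 'I_N -> nat) :=
  forall z, U z -> [/\ (rep z == z) || (rep z == iota z), dep z <= h,
    [/\ rep (iota z) = rep z, p (iota z) = p z, par (iota z) = par z & dep (iota z) = dep z],
    forall c, p z = Some c -> [/\ U (par z), rep (par z) = par z & dep (par z) < dep z] &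
    forall c, c \in nz -> top p par rep c (s c z) = top p par rep c z].

(** The new 0-edge hangs from the cycle of the slot [(x, c)]. Its parent is the top of that cycle,
    which may be closer to the root than [x]. *)
Lemma layered_ins s x c st B a h p par rep dep : wf s ((x, c) :: st) B -> ~~ used B a ->
  layered s (used B) h p par rep dep -> dep x < h ->
  let old z := (z == a) || (z == iota a) in
  layered (ins s a c x) (used (iota a |: B)) h (fun z => if old z then Some c else p z)
    (fun z => if old z then top p par rep c x else par z)
    (fun z => if old z then iota a else rep z) (fun z => if old z then (dep x).+1 else dep z).
Proof.
move=> w fa L dx old; have [iK ine] := wf_iota w; have wb := wf_behead w.
have [xB cn xst] := wf_head w; have [aB bB xa xb ba] := fresh_neqs wb xB fa.
have bU : ~~ used B (iota a) by rewrite (usedC a w).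
have oldU z : used B z -> old z = false.
  by move=> zU; rewrite /old (negPf (used_neq zU fa)) (negPf (used_neq zU bU)).
have oldi z : old (iota z) = old z.
  by rewrite /old (can_eq iK) orbC; congr (_ || _); apply/eqP/eqP => [<-|->]; rewrite iK.
have xU : used B x by rewrite /used_by xB.
have [_ _ _ bip _] := w.
have sU z d : used B z -> used B (s d z) by move=> /(bip z d)[].
have [xr xd [xr' xp' xpar' xdep'] xpar xloc] := L x xU.
have topU d z : used B z -> used B (top p par rep d z) /\ rep (top p par rep d z) = top p par rep d z.
  move=> zU; have [r1 _ [r2 _ _ _] hp _] := L z zU; rewrite /top; case: eqP => [/hp[]//|_].
  case/orP: r1 => /eqP r1; rewrite r1 ?(usedC z w) //.
  by rewrite -{2}r1 r2.
have topdep : dep (top p par rep c x) <= dep x.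
  rewrite /top; case: eqP => [/xpar[_ _]/ltnW//|_].
  by case/orP: xr => /eqP->; rewrite ?xdep'.
pose p' z := if old z then Some c else p z.
pose par' z := if old z then top p par rep c x else par z.
pose rep' z := if old z then iota a else rep z.
have top' d z : used B z -> top p' par' rep' d z = top p par rep d z.
  by move=> zU; rewrite /top /p' /par' /rep' oldU.
have topa d z : old z -> top p' par' rep' d z = if d == c then top p par rep c x else iota a.
  by move=> oz; rewrite /top /p' /par' /rep' oz; case: (eqVneq d c) => [->|dc]; rewrite ?eqxx //;
     case: eqP => // -[e]; rewrite e eqxx in dc.
have olda : old a by rewrite /old eqxx. have oldb : old (iota a) by rewrite /old eqxx orbT.
move=> z; rewrite usedU // => zU'.
have {zU'} [oz|zU] : old z \/ used B z by case/or3P: zU' => [/eqP->|/eqP->|]; [left|left|right].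
  rewrite oldi oz; split=> //.
  - by move: oz; rewrite /old => /orP[]/eqP->; rewrite ?iK eqxx ?orbT.
  - move=> d _; have [tU tr] := topU c x xU; rewrite usedU // tU !orbT.
    by rewrite (oldU _ tU).
  - move=> d dn; rewrite -/p' -/par' -/rep' (topa _ z) //.
    have [->|dc] := eqVneq d c; last first.
      have e : ins s a c x d z = iota z.
        rewrite ins_other //; case: w => _ _ out _ _; apply: out.
        by move: oz; rewrite /old => /orP[]/eqP->.
      by rewrite e topa ?oldi // (negPf dc).
    move: oz; rewrite /old => /orP[]/eqP->; first by rewrite ins_a top'.
    by rewrite (ins_b _ _ _ wb) top' ?sU // xloc.
have [r1 d1 [r2 r3 r4 r5] hp hl] := L z zU.
rewrite oldi oldU //; split=> //.
  move=> d /hp[h1 h2 h3]; rewrite usedU // h1 !orbT; by rewrite (oldU _ h1).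
move=> d dn; rewrite -/p' -/par' -/rep' (top' _ z) //.
have [ez|nz'] := boolP ((d == c) && ((z == x) || (z == s c x))).
  case/andP: ez => /eqP-> /orP[]/eqP->.
    by rewrite (ins_x c wb) // topa // eqxx.
  by rewrite (ins_y c wb) // topa // eqxx xloc.
rewrite (ins_z wb); first by rewrite top' ?sU // hl.
move=> dc; move: nz'; rewrite dc /= negb_or => /andP[h1 h2]; split=> //.
  exact: used_neq zU fa.
exact: used_neq zU bU.
Qed.

(** The certificate is extended along the history until an insertion occurs at a slot of depth [h];
    the chain leading there is then traced back to the slot of [st] from which it issued. *)
Lemma grow_layered s st B t Bf : grow s st B t Bf -> wf s st B -> forall h p par rep dep,
  layered s (used B) h p par rep dep ->
  (exists p' par' rep' dep', layered t (used Bf) h p' par' rep' dep') \/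
  (exists2 e, e \in st & deep (h.+1 - dep e.1) s e (rem e st) B t Bf).
Proof.
elim=> {s st B t Bf}.
- by move=> s B _ h p par rep dep L; left; exists p, par, rep, dep.
- move=> s e0 st B t Bf _ IH w h p par rep dep L.
  have [|[e est d]] := IH (wf_behead w) h p par rep dep L; first by left.
  right; exists e; first by rewrite inE est orbT.
  have u : e0 \notin st /\ uniq st by case: w => _ _ _ _ [/andP[]].
  have ne : e0 != e by apply/eqP => e1; rewrite e1 est in u; case: u.
  rewrite /= (negPf ne); apply: deep_none d.
  exact: wf_perm (perm_rem2 _ est) w.
move=> s x c st B t Bf a fa g IH w h p par rep dep L.
have [xB cn xst] := wf_head w; have ws := wf_some w fa; have [iK ine] := wf_iota w.
have xU : used B x by rewrite /used_by xB.
have [_ dx _ _ _] := L x xU.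
have [dh|dh] := ltnP (dep x) h; last first.
  right; exists (x, c); first exact: mem_head.
  have -> : h.+1 - dep (x, c).1 = 1.
    have e : dep x = h by apply/eqP; rewrite eqn_leq dx.
    by rewrite /= e subSnn.
  rewrite /= eqxx; have [c' c'n] : exists c', c' \in nz.
    by exists (lift ord0 (Ordinal q_gt0)); rewrite inE -val_eqE.
  exists a, c'; split=> //; apply: grow_perm ws _ g.
  by rewrite -cat_cons perm_cat2r slots_perm.
have L' := layered_ins w fa L dh.
have [|[e]] := IH ws _ _ _ _ _ L'; first by left.
have st0 e1 : e1 \in st -> [/\ e1.1 != a, e1.1 != iota a & e1 != (x, c)].
  case: e1 => x1 c1 h1; have [x1B _] : x1 \in B /\ c1 \in nz.
    by case: w => _ _ _ _ [_ hst]; apply: hst; rewrite inE h1 orbT.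
  have [_ _ h3 h4 _] := fresh_neqs (wf_behead w) x1B fa; split=> //.
  by apply/eqP => e4; rewrite e4 in h1; rewrite h1 in xst.
(* A chain from a new slot of [a] is prolonged backwards by [(x, c)]; for a chain from an older slot
   the insertion of [a] is merely woven into its history. *)
rewrite mem_cat => /orP[esl|est] d; right.
  exists (x, c); first exact: mem_head.
  case: e esl d => y c'; rewrite mem_slots => /andP[/eqP-> c'n].
  rewrite /= eqxx orbT eqxx subSS => d; rewrite subSn; last exact: ltnW.
  exists a, c'; split=> //; apply: deep_perm d.
    apply: wf_perm ws; rewrite perm_to_rem // mem_cat mem_slots eqxx.
    by rewrite c'n.
  have esl : (iota a, c') \in slots (iota a) by rewrite mem_slots eqxx.
  rewrite -(perm_cons (iota a, c')) perm_sym -cat_cons.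
  apply: (@perm_trans _ (slots (iota a) ++ st)); first by rewrite perm_cat2r perm_sym perm_to_rem.
  by rewrite perm_to_rem // mem_cat esl.
exists e; first by rewrite inE est orbT.
have [e1 e2 e3] := st0 e est.
rewrite /= eq_sym (negPf e3).
apply: (deep_some _ fa).
  exact: wf_perm (perm_rem2 _ est) w.
move: d; rewrite /= (negPf e1) (negPf e2) /=; apply: deep_perm.
  by apply: wf_perm ws; rewrite perm_to_rem // mem_cat est orbT.
rewrite -(perm_cons e) perm_sym; apply: perm_trans (perm_to_rem _); last by rewrite mem_cat est orbT.
apply: (@perm_trans _ (slots (iota a) ++ e :: rem e st)); first by rewrite perm_sym perm_mid.
by rewrite perm_cat2l perm_sym perm_to_rem.
Qed.

(* [big i j]: at least [j] insertions follow slots that are reached without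
   using the colour [i]; [st1] lists the open slots of colour other than [i]. *)
Definition nslots (i : 'I_q.+1) b := [seq e <- slots b | e.2 != i].

Inductive big (i : 'I_q.+1) : nat -> cgraph q N -> seq slot -> seq slot -> {set 'I_N} ->
    cgraph q N -> {set 'I_N} -> Prop :=
| big_grow s st1 st2 B t Bf : grow s (st1 ++ st2) B t Bf -> big i 0 s st1 st2 B t Bf
| big_none j s e st1 st2 B t Bf : big i j s st1 st2 B t Bf -> big i j s (e :: st1) st2 B t Bf
| big_some j s x c st1 st2 B t Bf a : ~~ used B a ->
    big i j (ins s a c x) (nslots i (iota a) ++ st1) ((iota a, i) :: st2) (iota a |: B) t Bf ->
    big i j.+1 s ((x, c) :: st1) st2 B t Bf.

Lemma slots_nslots i b : i \in nz -> perm_eq (slots b) (rcons (nslots i b) (b, i)).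
Proof.
move=> inz; rewrite perm_sym perm_rcons; apply: uniq_perm.
- rewrite /= filter_uniq ?uniq_slots // andbT mem_filter eqxx //.
- exact: uniq_slots.
move=> [y c]; rewrite inE mem_filter mem_slots xpair_eqE /=.
case: (y == b) => /=; last by rewrite andbF.
by have [->|ci] := eqVneq c i; rewrite ?inz.
Qed.

Lemma perm_nslots i b st1 st2 : i \in nz ->
  perm_eq (slots b ++ st1 ++ st2) ((nslots i b ++ st1) ++ (b, i) :: st2).
Proof.
move=> inz; apply: (@perm_trans _ (rcons (nslots i b) (b, i) ++ st1 ++ st2)).
  by rewrite perm_cat2r slots_nslots.
by rewrite cat_rcons -catA perm_cat2l perm_sym perm_mid.
Qed.

Lemma big_growE i j s st1 st2 B t Bf : i \in nz -> wf s (st1 ++ st2) B ->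
  big i j s st1 st2 B t Bf -> grow s (st1 ++ st2) B t Bf.
Proof.
move=> inz w b; elim: b w => {j s st1 st2 B t Bf} //.
- by move=> j s e st1 st2 B t Bf _ IH w; apply: grow_none; apply: IH; apply: wf_behead w.
move=> j s x c st1 st2 B t Bf a fa _ IH w; apply: (grow_some fa).
have p := perm_nslots (iota a) st1 st2 inz.
have ws := wf_perm p (wf_some w fa).
by apply: grow_perm (ws) _ (IH ws); rewrite perm_sym.
Qed.

(** The slots of colour [i] are postponed in [st2]. If the others run out after fewer than [j]
    insertions, the vertices reached by then are closed under all colours but [i]. *)
Lemma grow_big i j s st1 st2 B t Bf : i \in nz -> wf s (st1 ++ st2) B ->
  (forall e, e \in st2 -> e.2 = i) -> grow s (st1 ++ st2) B t Bf ->
  big i j s st1 st2 B t Bf \/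
  exists U : {set 'I_N}, [/\ forall z, used B z -> z \in U, #|U| <= 2 * #|B| + 2 * j &
    forall z c, z \in U -> c != i -> t c z \in U].
Proof.
move=> inz; elim: j s st1 st2 B => [|j IHj] s st1 st2 B; first by move=> _ _ g; left; apply: big_grow.
elim: st1 => [|[x c] st1 IH] w h2 g.
  right; exists [set z | used B z]; split=> [z|//|z c].
  - by rewrite inE.
  - by rewrite (card_used w) leq_addr.
  rewrite !inE => zU ci; have [_ _ _ bip _] := w.
  have [-> //] : t c z = s c z /\ used B (s c z).
  split; last by have [] := bip z c zU.
  by apply: (grow_frozen g w) => //; apply: contra ci => /h2/= ->.
have := grow_cons g w; case: ifPn => u g'.
  have [b|r] := IH (wf_behead w) h2 g'; [left|by right].
  exact: big_none.
move: u g'; set a := t c x => u g'.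
have p := perm_nslots (iota a) st1 st2 inz; have ws := wf_perm p (wf_some w u).
have h2' e : e \in (iota a, i) :: st2 -> e.2 = i by rewrite inE => /orP[/eqP->//|/h2].
have [b|[U [U1 U2 U3]]] := IHj _ _ _ _ ws h2' (grow_perm (wf_some w u) p g'); first by left; apply: big_some b.
right; exists U; split=> // [z zU|].
  apply: U1; rewrite usedU ?zU ?orbT //; by have [] := wf_iota w.
apply: leq_trans U2 _; rewrite cardsU1 (fresh_B u) mulnDr muln1 [2 * j.+1]mulnS.
by rewrite addnCA addnA addnA.
Qed.

End Growth.

(** * Counting trees *)

Section Numbers.
Variable q : nat.

(* Number of forests with [k] nodes, each carrying [q] slots, growing from [a]
   slots; [wordnum a k] forgets the constraint that slots do not run out, and
   [labels k] counts the choices of the oriented 0-edges to insert. *)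
Fixpoint forestnum (k : nat) : nat -> nat :=
  if k is k'.+1 then
    fix f (a : nat) := if a is a'.+1 then f a' + forestnum k' (a' + q) else 0
  else fun=> 1.

Definition wordnum a k := 'C(q * k + a, k).

Definition labels k := 2 ^ k * k`!.

Lemma labelsS k : labels k.+1 = 2 * k.+1 * labels k.
Proof. by rewrite /labels expnS factS mulnACA. Qed.

Lemma wordnumS a k : wordnum a.+1 k.+1 = wordnum a k.+1 + wordnum (a + q) k.
Proof.
rewrite /wordnum addnS binS; congr (_ + _); congr 'C(_, _).
by rewrite mulnS; lia.
Qed.

Lemma wordnum0 a : wordnum a 0 = 1. Proof. by rewrite /wordnum bin0. Qed.

(** A uniform word fills its first slot with probability at most [1 / q], the critical value for
    trees with [q] slots per node. *)
Lemma wordnum_ratio a k : 0 < q -> q * wordnum (a + q) k <= wordnum a.+1 k.+1.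
Proof.
move=> q0; rewrite -(leq_pmul2l (ltn0Sn k)) /wordnum addnS.
have -> : q * k + (a + q) = q * k.+1 + a by rewrite mulnS; lia.
rewrite -mul_bin_diag mulnA leq_mul2r; apply/orP; right.
by rewrite mulnC; lia.
Qed.

(** The count of the cycle lemma, derived from the two recursions: a share [a / (q * k + a)] of the
    words are forests. For [k = n - 1] and [a = q] the share is [1 / n]. *)
Lemma forestnumE a k : 0 < q -> (q * k + a) * forestnum k a = a * wordnum a k.
Proof.
move=> q0; elim: k a => [|k IHk]; first by move=> a; rewrite wordnum0 muln0 add0n.
elim=> [|a IHa]; first by rewrite muln0 mul0n.
rewrite wordnumS /=.
have IHk' := IHk (a + q); set Y := forestnum k (a + q) in IHk' *.
move: IHa; rewrite -/(forestnum k.+1 a); set X := forestnum k.+1 a => IHa.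
have em : q * k + (a + q) = q * k.+1 + a by rewrite mulnS; lia.
rewrite em in IHk'; set m := q * k.+1 + a in IHa IHk'.
have m0 : 0 < m by rewrite /m mulnS; lia.
have km : k <= m by rewrite /m mulnS; nia.
have e1 : k.+1 * wordnum a k.+1 + k * wordnum (a + q) k = m * wordnum (a + q) k.
  by rewrite /wordnum em -/m mul_bin_left -mulnDl subnK.
set C1 := wordnum a k.+1 in IHa e1 *; set C0 := wordnum (a + q) k in IHk' e1 *.
have -> : q * k.+1 + a.+1 = m.+1 by rewrite addnS.
apply/eqP; rewrite -(eqn_pmul2l m0); apply/eqP.
have -> : m * (m.+1 * (X + Y)) = m.+1 * (m * X + m * Y) by rewrite mulnCA mulnDr.
rewrite IHa IHk'.
have e2 : q * (k.+1 * C1 + k * C0) = q * (m * C0) by rewrite e1.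
have ma : m = q * k.+1 + a by [].
clearbody m C1 C0; clear -e2 ma; rewrite ma in e2 *.
nia.
Qed.

End Numbers.

Section Counting.
Variables (q N : nat) (iota : {ffun 'I_N -> 'I_N}).
Hypothesis q_gt0 : 0 < q.
Implicit Types (s t : cgraph q N) (B : {set 'I_N}).
Notation nz := (nonzero_colors q).
Notation slot := ('I_N * 'I_q.+1)%type.
Implicit Types st : seq slot.
Notation grow := (grow iota).
Notation wf := (wf iota).
Notation used := (used_by iota).
Notation slots := (@slots q N).
Notation deep := (deep iota).
Notation big := (big iota).
Notation W := (wordnum q).

Lemma card_unused s st B k : wf s st B -> N = 2 * #|B| + 2 * k ->
  #|[set a | ~~ used B a]| = 2 * k.
Proof.
move=> w e; have := cardsC [set z | used B z]; rewrite (card_used w) card_ord.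
have -> : ~: [set z | used B z] = [set a | ~~ used B a] by apply/setP=> z; rewrite !inE.
by move=> h; apply/eqP; rewrite -(eqn_add2l (2 * #|B|)) h {1}e.
Qed.

(** Decides the fate of the first slot [(x, c)]: by [grow_cons] it is closed exactly when [t c x] is
    already reached, and otherwise [t c x] is the end inserted there. *)
Lemma card_split (S : {set cgraph q N}) c x B :
  #|S| = #|[set t in S | used B (t c x)]| + \sum_(a | ~~ used B a) #|[set t in S | t c x == a]|.
Proof.
rewrite -(cardsID [set t : cgraph q N | used B (t c x)] S); congr (_ + _).
  by apply: eq_card => t; rewrite !inE.
rewrite -sum1_card (partition_big (fun t : cgraph q N => t c x) (fun a => ~~ used B a)) /=; last first.
  by move=> t; rewrite !inE => /andP[].
apply: eq_bigr => a ua; rewrite sum1dep_card; apply: eq_card => t; rewrite !inE.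
by have [->|_] := eqVneq (t c x) a; rewrite ?ua ?andbT ?andbF.
Qed.

Lemma head_none s x c st B t Bf : wf s ((x, c) :: st) B -> grow s st B t Bf -> used B (t c x).
Proof.
move=> w g; have wb := wf_behead w; have [xB cn xst] := wf_head w.
have /andP[yB yU] := step_side c wb xB.
have -> // : t c x = s c x.
apply: (grow_frozen g) => //; first by rewrite /used_by xB.
by apply: contra yB => h; case: wb => _ _ _ _ [_ /(_ _ _ h)[]].
Qed.

Lemma head_some s x c st B t Bf a : wf s ((x, c) :: st) B -> ~~ used B a ->
  grow (ins s a c x) (slots (iota a) ++ st) (iota a |: B) t Bf -> t c x = a.
Proof.
move=> w fa g; have wb := wf_behead w; have [xB cn xst] := wf_head w.
have [aB bB xa xb ba] := fresh_neqs wb xB fa.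
have e : ins s a c x c x = a := ins_x c wb xB fa.
rewrite -[RHS]e; apply: (grow_frozen g); first exact: wf_some.
- by rewrite /used_by !inE xB orbT.
- by rewrite mem_cat mem_slots (negPf xb) /= (negPf xst).
- rewrite e mem_cat mem_slots eq_sym (negPf ba) /=; apply: contra aB => h.
  by case: wb => _ _ _ _ [_ /(_ _ _ h)[]].
Qed.

Lemma size_step B a k : ~~ used B a -> N = 2 * #|B| + 2 * k.+1 -> N = 2 * #|iota a |: B| + 2 * k.
Proof.
move=> fa; rewrite cardsU1 (fresh_B fa) mulnDr muln1 [2 * k.+1]mulnS => {1}->.
by rewrite addnCA addnA.
Qed.

(** An insertion has [2 * k] unreached vertices to choose from, which produces [labels]; the rest
    follows the recursion of [wordnum]. The bound is not sharp, since words may go on after the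
    slots have run out. *)
Lemma grow_upper k s st B (S : {set cgraph q N}) : wf s st B -> N = 2 * #|B| + 2 * k ->
  (forall t, t \in S -> exists2 Bf : {set _}, 2 * #|Bf| = N & grow s st B t Bf) ->
  #|S| <= labels k * W (size st) k.
Proof.
elim: k s st B S => [|k IHk] s st B S.
  elim: st S => [|[x c] st IH] S w eN hS.
    rewrite wordnum0 muln1 -[labels 0]/1 -(cards1 s); apply: subset_leq_card.
    by apply/subsetP=> t /hS[Bf _ g]; rewrite inE; inversion g.
  rewrite wordnum0 (card_split S c x B) big1 ?addn0; last first.
    move=> a ua; have := card_unused w eN; rewrite muln0 => /cards0_eq/setP/(_ a).
    by rewrite !inE ua.
  have := IH [set t in S | used B (t c x)] (wf_behead w) eN; rewrite wordnum0; apply.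
  move=> t; rewrite inE => /andP[/hS[Bf fB g] u]; exists Bf => //.
  by have := grow_cons g w; rewrite u.
elim: st S => [|[x c] st IH] S w eN hS.
  rewrite (_ : S = set0) ?cards0 //; apply/setP=> t; rewrite inE; apply/negP => /hS[Bf fB g].
  inversion g as [s' B' e1 e2 e3 e4 e5| |]; move: fB; rewrite -e5 => fB.
  by move/eqP: (etrans fB eN); rewrite -{1}[2 * #|B|]addn0 eqn_add2l.
rewrite (card_split S c x B) /= wordnumS mulnDr; apply: leq_add.
  apply: IH (wf_behead w) eN _ => t; rewrite inE => /andP[/hS[Bf fB g] u]; exists Bf => //.
  by have := grow_cons g w; rewrite u.
apply: (@leq_trans (\sum_(a | ~~ used B a) labels k * W (size st + q) k)).
  apply: leq_sum => a ua.
  have -> : size st + q = size (slots (iota a) ++ st) by rewrite size_cat size_slots addnC.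
  apply: IHk (wf_some w ua) (size_step ua eN) _ => t; rewrite inE => /andP[/hS[Bf fB g] /eqP e].
  by exists Bf => //; have := grow_cons g w; rewrite e (negPf ua).
rewrite sum_nat_cond_const mulnA labelsS leq_mul2r; apply/orP; right.
rewrite leq_mul2r; apply/orP; right; rewrite -(card_unused w eN).
by apply: subset_leq_card; apply/subsetP=> a; rewrite inE.
Qed.

(** The recursion is realised by disjoint sets: trees that treat the first slot differently have
    different values [t c x]. *)
Lemma grow_lower k s st B : wf s st B -> N = 2 * #|B| + 2 * k ->
  exists2 S : {set cgraph q N}, labels k * forestnum q k (size st) <= #|S| &
    forall t, t \in S -> exists2 Bf : {set _}, 2 * #|Bf| = N & grow s st B t Bf.
Proof.
elim: k s st B => [|k IHk] s st B.
  move=> w eN; exists [set s]; first by rewrite cards1.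
  move=> t; rewrite inE => /eqP->; exists B.
    by have e := eN; rewrite muln0 addn0 in e; rewrite -e.
  by rewrite -[st]cats0; apply: grow_none_cat; apply: grow_nil.
elim: st => [|[x c] st IH] w eN.
  by exists set0; [rewrite muln0|move=> t; rewrite inE].
have [S0 card0 h0] := IH (wf_behead w) eN.
have /fin_all_exists2[Sa carda ha] : forall a, exists2 Sa : {set cgraph q N},
    ~~ used B a -> labels k * forestnum q k (size st + q) <= #|Sa| &
    forall t, t \in Sa -> exists2 Bf : {set _}, 2 * #|Bf| = N & grow s ((x, c) :: st) B t Bf /\ (t c x = a).
  move=> a; have [ua|ua] := boolP (used B a); first by exists set0 => // t; rewrite inE.
  have [Sa cSa hSa] := IHk _ _ _ (wf_some w ua) (size_step ua eN).
  exists Sa; first by move=> _; rewrite size_cat size_slots addnC in cSa.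
  move=> t /hSa[Bf fB g]; exists Bf => //; split; first exact: grow_some g.
  exact: head_some g.
exists (S0 :|: [set t : cgraph q N | (~~ used B (t c x)) && (t \in Sa (t c x))]); last first.
  move=> t; rewrite inE => /orP[/h0[Bf fB g]|]; first by exists Bf => //; apply: grow_none.
  by rewrite inE => /andP[_ /ha[Bf fB [g _]]]; exists Bf.
rewrite (card_split _ c x B) mulnDr; apply: leq_add.
  apply: leq_trans card0 _; apply: subset_leq_card; apply/subsetP=> t tS.
  rewrite inE in_setU tS /=; have [Bf fB g] := h0 t tS; exact: head_none g.
apply: (@leq_trans (\sum_(a | ~~ used B a) labels k * forestnum q k (size st + q))); last first.
  apply: leq_sum => a ua; apply: leq_trans (carda a ua) _.
  apply: subset_leq_card; apply/subsetP=> t tS; have [Bf fB [g e]] := ha a t tS.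
  by rewrite inE in_setU [t \in [set _ | _]]inE e ua tS orbT eqxx.
rewrite sum_nat_cond_const mulnA labelsS leq_mul2r; apply/orP; right.
rewrite leq_mul2r; apply/orP; right; rewrite -(card_unused w eN).
by apply: subset_leq_card; apply/subsetP=> a; rewrite inE.
Qed.

(** [j] forced insertions, each with one of the [q] new slots selected for the next, followed by
    unconstrained words. The filled slot disappears, hence [a + q.-1]. *)
Fixpoint deepnum j a k :=
  if j is j'.+1 then (if k is k'.+1 then q * deepnum j' (a + q.-1) k' else 0) else W a k.

Lemma deep_upper j k s e st B (S : {set cgraph q N}) : wf s (e :: st) B -> N = 2 * #|B| + 2 * k ->
  (forall t, t \in S -> exists2 Bf : {set _}, 2 * #|Bf| = N & deep j s e st B t Bf) ->
  #|S| <= labels k * deepnum j (size st).+1 k.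
Proof.
elim: j k s e st B S => [|j IH] k s [x c] st B S w eN hS.
  exact: (grow_upper w eN hS).
have hS' t : t \in S -> exists2 a, ~~ used B a & (t c x = a) /\ exists c' (Bf : {set _}), [/\ c' \in nz, 2 * #|Bf| = N &
    deep j (ins s a c x) (iota a, c') (rem (iota a, c') (slots (iota a)) ++ st) (iota a |: B) t Bf].
  case/hS=> Bf fB [a [c' [fa c'n d]]]; exists a => //; split; last by exists c', Bf.
  have w' := wf_deep w fa c'n; have g := deep_grow w' d.
  apply: (head_some w fa (Bf := Bf)); apply: grow_perm (w') _ g.
  by rewrite -cat_cons perm_cat2r perm_sym slots_perm.
rewrite (card_split S c x B).
rewrite [X in X + _](_ : _ = 0) ?add0n; last first.
  apply/eqP; rewrite cards_eq0; apply/eqP/setP=> t; rewrite !inE; apply/negP => /andP[/hS'[a ua [-> _]]].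
  by rewrite (negPf ua).
case: k eN => [|k] eN.
  rewrite big1 // => a ua; have := card_unused w eN; rewrite muln0 => /cards0_eq/setP/(_ a).
  by rewrite !inE ua.
set D := deepnum j (size st + q) k.
have -> : deepnum j.+1 (size st).+1 k.+1 = q * D.
  by rewrite /= /D addSn -addnS prednK.
apply: (@leq_trans (\sum_(a | ~~ used B a) labels k * (q * D))); last first.
  rewrite sum_nat_cond_const mulnA labelsS leq_mul2r; apply/orP; right.
  rewrite leq_mul2r; apply/orP; right; rewrite -(card_unused w eN).
  by apply: subset_leq_card; apply/subsetP=> a; rewrite inE.
apply: leq_sum => a ua; set Sa := [set t in S | _].
(* A tree may contain several chains; one continuation is selected for each tree, and the trees are
   sorted by its colour. *)
have /fin_all_exists[f hf] : forall t, exists c', t \in Sa -> c' \in nz /\ exists2 Bf : {set _}, 2 * #|Bf| = N &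
    deep j (ins s a c x) (iota a, c') (rem (iota a, c') (slots (iota a)) ++ st) (iota a |: B) t Bf.
  move=> t; have [tS|] := boolP (t \in Sa); last by exists ord0.
  move: (tS); rewrite inE => /andP[/hS'[a' ua' [e' [c' [Bf [h1 h2 h3]]]]] /eqP e].
  by rewrite -e e' in h3 *; exists c' => _; split=> //; exists Bf.
rewrite -sum1_card (partition_big f [in nz]) /=; last by move=> t /hf[].
apply: (@leq_trans (\sum_(c' in nz) labels k * D)).
  2: by rewrite sum_nat_const card_nonzero mulnCA.
apply: leq_sum => c' c'n; rewrite sum1dep_card /D.
have -> : size st + q = (size (rem (iota a, c') (slots (iota a)) ++ st)).+1.
  have := perm_size (slots_perm (iota a) c'n); rewrite size_slots /= => e.
  by rewrite size_cat -addSn -e addnC.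
apply: IH (wf_deep w ua c'n) (size_step ua eN) _ => t; rewrite inE => /andP[tS /eqP e].
by have [_] := hf t tS; rewrite e.
Qed.

End Counting.

(** * Exponential decay of large components avoiding a colour *)

Section BigCount.
Local Open Scope ring_scope.
Variables (q N : nat) (iota : {ffun 'I_N -> 'I_N}).
Hypothesis q_gt0 : (0 < q)%N.
Implicit Types (s t : cgraph q N) (B : {set 'I_N}).
Notation nz := (nonzero_colors q).
Notation slot := ('I_N * 'I_q.+1)%type.
Implicit Types st : seq slot.
Notation grow := (grow iota).
Notation wf := (wf iota).
Notation used := (used_by iota).
Notation slots := (@slots q N).
Notation big := (big iota).
Notation W := (wordnum q).

Lemma big_cons i j s x c st1 st2 B t Bf : i \in nz -> wf s ((x, c) :: st1 ++ st2) B ->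
  big i j.+1 s ((x, c) :: st1) st2 B t Bf ->
  if used B (t c x) then big i j.+1 s st1 st2 B t Bf else
  big i j (ins s (t c x) c x) (nslots i (iota (t c x)) ++ st1) ((iota (t c x), i) :: st2)
    (iota (t c x) |: B) t Bf.
Proof.
move=> inz w b.
inversion b as [|j1 s1 e1 t1 t2 B1 u1 Bf1 b1 e2 e3 e4|j1 s1 x1 c1 t1 t2 B1 u1 Bf1 a fa b1 e2 e3 e4].
  by rewrite (head_none w (big_growE inz (wf_behead w) b1)).
have p := perm_nslots (iota a) st1 st2 inz; have ws := wf_perm p (wf_some w fa).
have -> : t c x = a.
  apply: (head_some w fa (Bf := Bf)); apply: grow_perm (ws) _ (big_growE inz ws b1).
  by rewrite perm_sym.
by rewrite (negPf fa).
Qed.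

Lemma size_nslots i b : i \in nz -> (size (@nslots q N i b)).+1 = q.
Proof. by move=> inz; have := perm_size (slots_nslots b inz); rewrite size_slots size_rcons. Qed.

Variables (R : realFieldType) (th y : R).
Hypotheses (th0 : 0 <= th) (y1 : 1 <= y) (hy : y ^+ q.-1 <= th * (1 + q%:R * (y - 1))).

(* Supersolution: [th ^+ j * y ^+ size st1] dominates the recursion because the
   fraction of words whose first slot is filled is at most [1 / q]. *)
Lemma big_upper i j k s st1 st2 B (S : {set cgraph q N}) : i \in nz -> wf s (st1 ++ st2) B ->
  N = (2 * #|B| + 2 * k)%N ->
  (forall t, t \in S -> exists2 Bf : {set _}, (2 * #|Bf|)%N = N & big i j s st1 st2 B t Bf) ->
  #|S|%:R <= th ^+ j * y ^+ size st1 * (labels k * W (size st1 + size st2) k)%N%:R.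
Proof.
move=> inz; have y0 : 0 <= y := le_trans ler01 y1.
elim: j k s st1 st2 B S => [|j IHj] k s st1 st2 B S w eN hS.
  rewrite expr0 mul1r.
  have h : (#|S| <= labels k * W (size (st1 ++ st2)) k)%N.
    apply: (grow_upper w eN) => t /hS[Bf fB b]; exists Bf => //; exact: big_growE b.
  rewrite size_cat in h; apply: (@le_trans _ _ ((labels k * W (size st1 + size st2) k)%N%:R)).
    by rewrite ler_nat.
  by rewrite ler_peMl // exprn_ege1.
elim: st1 S w hS => [|[x c] st1 IH] S w hS.
  rewrite (_ : S = set0) ?cards0; first by rewrite !mulr_ge0 ?exprn_ge0.
  by apply/setP=> t; rewrite inE; apply/negP => /hS[Bf _ b]; inversion b.
have IH1 : #|[set t in S | used B (t c x)]|%:R <=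
    th ^+ j.+1 * y ^+ size st1 * (labels k * W (size st1 + size st2) k)%N%:R.
  apply: IH (wf_behead w) _ => t; rewrite inE => /andP[/hS[Bf fB b] u]; exists Bf => //.
  by have := big_cons inz w b; rewrite u.
rewrite (card_split iota S c x B) natrD natr_sum.
set a := size st1 in IH1 *; set r := size st2 in IH1 *.
case: k eN IH IH1 => [|k] eN _ IH1.
  rewrite big1 ?addr0; last first.
    move=> b ub; have := card_unused w eN; rewrite muln0 => /cards0_eq/setP/(_ b).
    by rewrite !inE ub.
  apply: le_trans IH1 _; rewrite !wordnum0 /= -/a; apply: ler_wpM2r => //.
  by apply: ler_wpM2l; [apply: exprn_ge0|apply: ler_weXn2l].
have IH2 : \sum_(b | ~~ used B b) (#|[set t in S | t c x == b]|)%:R <=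
    th ^+ j * y ^+ (a + q.-1) * (labels k.+1 * W (a + r + q) k)%N%:R.
  have -> : (labels k.+1 * W (a + r + q) k)%N%:R = (2 * k.+1)%:R * (labels k * W (a + r + q) k)%N%:R :> R.
    by rewrite -natrM mulnA labelsS.
  rewrite mulrCA; set Z := th ^+ j * _ * _.
  have -> : (2 * k.+1)%:R * Z = \sum_(b | ~~ used B b) Z.
    rewrite sumr_const mulr_natl; congr (_ *+ _); rewrite -(card_unused w eN).
    by apply: eq_card => b; rewrite inE.
  apply: ler_sum => b ub.
  have p := perm_nslots (iota b) st1 st2 inz; have ws := wf_perm p (wf_some w ub).
  have := IHj k _ _ _ _ [set t in S | t c x == b] ws (size_step ub eN).
  have sz : (size (nslots i (iota b) ++ st1) = a + q.-1)%N.
    by rewrite size_cat -[q in RHS](size_nslots (iota b) inz) addnC.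
  rewrite sz /=.
  have -> : (a + q.-1 + (size st2).+1 = a + r + q)%N by rewrite -/r; lia.
  apply=> t; rewrite inE => /andP[/hS[Bf fB b'] /eqP e]; exists Bf => //.
  by have := big_cons inz w b'; rewrite e (negPf ub).
apply: (le_trans (lerD IH1 IH2)); rewrite /= -/a addSn.
rewrite wordnumS mulnDr natrD !(natrM _ (labels k.+1)).
set w1 : R := (W (a + r) k.+1)%:R; set w2 : R := (W (a + r + q) k)%:R.
set L : R := (labels k.+1)%:R.
have rat12 : q%:R * w2 <= w1 + w2.
  by rewrite /w1 /w2 -natrD -wordnumS -natrM ler_nat; apply: wordnum_ratio.
have w20 : 0 <= w2 by []. have L0 : 0 <= L by [].
rewrite exprD exprS [y ^+ a.+1]exprS.
(* Without the colour [i] a filled slot opens [q - 1] others, so at filling probability [1 / q] the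
   exploration is subcritical. This leaves room for a weight [y] per open slot together with a
   factor [th] per insertion; [hy] is the inequality at probability exactly [1 / q]. *)
have key : th * w1 + y ^+ q.-1 * w2 <= th * y * (w1 + w2).
  have h1 : y ^+ q.-1 * w2 <= th * (1 + q%:R * (y - 1)) * w2 by apply: ler_wpM2r.
  have h2 : 0 <= th * (y - 1) * (w1 + w2 - q%:R * w2).
    by apply: mulr_ge0; [apply: mulr_ge0; rewrite // subr_ge0|rewrite subr_ge0].
  apply: le_trans (lerD (lexx _) h1) _; move: h2; clear; set qq := q%:R; nra.
have tj : 0 <= th ^+ j * y ^+ a * L by rewrite !mulr_ge0 ?exprn_ge0.
have := ler_wpM2l tj key.
set T := th ^+ j; set Y := y ^+ a; set Z := y ^+ q.-1.
by move=> h; apply: le_trans (le_trans _ h) _; rewrite le_eqVlt; apply/orP; left; apply/eqP; ring.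
Qed.

End BigCount.

(** * Exponential decay of long chains *)

Section DeepCount.
Local Open Scope ring_scope.
Variable q : nat.
Hypothesis q_gt0 : (0 < q)%N.
Variables (R : realFieldType) (rho : R).
Hypotheses (rho0 : 0 <= rho) (rho1 : rho <= 1).

Lemma wordnum_step a k : ((q * k.+1 + a) * wordnum q (a + q.-1) k = k.+1 * wordnum q a k.+1)%N.
Proof.
rewrite /wordnum; have -> : (q * k + (a + q.-1) = (q * k.+1 + a).-1)%N by rewrite mulnS; lia.
exact: mul_bin_diag.
Qed.

(** By [wordnum_step] a forced insertion multiplies the count by [q * k / (q * k + a)], which is at
    most 1, and at most [rho] once [a] is large. Each insertion adds [q - 1] open slots: [i] of them
    accumulate slots, the other [j] gain a factor [rho] each. *)
Lemma deepnum_decay i j a k : (1 - rho) * (q * k)%:R <= rho * (a + q.-1 * i)%:R ->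
  (deepnum q (i + j) a k)%:R <= rho ^+ j * (wordnum q a k)%:R.
Proof.
elim: i a k => [|i IHi] a k.
  rewrite muln0 addn0 add0n; elim: j a k => [|j IHj] a k h; first by rewrite expr0 mul1r.
  case: k h => [|k] h; first by rewrite /= mulr_ge0 ?exprn_ge0.
  rewrite /= natrM.
  have h' : (1 - rho) * (q * k)%:R <= rho * (a + q.-1)%:R.
    have e1 : ((q * k.+1)%:R : R) = (q * k)%:R + q%:R by rewrite mulnS natrD addrC.
    rewrite e1 in h; rewrite natrD; have q0 : 0 <= q%:R :> R by [].
    have q0' : 0 <= q.-1%:R :> R by [].
    have m1 : 0 <= (1 - rho) * q%:R by apply: mulr_ge0; rewrite // subr_ge0.
    have m2 : 0 <= rho * q.-1%:R by apply: mulr_ge0.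
    move: h m1 m2; clear; nra.
  apply: le_trans (ler_wpM2l _ (IHj _ _ h')) _; first by [].
  rewrite exprS mulrCA -mulrA [rho * _]mulrCA; apply: ler_wpM2l; first exact: exprn_ge0.
  have kp : 0 < (k.+1)%:R :> R by rewrite ltr0n.
  rewrite -(ler_pM2l kp).
  have -> : (k.+1)%:R * (rho * (wordnum q a k.+1)%:R) = rho * ((q * k.+1 + a)%:R * (wordnum q (a + q.-1) k)%:R).
    by rewrite -natrM wordnum_step natrM mulrCA.
  rewrite !mulrA; apply: ler_wpM2r => //.
  move: h; rewrite natrD !natrM; set qq := q%:R; set kk := (k.+1)%:R; set aa := a%:R; clear; nra.
move=> h; case: k h => [|k] h; first by rewrite /= mulr_ge0 ?exprn_ge0.
rewrite addSn /= natrM.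
have h' : (1 - rho) * (q * k)%:R <= rho * (a + q.-1 + q.-1 * i)%:R.
  apply: le_trans (le_trans _ h) _; last by rewrite mulnS addnA.
  apply: ler_wpM2l; first by rewrite subr_ge0.
  by rewrite ler_nat leq_mul2l leqnSn orbT.
apply: le_trans (ler_wpM2l _ (IHi _ _ h')) _; first by [].
rewrite mulrCA; apply: ler_wpM2l; first exact: exprn_ge0.
rewrite -natrM ler_nat.
rewrite -(leq_pmul2l (ltn0Sn k)) -wordnum_step mulnA leq_mul2r; apply/orP; right.
by rewrite mulnC leq_addr.
Qed.

End DeepCount.

(** * From trees to graphs of higher order *)

Lemma leq_card_bigcup (I T : finType) (P : {set I}) (F : I -> {set T}) :
  #|\bigcup_(i in P) F i| <= \sum_(i in P) #|F i|.
Proof.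
apply: (big_ind2 (fun (S : {set T}) k => #|S| <= k)) => [|S k S' k' h1 h2|//].
  by rewrite cards0.
by apply: leq_trans (leq_card_setU _ _) (leq_add h1 h2).
Qed.

(** * Cuttable 0-edges and ancestors of touched vertices *)

Section Ancestors.
Variables (q N : nat) (t : cgraph q N) (h : nat) (p : 'I_N -> option 'I_q.+1).
Variables (par rep : 'I_N -> 'I_N) (dep : 'I_N -> nat).
Notation nz := (nonzero_colors q).
Notation iota := (t ord0).
Hypotheses (mt : matched t) (lay : layered iota t xpredT h p par rep dep).

Let iK : involutive iota. Proof. exact: matchedK. Qed.

(** Acts on representatives and fixes the root, so that ancestry is the reachability relation of a
    function. *)
Definition up r := if p r is Some _ then par r else r.

Lemma rep_cases z : rep z = z \/ rep z = iota z.
Proof. by have [/orP[]/eqP->] := lay (z := z) isT; [left|right]. Qed.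

Lemma dep_le z : dep z <= h. Proof. by have [] := lay (z := z) isT. Qed.

Lemma iota_inv z : [/\ rep (iota z) = rep z, p (iota z) = p z, par (iota z) = par z & dep (iota z) = dep z].
Proof. by have [] := lay (z := z) isT. Qed.

Lemma rep_inv z : [/\ rep (rep z) = rep z, p (rep z) = p z, par (rep z) = par z & dep (rep z) = dep z].
Proof.
have [i1 i2 i3 i4] := iota_inv z.
by have [e|e] := rep_cases z; rewrite {1}e [rep z]e ?i1 ?i2 ?i3 ?i4 // e.
Qed.

Lemma par_inv z c : p z = Some c -> rep (par z) = par z /\ dep (par z) < dep z.
Proof. by have [_ _ _ hp _] := lay (z := z) isT; case/hp. Qed.

Lemma top_inv c z : c \in nz -> top p par rep c (t c z) = top p par rep c z.
Proof. by move=> cn; have [_ _ _ _ ->] := lay (z := z) isT. Qed.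

Lemma same_rep z z' : rep z = rep z' -> z = z' \/ z = iota z'.
Proof.
have [e1|e1] := rep_cases z; have [e2|e2] := rep_cases z'; rewrite e1 e2 => e.
- by left.
- by right.
- by right; rewrite -e iK.
by left; apply: (can_inj iK).
Qed.

Lemma iter_up r k : iter k up r = r \/ dep (iter k up r) < dep r.
Proof.
elim: k => [|k IH]; [by left | rewrite iterS].
move: (iter k up r) IH => v IH; rewrite /up; case e: (p v) => [c|] //; have [_ d] := par_inv e.
by right; case: IH => [<- //|]; apply: ltn_trans.
Qed.

Lemma dep_anc a b : fconnect up a b -> a = b \/ dep b < dep a.
Proof. by move/iter_findex => <-; have [e|] := iter_up a (findex up a b); [left|right]. Qed.

Lemma anc_total a b c : fconnect up a b -> fconnect up a c -> fconnect up b c \/ fconnect up c b.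
Proof.
move=> /iter_findex <- /iter_findex <-.
move: (findex _ _ b) (findex _ _ c) => i j; have [ij|/ltnW ij] := leqP i j; [left|right].
  by rewrite -(subnK ij) iterD fconnect_iter.
by rewrite -(subnK ij) iterD fconnect_iter.
Qed.

Definition anc r z := fconnect up (rep z) r.

Lemma anc_par r z c : p z = Some c -> anc r (par z) -> anc r z.
Proof.
move=> e; have [e1 _] := par_inv e; have [r1 r2 r3 _] := rep_inv z.
rewrite /anc e1; apply: connect_trans; apply: connect1.
by rewrite /= /up r2 e r3.
Qed.

Lemma anc_rep r z : anc r (rep z) = anc r z.
Proof. by rewrite /anc; have [-> _ _ _] := rep_inv z. Qed.

Lemma anc_iota r z : anc r (iota z) = anc r z.
Proof. by rewrite /anc; have [-> _ _ _] := iota_inv z. Qed.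

Lemma anc_cases r z : anc r z -> rep z = r \/ exists2 c, p z = Some c & anc r (par z).
Proof.
have [r1 r2 r3 _] := rep_inv z.
rewrite /anc => /iter_findex; case: (findex _ _ _) => [|k]; first by left.
rewrite iterSr {2}/up r2 r3; case e: (p z) => [c|] <-; last first.
  left; elim: k => // k IH; rewrite iterS -IH /up r2 e //.
by right; exists c => //; have [-> _] := par_inv e; apply: fconnect_iter.
Qed.

Lemma anc_top r c z : anc r (top p par rep c z) -> anc r z.
Proof. by rewrite /top; case: eqP => [/anc_par|_]; [apply|rewrite anc_rep]. Qed.

(** [top] agrees at both ends of an edge of colour [c], so the part of the tree below [r] can be
    left only at [r] itself, through its parent cycle. *)
Lemma anc_step r c z : c \in nz -> anc r z -> anc r (t c z) \/ rep z = r /\ p z = Some c.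
Proof.
move=> cn az; have [at_|at_] := boolP (anc r (top p par rep c z)).
  by left; apply: (@anc_top _ c); rewrite top_inv.
right; move: at_; rewrite /top; case: eqP => [e|_]; last by rewrite anc_rep az.
by case: (anc_cases az) => [-> //|[c' _ ->]].
Qed.

Variables (G : cgraph q N) (D : {set 'I_N}).
Hypotheses (mG : matched G) (G0 : G ord0 = iota) (ag : forall z c, z \notin D -> G c z = t c z).

(* A nonbridge lies on the branch from the root to a touched vertex: the
   part of the tree hanging below an untouched node is separated by the cut. *)
Lemma nonbridge_anc w c : nonbridge G nz w c -> exists2 z, z \in D & anc (rep w) z.
Proof.
case/and3P=> cn nf h0; have c0 : c != ord0 by move: cn; rewrite inE.
have mc : matched (cut G w c) by apply: matched_cut.
have [z0 /andP[zD0 az0]|no] := pickP [pred z in D | anc (rep w) z]; first by exists z0.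
have nD z : anc (rep w) z -> z \notin D by move=> az; apply/negP => zD; have := no z; rewrite /= zD az.
have nD' z : anc (rep w) z -> forall d, G d z = t d z by move=> az d; apply: ag; apply: nD.
have aw : anc (rep w) w by apply: connect0.
have aw' : anc (rep w) (iota w) by rewrite anc_iota.
have [k1 k2 k3 k4 k5] := cut_neqs mG nf.
have rw z : rep z = rep w -> z = w \/ z = G ord0 w by rewrite G0; apply: same_rep.
(* If the cut is made on the parent cycle of [w], it separates everything below [w], the 0-edge of
   [w] included. *)
have [pw|pw] := eqVneq (p w) (Some c).
  have sep z : z = w \/ z = iota w -> G c z != w -> G c z != G ord0 w -> ~~ anc (rep w) (G c z).
    move=> zw n1 n2; have az : anc (rep w) z by case: zw => ->.
    have tz : top p par rep c z = par w.
      rewrite /top; have [_ i2 i3 _] := iota_inv w.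
      by case: zw => ->; rewrite ?i2 pw eqxx ?i3.
    apply/negP => ax; move: (top_inv z cn); rewrite tz -(nD' z az) /top.
    have [_ i2 _ i4] := rep_inv w; have [e1 d1] := par_inv pw.
    have no_par : ~~ anc (rep w) (par w).
      apply/negP; rewrite /anc e1 => /dep_anc[e|]; last by rewrite i4 ltnNge ltnW.
      by move: d1; rewrite e i4 ltnn.
    case: eqP => [px|_] e; last by move: ax; rewrite -anc_rep e (negPf no_par).
    by case: (anc_cases ax) => [/rw[]/eqP|[c' _]]; rewrite ?(negPf n1) ?(negPf n2) // e (negPf no_par).
  have sx : ~~ anc (rep w) (G c w) by apply: sep; [left|..].
  have sy : ~~ anc (rep w) (G c (G ord0 w)) by apply: sep => //; right; rewrite G0.
  have : G c w \in [set z | anc (rep w) z].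
    apply: conn_closed h0 => [z d|]; last by rewrite inE.
    rewrite !inE => az _; have [->|d0] := eqVneq d ord0; first by rewrite cut0 // G0 anc_iota.
    have [->|dc] := eqVneq d c.
      have [->|zw] := eqVneq z w; first by rewrite cutw G0.
      have [->|zw'] := eqVneq z (G ord0 w); first by rewrite cutw'.
      have zx : z != G c w by apply: contraNneq sx => <-.
      have zy : z != G c (G ord0 w) by apply: contraNneq sy => <-.
      rewrite cut_else // nD' //.
      case: (anc_step cn az) => // -[/rw[]/eqP]; by rewrite ?(negPf zw) ?(negPf zw').
    have dn : d \in nz by rewrite inE.
    rewrite cut_other // nD' //; case: (anc_step dn az) => // -[/rw zw].
    have -> : p z = p w by case: zw => ->; rewrite ?G0 //; case: (iota_inv w).
    by rewrite pw => -[/esym/eqP]; rewrite (negPf dc).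
  by rewrite inE (negPf sx).
(* Here the cut is made on a cycle below [w], and [S] is what hangs from this cycle through its
   0-edges other than that of [w]. *)
pose S := [set z | [exists u, [&& p u == Some c, par u == rep w & anc (rep u) z]]].
have SP z : reflect (exists u, [/\ p u = Some c, par u = rep w & anc (rep u) z]) (z \in S).
  rewrite inE; apply: (iffP existsP) => -[u]; first by case/and3P=> /eqP e1 /eqP e2 e3; exists u.
  by case=> e1 e2 e3; exists u; rewrite e1 e2 e3 !eqxx.
have Sanc z : z \in S -> anc (rep w) z.
  case/SP=> u [e1 e2 e3]; apply: connect_trans e3 _; apply: connect1.
  by have [_ r2 r3 _] := rep_inv u; rewrite /= /up r2 e1 r3 e2.
have Sw z : rep z = rep w -> z \notin S.
  move=> e; apply/negP => /SP[u [e1 e2 e3]]; have [_ d] := par_inv e1.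
  have [_ _ _ d2] := rep_inv u.
  move: e3; rewrite /anc e -e2 => /dep_anc; rewrite d2 => -[e3|]; last by rewrite ltnNge ltnW.
  by move: d; rewrite e3 d2 ltnn.
have Snew z : p z = Some c -> par z = rep w -> z \in S.
  by move=> e1 e2; apply/SP; exists z; split=> //; apply: connect0.
have tw z : z = w \/ z = iota w -> G c z != w -> G c z != G ord0 w -> G c z \in S.
  move=> zw n1 n2; have az : anc (rep w) z by case: zw => ->.
  have tz : top p par rep c z = rep w.
    rewrite /top; have [i1 i2 i3 _] := iota_inv w.
    by case: zw => ->; rewrite ?i2 (negPf pw) ?i1.
  move: (top_inv z cn); rewrite tz -(nD' z az) /top.
  case: eqP => [px|_] e; first exact: Snew.
  by case: (rw _ e) => /eqP; rewrite ?(negPf n1) ?(negPf n2).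
have sx : G c w \in S by apply: tw; [left|..].
have sy : G c (G ord0 w) \in S by apply: tw => //; right; rewrite G0.
have wS := Sw w erefl; have wS' : G ord0 w \notin S by apply: Sw; rewrite G0; case: (iota_inv w).
suff : w \in S by rewrite (negPf wS).
rewrite conn_sym // in h0; apply: conn_closed h0 => // z d zS _.
have [->|d0] := eqVneq d ord0.
  case/SP: zS => u [e1 e2 e3]; apply/SP; exists u; split=> //.
  by rewrite cut0 // G0 anc_iota.
have dn : d \in nz by rewrite inE.
have az := Sanc _ zS.
have step : t d z \in S \/ exists u, [/\ p u = Some c, par u = rep w, rep z = rep u & p z = Some d].
  case/SP: (zS) => u [e1 e2 e3]; case: (anc_step dn e3) => [h1|[h1 h2]]; last by right; exists u.
  by left; apply/SP; exists u.
have zw : z != w by apply: contraNneq wS => <-.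
have zw' : z != G ord0 w by apply: contraNneq wS' => <-.
have [dc|dc] := eqVneq d c; last first.
  rewrite cut_other // nD' //; case: step => // -[u [e1 e2 e3 e4]].
  have [_ r2 _ _] := rep_inv z; have [_ r2' _ _] := rep_inv u.
  by move: dc; rewrite -[d]/(odflt d (Some d)) -e4 -r2 e3 r2' e1 eqxx.
rewrite dc in step *; have [->|zx] := eqVneq z (G c w); first by rewrite cutx.
have [->|zy] := eqVneq z (G c (G ord0 w)); first by rewrite cuty.
rewrite cut_else // nD' //; case: step => // -[u [e1 e2 e3 e4]].
have [_ _ r3 _] := rep_inv z; have [_ _ r3' _] := rep_inv u.
have pz : par z = rep w by rewrite -r3 e3 r3'.
move: (top_inv z cn); rewrite /top e4 eqxx pz.
case: eqP => [px|_] e; first exact: Snew.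
have := rw _ e; have tz : t c (t c z) = z by rewrite matchedK.
case=> e5; rewrite e5 in tz; first by move: zx; rewrite nD' // tz eqxx.
by move: zy; rewrite nD' ?G0 // -G0 tz eqxx.
Qed.

(** The ancestors of a vertex form a chain with strictly decreasing depth, so there is at most one
    0-edge, with its two ends, for each depth from 0 to [h]. *)
Lemma card_nonbridge :
  #|[set wc : 'I_N * 'I_q.+1 | nonbridge G nz wc.1 wc.2]| <= #|D| * (2 * h.+1 * q.+1).
Proof.
pose A z := [set w | anc (rep w) z].
have cA z : #|A z| <= 2 * h.+1.
  pose f w : bool * 'I_h.+1 := (rep w == w, inord (dep w)).
  have fi : {in A z &, injective f}.
    move=> w w'; rewrite !inE => a1 a2 [eb].
    move/(congr1 val); rewrite /= !inordK ?ltnS ?dep_le // => ed.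
    have er : rep w = rep w'.
      have [_ _ _ d1] := rep_inv w; have [_ _ _ d2] := rep_inv w'.
      by case: (anc_total a1 a2) => /dep_anc[//|]; rewrite d1 d2 ed ltnn.
    have [w1|w1] := eqVneq (rep w) w; first by rewrite -w1 er; apply/eqP; rewrite -eb w1.
    case: (rep_cases w) => e1; first by rewrite e1 eqxx in w1.
    have := eb; rewrite (negPf w1) => /esym/negbT w2.
    case: (rep_cases w') => e2; first by rewrite e2 eqxx in w2.
    by apply: (can_inj iK); rewrite -e1 -e2.
  rewrite -(card_in_imset fi); apply: leq_trans (max_card _) _.
  by rewrite card_prod card_bool card_ord.
pose E := \bigcup_(z in D) [set wc : 'I_N * 'I_q.+1 | wc.1 \in A z].
apply: (@leq_trans #|E|).
  apply: subset_leq_card; apply/subsetP=> -[w c]; rewrite inE /= => /nonbridge_anc[z zD az].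
  by apply/bigcupP; exists z => //; rewrite !inE.
apply: leq_trans (leq_card_bigcup _ _) _; rewrite -sum_nat_const; apply: leq_sum => z _.
have -> : [set wc : 'I_N * 'I_q.+1 | wc.1 \in A z] = setX (A z) setT.
  by apply/setP=> wc; rewrite !inE andbT.
by rewrite cardsX cardsT card_ord leq_mul2r cA orbT.
Qed.

End Ancestors.

Section Fibres.
Variables (A B : finType) (f : A -> B) (E : {set A}) (S : {set B}) (m : nat).

Lemma card_fibres : (forall e, e \in E -> f e \in S) ->
  #|E| = \sum_(y in S) #|[set e in E | f e == y]|.
Proof.
move=> h; rewrite -sum1_card (partition_big f (mem S)) //=.
by apply: eq_bigr => y _; rewrite -sum1_card; apply: eq_bigl => e; rewrite inE.
Qed.

Lemma fibres_upper : (forall e, e \in E -> f e \in S) ->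
  (forall y, y \in S -> #|[set e in E | f e == y]| <= m) -> #|E| <= #|S| * m.
Proof. by move=> h hm; rewrite card_fibres // -sum_nat_const; apply: leq_sum. Qed.

Lemma fibres_lower : (forall y, y \in S -> m <= #|[set e in E | f e == y]|) -> #|S| * m <= #|E|.
Proof.
move=> hm; pose E' := [set e in E | f e \in S].
have sE : #|E'| <= #|E| by apply: subset_leq_card; apply/subsetP => e; rewrite inE => /andP[].
apply: leq_trans sE; rewrite -sum_nat_const.
suff -> : #|E'| = \sum_(y in S) #|[set e in E | f e == y]| by apply: leq_sum.
have h e : e \in E' -> f e \in S by rewrite inE => /andP[].
rewrite -sum1_card (partition_big f (mem S)) //=.
apply: eq_bigr => y yS; rewrite -sum1_card; apply: eq_bigl => e; rewrite !inE -andbA.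
by case: eqP => [->|]; rewrite ?yS ?andbF.
Qed.

End Fibres.

Section CutIns2.
Variables (q N : nat).
Implicit Types (s : cgraph q N) (A : {set 'I_q.+1}).
Notation nz := (nonzero_colors q).

Lemma setT_nz : ord0 |: nz = setT.
Proof. by apply/setP=> c; rewrite !inE orbN. Qed.

Lemma nonbridge_sub s A (A' : {set 'I_q.+1}) w c : A \subset A' -> nonbridge s A w c -> nonbridge s A' w c.
Proof.
move=> sA /and3P[cA nf h]; rewrite /nonbridge (subsetP sA) // nf.
by apply: conn_subset h; apply: setUS.
Qed.

Lemma nonbridge_ins s A w c x : matched s -> c != ord0 -> c \in A -> fixedc s c w -> x != w ->
  x != s ord0 w -> conn s (ord0 |: A) w x -> nonbridge (ins s w c x) A w c.
Proof.
move=> ms c0 cA fx xw xw' h; rewrite /nonbridge cA nfixed_ins // insK //.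
by rewrite insw.
Qed.

Lemma bipartite_cut s w c : matched s -> is_bipartite s -> is_bipartite (cut s w c).
Proof.
move=> ms /existsP[b /forallP hb]; apply/existsP; exists b.
have bE d z : b (s d z) = ~~ b z by have /forallP/(_ z) := hb d; case: (b _); case: (b _).
apply/forallP=> d; apply/forallP=> z; have [->{d}|dc] := eqVneq d c; last first.
  by rewrite cut_other // bE; case: (b z).
rewrite cutE; case: ifP => [/eqP->|_]; first by rewrite bE; case: (b w).
case: ifP => [/eqP->|_]; first by rewrite bE; case: (b w).
case: ifP => [/eqP->|_]; first by rewrite !bE; case: (b w).
case: ifP => [/eqP->|_]; first by rewrite !bE; case: (b w).
by rewrite bE; case: (b z).
Qed.

Lemma bipartite_ins s (b : {ffun 'I_N -> bool}) w c x :
  (forall d z, b (s d z) = ~~ b z) -> b x != b w -> is_bipartite (ins s w c x).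
Proof.
move=> bE bx; have {bx}bx : b x = ~~ b w by case: (b x) (b w) bx => [] [].
apply/existsP; exists b.
apply/forallP=> d; apply/forallP=> z; have [->{d}|dc] := eqVneq d c; last first.
  by rewrite ins_other // bE; case: (b z).
rewrite insE; case: ifP => [/eqP->|_]; first by rewrite bx; case: (b w).
case: ifP => [/eqP->|_]; first by rewrite !bE bx; case: (b w).
case: ifP => [/eqP->|_]; first by rewrite bx; case: (b w).
case: ifP => [/eqP->|_]; first by rewrite !bE bx; case: (b w).
by rewrite bE; case: (b z).
Qed.

Lemma ncomp_connected s A : 0 < N -> (forall x y, conn s A x y) -> ncomp s A = 1.
Proof.
case: N s => // N' s _ h; rewrite /ncomp.
suff -> : [set [set y | connect (adjA s A) x y] | x : 'I_N'.+1] = [set setT] by rewrite cards1.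
apply/setP=> S; rewrite inE; apply/imsetP/eqP => [[x _ ->]|->].
  by apply/setP=> y; rewrite !inE; apply: h.
by exists ord0 => //; apply/setP=> y; rewrite !inE; apply/esym/h.
Qed.

(** All new edges have their ends in the classes of [w] and [x], so the union on the right is
    closed. Component sizes are thus at most tripled by an insertion. *)
Lemma cls_ins s A w c x v : matched s -> ord0 \in A -> c \in A ->
  cls (ins s w c x) A v \subset cls s A v :|: (cls s A w :|: cls s A x).
Proof.
move=> ms A0 cA; apply/subsetP=> y; rewrite inE.
apply: conn_closed; last by rewrite inE cls_self.
set U := _ :|: _ => z d zU dA.
have st u e : e \in A -> u \in U -> s e u \in U.
  move=> eA; rewrite /U !inE => /or3P[] h; apply/or3P; [apply: Or31|apply: Or32|apply: Or33];
  by apply: conn_trans h _; apply: conn_step.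
have wU : w \in U by rewrite !inE conn_refl orbT.
have xU : x \in U by rewrite !inE conn_refl !orbT.
have [->{d dA}|dc] := eqVneq d c; last by rewrite ins_other //; apply: st.
rewrite insE; do 4?[case: ifP => _]; rewrite ?xU ?wU //; exact: st.
Qed.

End CutIns2.

(** * Comparing graphs of consecutive orders *)

Section Levels.
Variables (q n : nat) (bip : bool).
Hypotheses (q3 : 2 < q) (n_gt0 : 0 < n).
Notation N := (2 * n).
Notation nz := (nonzero_colors q).
Implicit Types (s t G : cgraph q N).

Definition Xset d : {set cgraph q N} :=
  [set s | [&& is_colored_graph s, bip ==> is_bipartite s & graph_order s == Posz d]].

Lemma XsetP s d : reflect [/\ matched s, forall x y, conn s setT x y, bip ==> is_bipartite s &
  cycles s nz + d = 1 + (q - 1) * n] (s \in Xset d).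
Proof.
have F0E : F0 s = cycles s nz by rewrite /F0 /cycles; apply: eq_bigl => c; rewrite inE.
have oE : (graph_order s == Posz d) = (cycles s nz + d == 1 + (q - 1) * n).
  rewrite /graph_order F0E; move: (1 + _) (cycles s nz) => a b; clear; lia.
rewrite inE oE; apply: (iffP and3P) => [[/andP[ms cs] b /eqP e]|[ms cs b /eqP e]]; split=> //.
  by move=> x y; have /forallP/(_ x)/forallP/(_ y) := cs.
by apply/andP; split=> //; apply/forallP=> x; apply/forallP=> y; apply: cs.
Qed.

Lemma cut_X s d w c : s \in Xset d.+1 -> nonbridge s nz w c -> cut s w c \in Xset d.
Proof.
move=> /XsetP[ms cs bs e] /and3P[cA nf h]; have c0 : c != ord0 by move: cA; rewrite inE.
apply/XsetP; split.
- exact: matched_cut.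
- move=> x y; rewrite (conn_cut_nonbridge ms c0 nf) ?inE //.
  by rewrite -setT_nz.
- by apply/implyP => hb; apply: bipartite_cut => //; apply: (implyP bs).
by rewrite (cycles_cut (nz0 q)) // addSnnS.
Qed.

Lemma ins_X s d w c x : s \in Xset d -> c \in nz -> fixedc s c w -> x != w -> x != s ord0 w ->
  bip ==> is_bipartite (ins s w c x) ->
  ins s w c x \in Xset d.+1 /\ nonbridge (ins s w c x) nz w c.
Proof.
move=> /XsetP[ms cs bs e] cA fx xw xw' hb; have c0 : c != ord0 by move: cA; rewrite inE.
have nb : nonbridge (ins s w c x) nz w c by apply: nonbridge_ins => //; rewrite setT_nz.
have mi : matched (ins s w c x) by apply: matched_ins.
have /and3P[_ nf h] := nb; split=> //; apply/XsetP; split=> //.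
- move=> u v; rewrite -(conn_cut_nonbridge mi c0 nf) ?inE //; last by rewrite -setT_nz.
  by rewrite insK.
by rewrite -e -{2}(insK ms c0 fx xw xw') (cycles_cut (nz0 q)) // addSnnS.
Qed.

Lemma ex_nonbridge s d : s \in Xset d.+1 -> exists w c, nonbridge s nz w c.
Proof.
move=> /XsetP[ms cs bs e]; apply: (nonbridge_ex (nz0 q) ms).
rewrite setT_nz ncomp_connected // ?muln_gt0 // card_nonzero.
move: (cycles s nz) e => z e; move: q3 n_gt0 e; clear; nia.
Qed.

Lemma forest_X0 s : s \in Xset 0 -> forest s nz.
Proof.
move=> /XsetP[ms cs bs e]; rewrite /forest setT_nz ncomp_connected // ?muln_gt0 // card_nonzero.
move: (cycles s nz) e => z e; move: q3 n_gt0 e; clear; nia.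
Qed.

(** In the bipartite case [x] has to lie in the class opposite to [w], which has [n] vertices,
    [s ord0 w] being one of them. *)
Lemma ins_many s d w c : s \in Xset d -> c \in nz -> fixedc s c w ->
  exists2 D : {set 'I_N}, n.-1 <= #|D| & forall x, x \in D ->
    [/\ x != w, x != s ord0 w & bip ==> is_bipartite (ins s w c x)].
Proof.
move=> /XsetP[ms cs bs e] cA fx.
have cN : #|[set: 'I_N]| = 2 * n by rewrite cardsT card_ord.
case: (boolP bip) bs => bb /= bs; last first.
  exists (setT :\ w :\ s ord0 w) => [|x]; last by rewrite !inE; case/and3P.
  have := cardsD1 w [set: 'I_N]; have := cardsD1 (s ord0 w) (setT :\ w); rewrite cN.
  move: (leq_b1 (w \in setT)) (leq_b1 (s ord0 w \in setT :\ w)).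
  move: (nat_of_bool _) (nat_of_bool _) #|_| #|_|; move: n_gt0; clear; lia.
have /existsP[b /forallP hb] := bs.
have bE k z : b (s k z) = ~~ b z by have /forallP/(_ z) := hb k; case: (b _); case: (b _).
pose D := [set x | b x != b w]; exists (D :\ s ord0 w) => [|x]; last first.
  rewrite !inE => /andP[-> bx]; split=> //; first by apply: contra bx => /eqP->.
  exact: bipartite_ins bE bx.
have cD : #|D| = n.
  have : #|~: D| = #|D|.
    rewrite -(card_imset (mem (~: D)) (can_inj (matchedK ord0 ms))); apply: eq_card => x.
    apply/imsetP/idP => [[y yD ->]|xD].
      by move: yD; rewrite !inE bE; case: (b y); case: (b w).
    exists (s ord0 x); last by rewrite matchedK.
    by move: xD; rewrite !inE bE; case: (b x); case: (b w).
  have := cardsC D; rewrite card_ord; move: #|_| #|_|; clear; lia.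
have := cardsD1 (s ord0 w) D; rewrite cD; move: (leq_b1 (s ord0 w \in D)).
move: (nat_of_bool _) #|_|; clear; lia.
Qed.

(** By [nonfixed_le] fewer than [4 * n + 4 * d] of the [2 * q * n] pairs of a vertex and a nonzero
    colour are not parallel to the 0-edge; as [q] is at least 3, more than [2 * n - 4 * d]
    remain. *)
Lemma fixed_many s d : s \in Xset d -> 4 * d <= n ->
  n <= #|[set wc : 'I_N * 'I_q.+1 | (wc.2 \in nz) && fixedc s wc.2 wc.1]|.
Proof.
move=> /XsetP[ms cs bs e] dn; have := nonfixed_le (nz0 q) ms.
have -> : #|[set wc : 'I_N * 'I_q.+1 | (wc.2 \in nz) && fixedc s wc.2 wc.1]| =
    \sum_(z : 'I_N) #|[set c in nz | fixedc s c z]|.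
  rewrite (@card_fibres _ _ fst _ setT) //; under eq_bigl do rewrite inE.
  apply: eq_bigr => z _.
  rewrite -(card_imset [set c in nz | fixedc s c z] (f := fun c => (z, c))) => [|a b []//].
  apply: eq_card => -[z' c]; rewrite !inE /=; apply/andP/imsetP => [[h /eqP<-]|[c' h [-> ->]]].
    by exists c => //; rewrite !inE.
  by move: h; rewrite !inE eqxx.
have : \sum_(z : 'I_N) #|[set c in nz | fixedc s c z]| + \sum_z nonfixed s nz z = q * (2 * n).
  have hz z : #|[set c in nz | fixedc s c z]| + nonfixed s nz z = q.
    rewrite -[RHS]card_nonzero -(cardsID [set c | fixedc s c z] nz); congr (_ + _).
      by apply: eq_card => c; rewrite !inE.
    by apply: eq_card => c; rewrite !inE andbC.
  rewrite -big_split /= (eq_bigr (fun=> q)) => [|z _]; last exact: hz.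
  by rewrite sum_nat_const card_ord mulnC.
rewrite card_nonzero; move: (\sum_z _) (\sum_z _) (cycles s nz) e => a b z e.
move: q3 n_gt0 e dn; clear; nia.
Qed.

Variables (Y0 : {set cgraph q N}) (h m : nat).
Hypotheses (sY0 : Y0 \subset Xset 0)
  (layY0 : forall t, t \in Y0 -> exists p par rep dep, layered (t ord0) t xpredT h p par rep dep)
  (clsY0 : forall t, t \in Y0 -> forall i v, i \in nz -> #|cls t (ord0 |: nz :\ i) v| <= m).

(** Graphs obtained from some tree of [Y0] by [d] insertions. One such history suffices; other cuts
    of the same graph may lead elsewhere. *)
Fixpoint Yset d : {set cgraph q N} :=
  if d is d'.+1 then
    [set G in Xset d | [exists w, exists c, nonbridge G nz w c && (cut G w c \in Yset d')]]
  else Y0.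

Lemma Y_X d : Yset d \subset Xset d.
Proof. by case: d => [|d] //=; apply/subsetP=> G; rewrite inE => /andP[]. Qed.

Lemma Y_cls d G : G \in Yset d -> forall i v, i \in nz -> #|cls G (ord0 |: nz :\ i) v| <= 3 ^ d * m.
Proof.
elim: d G => [|d IH] G /=; first by rewrite mul1n; apply: clsY0.
rewrite inE => /andP[/XsetP[mG _ _ _] /existsP[w /existsP[c /andP[/and3P[cA nf _] GY]]]] i v inz.
have c0 : c != ord0 by move: cA; rewrite inE.
have bd u := IH _ GY i u inz.
rewrite expnS -mulnA; set G' := cut G w c in GY bd *.
have mG' : matched G' by apply: matched_cut.
have [ci|ci] := eqVneq c i.
  have -> : cls G (ord0 |: nz :\ i) v = cls G' (ord0 |: nz :\ i) v.
    apply: eq_cls => d' hd'; rewrite cut_other //; apply/eqP=> e.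
    by move: hd'; rewrite e ci !inE eqxx /= orbF -ci (negPf c0).
  by apply: leq_trans (bd v) _; rewrite leq_pmull.
have cA' : c \in ord0 |: nz :\ i by rewrite !inE ci c0 orbT.
rewrite -(cutK mG c0 nf) -/G'.
apply: leq_trans (subset_leq_card (cls_ins _ _ _ mG' _ cA')) _; first by rewrite !inE eqxx.
have c1 := bd v; have c2 := bd w; have c3 := bd (G c w).
apply: leq_trans (leq_card_setU _ _) _.
have c4 := leq_trans (leq_card_setU _ _) (leq_add c2 c3).
by apply: leq_trans (leq_add c1 c4) _; rewrite !mulSn mul0n addn0.
Qed.

(** An insertion changes edges at four vertices only: the two ends of the 0-edge and those of the
    edge that receives it. *)
Lemma Y_touched d G : G \in Yset d -> exists2 t, t \in Y0 & exists2 D : {set 'I_N}, #|D| <= 4 * d &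
  G ord0 = t ord0 /\ forall z c, z \notin D -> G c z = t c z.
Proof.
elim: d G => [|d IH] G /=; first by move=> hG; exists G => //; exists set0; rewrite ?cards0.
rewrite inE => /andP[/XsetP[mG _ _ _] /existsP[w /existsP[c /andP[/and3P[cA nf _] GY]]]].
have c0 : c != ord0 by move: cA; rewrite inE.
have [t tY [D cD [e0 ag]]] := IH _ GY; exists t => //.
exists ([set w; G ord0 w] :|: [set G c w; G c (G ord0 w)] :|: D).
  apply: leq_trans (leq_card_setU _ _) _; rewrite mulnS; apply: leq_add => //.
  apply: leq_trans (leq_card_setU _ _) _; rewrite !cards2.
  by case: (_ != _); case: (_ != _).
split=> [|z d']; first by rewrite -e0 cut0.
rewrite !inE !negb_or => /andP[/andP[/andP[z1 z2] /andP[z3 z4]] zD].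
rewrite -ag //; have [->|dc] := eqVneq d' c; last by rewrite cut_other.
by rewrite cut_else.
Qed.

Lemma Y_nonbridge d G : G \in Yset d ->
  #|[set wc : 'I_N * 'I_q.+1 | nonbridge G nz wc.1 wc.2]| <= 4 * d * (2 * h.+1 * q.+1).
Proof.
move=> GY; have [t tY [D cD [e0 ag]]] := Y_touched GY.
have /XsetP[mG _ _ _] := subsetP (Y_X _) _ GY.
have /XsetP[mt _ _ _] := subsetP sY0 _ tY.
have [p [par [rep [dep lay]]]] := layY0 tY.
apply: leq_trans (card_nonbridge mt lay mG e0 ag) _.
by rewrite leq_mul2r cD orbT.
Qed.

(** Double counting of the pairs of a graph in [Yset d.+1] and one of its nonbridges: [fixed_many]
    and [ins_many] bound them from below through insertions, [Y_nonbridge] from above. *)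
Lemma Y_growth d : 4 * d <= n ->
  #|Yset d| * (n * n.-1) <= #|Yset d.+1| * (4 * d.+1 * (2 * h.+1 * q.+1)).
Proof.
move=> dn.
pose T := (cgraph q N * ('I_N * 'I_q.+1))%type.
pose E := [set e : T | (e.1 \in Yset d.+1) && (nonbridge e.1 nz e.2.1 e.2.2)].
pose F := [set e : T | (e.1 \in Yset d) && ((e.2.2 \in nz) && fixedc e.1 e.2.2 e.2.1)].
have fst_card (P : cgraph q N -> pred ('I_N * 'I_q.+1)) (Z : {set cgraph q N}) G : G \in Z ->
    #|[set e in [set e : T | (e.1 \in Z) && P e.1 e.2] | e.1 == G]| = #|[set wc | P G wc]|.
  move=> GZ; rewrite -[RHS](card_imset _ (f := fun wc => (G, wc))) => [|a b []//].
  apply: eq_card => -[G' wc]; rewrite !inE /=; apply/andP/imsetP => [[/andP[h1 h2] /eqP <-]|[wc' h1 [-> ->]]].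
    by exists wc; rewrite ?inE.
  by move: h1; rewrite inE GZ eqxx.
have cE : #|E| <= #|Yset d.+1| * (4 * d.+1 * (2 * h.+1 * q.+1)).
  apply: (@fibres_upper _ _ fst) => [e|G GY]; first by rewrite inE => /andP[].
  rewrite (fst_card (fun G wc => nonbridge G nz wc.1 wc.2)) //; exact: Y_nonbridge.
have cF : #|Yset d| * n <= #|F|.
  apply: (@fibres_lower _ _ fst) => G GY.
  rewrite (fst_card (fun G wc => (wc.2 \in nz) && fixedc G wc.2 wc.1)) //.
  by apply: fixed_many dn; apply: (subsetP (Y_X _)) GY.
apply: leq_trans cE; rewrite mulnA.
apply: (@leq_trans (#|F| * n.-1)); first by rewrite leq_mul2r cF orbT.
apply: (@fibres_lower _ _ (fun e : T => (cut e.1 e.2.1 e.2.2, e.2))) => -[G [w c]].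
rewrite inE /= => /andP[GY /andP[cn fx]].
have GX := subsetP (Y_X _) _ GY; have /XsetP[mG _ _ _] := GX.
have c0 : c != ord0 by move: cn; rewrite inE.
have [D cD hD] := ins_many GX cn fx; apply: leq_trans cD _.
have fi : {in D &, injective (fun x => (ins G w c x, (w, c)) : T)}.
  by move=> x x' _ _ [/(congr1 (fun s => s c w))]; rewrite !insw.
rewrite -(card_in_imset fi); apply: subset_leq_card; apply/subsetP=> _ /imsetP[x xD ->].
have [xw xw' hb] := hD x xD; have [iX nb] := ins_X GX cn fx xw xw' hb.
have iY : ins G w c x \in Yset d.+1.
  by rewrite inE iX; apply/existsP; exists w; apply/existsP; exists c; rewrite nb insK.
rewrite in_set; apply/andP; split; last by rewrite /= insK.
by rewrite in_set; apply/andP; split; [apply: iY|apply: nb].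
Qed.

(** By definition of [Yset] every cut of such a graph stays outside, and a graph is recovered from a
    cut by the three parameters of the insertion. *)
Lemma XY_growth d : #|Xset d.+1 :\: Yset d.+1| <= #|Xset d :\: Yset d| * (N * q.+1 * N).
Proof.
pose T := (cgraph q N * ('I_N * 'I_q.+1 * 'I_N))%type.
have -> : #|Xset d :\: Yset d| * (N * q.+1 * N) =
    #|setX (Xset d :\: Yset d) [set: 'I_N * 'I_q.+1 * 'I_N]|.
  by rewrite cardsX cardsT !card_prod !card_ord.
apply: leq_trans (leq_imset_card (fun e : T => ins e.1 e.2.1.1 e.2.1.2 e.2.2) _).
apply: subset_leq_card; apply/subsetP=> G; rewrite inE => /andP[nY GX].
have [w [c nb]] := ex_nonbridge GX; have /and3P[cn nf _] := nb.
have /XsetP[mG _ _ _] := GX; have c0 : c != ord0 by move: cn; rewrite inE.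
apply/imsetP; exists (cut G w c, (w, c, G c w)); last by rewrite /= cutK.
rewrite in_setX /= in_setD in_setT (cut_X GX nb) !andbT; apply: contra nY => Yc.
by rewrite inE GX; apply/existsP; exists w; apply/existsP; exists c; rewrite nb.
Qed.

(** Failure of a forest condition of [good_forest], in the form that [nonbridge_ex] supplies. *)
Definition badset d := [set G in Xset d | [exists i in nz, exists w, exists c, nonbridge G (nz :\ i) w c]].

(** After cutting a nonbridge that survives without the colour [i], the insertion point lies in the
    component of [w] avoiding [i]. Over [Yset d] such components are small; elsewhere all insertion
    points are counted. *)
Lemma card_bad d : #|badset d.+1| <= #|Yset d| * (N * q.+1 ^ 2 * (3 ^ d * m)) +
  #|Xset d :\: Yset d| * (N * q.+1 * N).
Proof.
pose T := (cgraph q N * ('I_N * 'I_q.+1 * 'I_N))%type.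
pose F (e : T) := ins e.1 e.2.1.1 e.2.1.2 e.2.2.
pose U := (cgraph q N * ('I_N * 'I_q.+1 * 'I_q.+1))%type.
pose E1 := [set eu : U * 'I_N | [&& eu.1.1 \in Yset d, eu.1.2.2 \in nz &
  eu.2 \in cls eu.1.1 (ord0 |: nz :\ eu.1.2.2) eu.1.2.1.1]].
pose F1 (eu : U * 'I_N) := F (eu.1.1, (eu.1.2.1, eu.2)).
pose E2 := setX (Xset d :\: Yset d) [set: 'I_N * 'I_q.+1 * 'I_N].
have c2 : #|F @: E2| <= #|Xset d :\: Yset d| * (N * q.+1 * N).
  by apply: leq_trans (leq_imset_card _ _) _; rewrite cardsX cardsT !card_prod !card_ord.
have c1 : #|F1 @: E1| <= #|Yset d| * (N * q.+1 ^ 2 * (3 ^ d * m)).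
  apply: leq_trans (leq_imset_card _ _) _.
  pose Z := setX (Yset d) [set u : 'I_N * 'I_q.+1 * 'I_q.+1 | u.2 \in nz].
  have cZ : #|Z| <= #|Yset d| * (N * q.+1 ^ 2).
    rewrite cardsX leq_mul2l; apply/orP; right; apply: leq_trans (max_card _) _.
    by rewrite !card_prod !card_ord -mulnA.
  rewrite mulnA; apply: (@leq_trans (#|Z| * (3 ^ d * m))); last by rewrite leq_mul2r cZ orbT.
  apply: (@fibres_upper _ _ fst) => [eu|[G [[w c] i]]]; first by rewrite !inE => /and3P[-> ->].
  rewrite !inE /= => /andP[GY inz]; apply: leq_trans (Y_cls GY w (i := i) _); last by rewrite inE.
  apply: leq_trans (subset_leq_card _) (leq_imset_card (fun x => ((G, (w, c, i)), x)) _).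
  apply/subsetP=> -[u x]; rewrite inE /= => /andP[hE /eqP eu]; apply/imsetP.
  by move: hE; rewrite eu !inE /= => /and3P[_ _ hx]; exists x; rewrite ?inE.
apply: leq_trans (leq_add c1 c2); apply: leq_trans (leq_card_setU _ _).
apply: subset_leq_card; apply/subsetP=> G; rewrite inE.
case/andP=> GX /existsP[i /andP[inz /existsP[w /existsP[c nbi]]]].
have nb : nonbridge G nz w c by apply: nonbridge_sub nbi; apply: subsetDl.
have /and3P[_ nf hx] := nbi; have /and3P[cn _ _] := nb.
have /XsetP[mG _ _ _] := GX; have c0 : c != ord0 by move: cn; rewrite inE.
have cX := cut_X GX nb; rewrite inE.
have [Yc|nYc] := boolP (cut G w c \in Yset d); apply/orP; [left|right].
  apply/imsetP; exists ((cut G w c, (w, c, i)), G c w); last by rewrite /F1 /F /= cutK.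
  by rewrite !inE /= Yc hx; move: inz; rewrite inE => ->.
apply/imsetP; exists (cut G w c, (w, c, G c w)); last by rewrite /F /= cutK.
by rewrite in_setX /= in_setD nYc cX in_setT.
Qed.

Lemma good_notbad d G : G \in Xset d.+1 -> G \notin badset d.+1 ->
  is_SYK G /\ pl_manifold q.-1 (bary_T0 G).
Proof.
move=> GX; rewrite inE GX /= => nb; have /XsetP[mG cG _ _] := GX.
apply: good_forest => // [i i0|]; last first.
  by apply/forallP=> x; apply/forallP=> y; apply: cG.
rewrite /forest leqNgt; apply: contra nb => /nonbridge_ex[||w [c hb]] //.
  by rewrite !inE eqxx andbF.
apply/existsP; exists i; rewrite inE i0 /=.
by apply/existsP; exists w; apply/existsP; exists c.
Qed.

End Levels.

Lemma card_bigcup_bound (R : realFieldType) (I T : finType) (P : {set I}) (F : I -> {set T}) (a : R) :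
  (forall i, i \in P -> (#|F i|%:R <= a)%R) -> (#|\bigcup_(i in P) F i|%:R <= #|P|%:R * a)%R.
Proof.
move=> h; apply: (@le_trans _ _ (\sum_(i in P) #|F i|)%:R%R).
  by rewrite ler_nat leq_card_bigcup.
rewrite natr_sum; apply: (le_trans (ler_sum _ h)).
by rewrite sumr_const mulr_natl.
Qed.

(** * The share of exceptional trees *)

Section Trees.
Variables (q n : nat) (bip : bool).
Hypotheses (q3 : 2 < q) (n_gt0 : 0 < n).
Notation N := (2 * n).
Notation nz := (nonzero_colors q).
Implicit Types (s t G : cgraph q N).
Notation X0 := (@Xset q n bip 0).
Notation F := (forestnum q n.-1 q).
Notation W := (wordnum q q n.-1).
Notation L := (labels n.-1).

Let q0 : 0 < q. Proof. exact: leq_trans q3. Qed.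

Lemma N_root (v : 'I_N) : N = 2 * #|[set v]| + 2 * n.-1.
Proof. by rewrite cards1 -mulnDr add1n prednK. Qed.

Lemma tree_grow t v : t \in X0 -> exists2 Bf : {set _}, 2 * #|Bf| = N &
  grow (t ord0) (melons q (t ord0)) (slots q v) [set v] t Bf.
Proof.
move=> tX; have /XsetP[mt ct _ _] := tX.
have [|Bf g u] := grow_root (v := v) mt erefl (forest_X0 q3 n_gt0 tX).
  by move=> z _; rewrite setT_nz.
exists Bf => //; have iK := matchedK ord0 mt; have ine z := matched_neq ord0 z mt.
apply: full_used (grow_wf g (wf_melons q iK ine v)) _ => z.
by rewrite u setT_nz.
Qed.

Lemma tree_deep h v t : t \in X0 ->
  (exists p par rep dep, layered (t ord0) t xpredT h p par rep dep) \/
  (exists2 c, c \in nz & exists2 Bf : {set _}, 2 * #|Bf| = N &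
    deep (t ord0) h.+1 (melons q (t ord0)) (v, c) (rem (v, c) (slots q v)) [set v] t Bf).
Proof.
move=> tX; have [Bf cB g] := tree_grow v tX; have /XsetP[mt _ _ _] := tX.
have iK := matchedK ord0 mt; have ine z := matched_neq ord0 z mt.
have w := wf_melons q iK ine v.
have lay : layered (t ord0) (melons q (t ord0)) (used_by (t ord0) [set v]) h (fun=> None)
    (fun=> v) (fun=> v) (fun=> 0).
  move=> z; rewrite /used_by !inE => uz; split=> //; first by rewrite ![v == _]eq_sym.
case: (grow_layered q0 g w lay) => [[p [par [rep [dep l]]]]|[[x c] est d]]; [left|right].
  exists p, par, rep, dep => z _.
  have al z' := used_full (grow_wf g w) cB z'.
  have [l1 l2 l3 l4 l5] := l z (al z); split=> // c /l4[]//.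
move: est; rewrite mem_slots => /andP[/eqP ex cn]; subst x.
by exists c => //; exists Bf.
Qed.

(** The component is explored from a vertex of its own: the tree is grown anew with [v] as the
    root. *)
Lemma tree_big j t v i : t \in X0 -> i \in nz -> 2 + 2 * j < #|cls t (ord0 |: nz :\ i) v| ->
  exists2 Bf : {set _}, 2 * #|Bf| = N &
    big (t ord0) i j (melons q (t ord0)) (nslots i v) [:: (v, i)] [set v] t Bf.
Proof.
move=> tX inz; have [Bf cB g] := tree_grow v tX; have /XsetP[mt _ _ _] := tX.
have iK := matchedK ord0 mt; have ine z := matched_neq ord0 z mt.
have w := wf_melons q iK ine v; have p := slots_nslots v inz; rewrite -cats1 in p.
have w' := wf_perm p w; have g' := grow_perm w p g.
have h2 e : e \in [:: (v, i)] -> e.2 = i by rewrite inE => /eqP->.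
case: (grow_big j inz w' h2 g') => [b|[U [U1 U2 U3]]]; first by exists Bf.
rewrite cards1 in U2; rewrite ltnNge => /negP[]; apply: leq_trans U2.
apply: subset_leq_card; apply/subsetP=> z; rewrite inE.
apply: conn_closed; last by apply: U1; rewrite /used_by !inE eqxx.
move=> u c uU cA; apply: U3 => //; apply: contraTneq cA => ->.
by rewrite !inE eqxx /= orbF; move: inz; rewrite inE.
Qed.

(** All trees grown from one vertex are bipartite, with [Bf] as one class, so the bound holds for
    both values of [bip]. *)
Lemma trees_many (iota : {ffun 'I_N -> 'I_N}) : involutive iota -> (forall z, iota z != z) ->
  L * F <= #|[set t in X0 | t ord0 == iota]|.
Proof.
move=> iK ine; have vN : 0 < N by rewrite muln_gt0.
pose v := Ordinal vN; have w := wf_melons q iK ine v.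
have [S cS hS] := grow_lower w (N_root v); rewrite size_slots in cS.
apply: leq_trans cS _; apply: subset_leq_card; apply/subsetP=> t /hS[Bf cB g].
have wt := grow_wf g w; have [mt t0 _ bt _] := wt; have al := used_full wt cB.
rewrite inE t0 eqxx andbT.
have [c1 c2] : (forall z, used_by iota Bf z -> conn t (ord0 |: nz) v z) /\
    2 * cycles t nz + 2 * #|Bf| = q * N + 2.
  apply: grow_tree g w _ _ => [z|]; last by rewrite cycles_melons // cards1.
  rewrite /used_by !inE => /orP[/eqP->|/eqP<-]; first exact: conn_refl.
  rewrite conn_sym ?matched_melons //; apply: (@conn_trans _ _ _ _ _ (melons q iota ord0 z)).
    by apply: conn_step; rewrite !inE.
  by rewrite ffunE; apply: conn_refl.
apply/XsetP; split=> //.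
- move=> x y; rewrite -setT_nz; apply: (@conn_trans _ _ _ _ _ v); last exact: c1.
  by rewrite conn_sym //; apply: c1.
- apply/implyP=> _; apply/existsP; exists [ffun z => z \in Bf].
  apply/forallP=> c; apply/forallP=> z; rewrite !ffunE.
  by have [_ ->] := bt z c (al z); case: (z \in Bf).
rewrite cB in c2; move: (cycles t nz) c2 q0; clear; nia.
Qed.

Lemma words_forests : W = n * F.
Proof.
have := forestnumE q n.-1 q0; rewrite -mulnSr prednK // => e.
by apply/eqP; rewrite -(eqn_pmul2l q0) mulnA e.
Qed.

Local Open Scope ring_scope.
Variables (R : realFieldType) (h j I J : nat) (rho th y : R).
Hypotheses (hIJ : (h.+1 = I + J)%N) (rho0 : 0 <= rho) (rho1 : rho <= 1)
  (hrho : (1 - rho) * (q * n.-1)%:R <= rho * (q + q.-1 * I)%:R)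
  (th0 : 0 <= th) (y1 : 1 <= y) (hy : y ^+ q.-1 <= th * (1 + q%:R * (y - 1))).

Lemma nice_trees : exists Y0 : {set cgraph q N}, [/\ Y0 \subset X0,
  forall t, t \in Y0 -> exists p par rep dep, layered (t ord0) t xpredT h p par rep dep,
  forall t, t \in Y0 -> forall i v, i \in nz -> (#|cls t (ord0 |: nz :\ i) v| <= 2 + 2 * j)%N &
  #|X0 :\: Y0|%:R <= (q%:R * rho ^+ J + (N * q)%:R * (th ^+ j * y ^+ q.-1)) * n%:R * #|X0|%:R].
Proof.
have vN : (0 < N)%N by rewrite muln_gt0.
pose v := Ordinal vN.
(* The certificate is a [Prop] about functions into [nat]; choosing one alternative of [tree_deep]
   for each tree turns it into a boolean condition. *)
pose P t (o : option 'I_q.+1) := t \in X0 ->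
  if o is Some c then c \in nz /\ exists2 Bf : {set _}, (2 * #|Bf|)%N = N &
    deep (t ord0) h.+1 (melons q (t ord0)) (v, c) (rem (v, c) (slots q v)) [set v] t Bf
  else exists p par rep dep, layered (t ord0) t xpredT h p par rep dep.
have /fin_all_exists[f hf] : forall t, exists o, P t o.
  move=> t; have [tX|tX] := boolP (t \in X0); last by exists None; rewrite /P (negPf tX).
  by case: (tree_deep h v tX) => [l|[c cn d]]; [exists None|exists (Some c)].
pose small t := [forall u, forall i, (i \in nz) ==> (#|cls t (ord0 |: nz :\ i) u| <= 2 + 2 * j)%N].
exists [set t in X0 | (f t == None) && small t]; split.
- by apply/subsetP=> t; rewrite inE => /andP[].
- move=> t; rewrite inE => /and3P[tX /eqP e _]; have := hf t tX; by rewrite e.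
- move=> t; rewrite inE => /and3P[_ _ /forallP sm] i u inz.
  by have /forallP/(_ i)/implyP := sm u; apply.
set Y0 := [set _ in _ | _].
pose Xi i := [set t in X0 | t ord0 == i].
(* Growth takes place over a fixed involution of colour 0, so the comparison is made for each
   involution separately. *)
suff key i : #|[set t in X0 :\: Y0 | t ord0 == i]|%:R <=
    (q%:R * rho ^+ J + (N * q)%:R * (th ^+ j * y ^+ q.-1)) * n%:R * #|Xi i|%:R.
  rewrite (@card_fibres _ _ (fun t => t ord0) _ setT) // [X in _ <= _ * X%:R](@card_fibres _ _ (fun t => t ord0) _ setT) //.
  by rewrite !natr_sum mulr_sumr; apply: ler_sum => i _; apply: key.
have [e0|[t1 t1X]] := set_0Vmem (Xi i).
  rewrite (_ : [set t in X0 :\: Y0 | t ord0 == i] = set0) ?e0 ?cards0 ?mulr0 //.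
  apply/setP=> t; rewrite [RHS]inE; apply/negP; rewrite inE in_setD => /andP[/andP[_ tX] ti].
  by have : t \in Xi i; [rewrite inE tX|rewrite e0 inE].
have [iK ine] : involutive i /\ forall z, i z != z.
  move: t1X; rewrite inE => /andP[/XsetP[m1 _ _ _] /eqP<-].
  by split=> [|z]; [apply: matchedK|apply: matched_neq].
have w u := wf_melons q iK ine u.
(* The passage from words back to trees costs the factor [n] of the final bound. *)
have LW : (L * W)%:R <= n%:R * #|Xi i|%:R :> R.
  by rewrite -natrM ler_nat words_forests mulnCA leq_mul2l trees_many ?orbT.
pose A c := [set t in Xi i | f t == Some c].
pose B (vi : 'I_N * 'I_q.+1) := [set t in Xi i | (2 + 2 * j < #|cls t (ord0 |: nz :\ vi.2) vi.1|)%N].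
have cA c : c \in nz -> #|A c|%:R <= rho ^+ J * (n%:R * #|Xi i|%:R).
  move=> cn; have w1 : wf i (melons q i) ((v, c) :: rem (v, c) (slots q v)) [set v].
    by apply: wf_perm (w v); rewrite perm_to_rem // mem_slots eqxx.
  have sz : (size (rem (v, c) (slots q v))).+1 = q.
    by rewrite size_rem ?mem_slots ?eqxx // size_slots prednK.
  have up : (#|A c| <= L * deepnum q h.+1 q n.-1)%N.
    have := @deep_upper q N i q0 h.+1 _ _ _ _ _ (A c) w1 (N_root v); rewrite sz; apply=> t.
    rewrite inE => /andP[tXi /eqP e].
    move: tXi; rewrite inE => /andP[tX /eqP ti]; have := hf t tX; rewrite e ti => -[] //.
  apply: (@le_trans _ _ (L * deepnum q h.+1 q n.-1)%:R); first by rewrite ler_nat.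
  rewrite natrM hIJ; apply: (@le_trans _ _ (L%:R * (rho ^+ J * W%:R))).
    by apply: ler_wpM2l => //; apply: deepnum_decay.
  by rewrite mulrCA; apply: ler_wpM2l; [apply: exprn_ge0|rewrite -(natrM _ L)].
have cB vi : vi.2 \in nz -> #|B vi|%:R <= th ^+ j * y ^+ q.-1 * (n%:R * #|Xi i|%:R).
  case: vi => u c /= cn; have p := slots_nslots u cn; rewrite -cats1 in p.
  have sz := size_nslots u cn.
  have sz1 : size (@nslots q N c u) = q.-1 by rewrite -[in RHS]sz.
  have sz2 : (size (@nslots q N c u) + size [:: (u, c)])%N = q by rewrite addn1.
  have := @big_upper q N i q0 R th y th0 y1 hy c j n.-1 (melons q i) (nslots c u) [:: (u, c)] [set u]
    (B (u, c)) cn (wf_perm p (w u)) (N_root u).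
  rewrite sz2 sz1 => up; apply: (le_trans (up _)) => [t|].
    rewrite inE => /andP[]; rewrite inE => /andP[tX /eqP <-]; exact: tree_big.
  by apply: ler_wpM2l => //; rewrite mulr_ge0 // exprn_ge0 // (le_trans _ y1).
pose nz2 := [set vi : 'I_N * 'I_q.+1 | vi.2 \in nz].
have c2 : #|nz2| = (N * q)%N.
  have -> : nz2 = setX setT nz by apply/setP=> vi; rewrite !inE.
  by rewrite cardsX cardsT card_ord card_nonzero.
apply: (@le_trans _ _ (#|\bigcup_(c in nz) A c| + #|\bigcup_(vi in nz2) B vi|)%:R).
  rewrite ler_nat; apply: leq_trans (leq_card_setU _ _); apply: subset_leq_card.
  apply/subsetP=> t; rewrite inE in_setD => /andP[/andP[nY tX] ti].
  have tXi : t \in Xi i by rewrite inE tX.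
  rewrite inE; apply/orP; move: nY; rewrite inE tX /=; case ft: (f t) => [c|] /=.
    move=> _; left; have := hf t tX; rewrite ft => -[cn _].
    by apply/bigcupP; exists c; rewrite // inE tXi ft eqxx.
  case/forallPn => u /forallPn[c]; rewrite negb_imply -ltnNge => /andP[cn big_c]; right.
  by apply/bigcupP; exists (u, c); rewrite inE // tXi.
rewrite natrD -mulrA mulrDl; apply: lerD.
  apply: (le_trans (card_bigcup_bound cA)); by rewrite card_nonzero mulrA.
apply: (le_trans (card_bigcup_bound (a := th ^+ j * y ^+ q.-1 * (n%:R * #|Xi i|%:R)) _)) => [vi|].
  by rewrite inE; apply: cB.
by rewrite c2 !mulrA.
Qed.

End Trees.

(** * Asymptotics *)
Local Open Scope ring_scope.

Section Estimates.
Variable R : archiRealFieldType.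

(** A form of Bernoulli's inequality free of division: the left side decreases in [k], consecutive
    terms differing by a nonnegative multiple of [(1 - s) ^+ 2]. *)
Lemma bernoulli_inv (s : R) k : 0 <= s -> s ^+ k * (1 + k%:R * (1 - s)) <= 1.
Proof.
move=> s0; elim: k => [|k IH]; first by rewrite expr0 mul0r addr0 mulr1.
apply: le_trans IH; rewrite exprSr -mulrA; apply: ler_wpM2l; first exact: exprn_ge0.
rewrite -natr1 -subr_ge0; set K := k%:R.
have -> : 1 + K * (1 - s) - s * (1 + (K + 1) * (1 - s)) = (K + 1) * (1 - s) ^+ 2 by ring.
by rewrite mulr_ge0 ?sqr_ge0 // natr1.
Qed.

Lemma poly_geom_bounded (E : nat) (s : R) : 0 <= s -> s < 1 ->
  exists2 B : R, 0 <= B & forall k, k%:R ^+ E * s ^+ k <= B.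
Proof.
elim: E s => [|E IH] s s0 s1.
  by exists 1 => // k; rewrite expr0 mul1r exprn_ile1 // ltW.
(* The square of the mean [r] of 1 and [s] is at least [s]; of the two factors [r ^+ k] one controls
   the power [E], the other the additional [k]. *)
pose r := (1 + s) / 2%:R.
have r0 : 0 <= r by rewrite /r; lra.
have r1 : r < 1 by rewrite /r; lra.
have sr : s <= r ^+ 2.
  rewrite -subr_ge0 (_ : _ - s = ((1 - s) / 2%:R) ^+ 2) ?sqr_ge0 // /r; by field.
have [B B0 hB] := IH r r0 r1; exists (B / (1 - r)).
  by rewrite divr_ge0 // subr_ge0 ltW.
move=> k; have lin : k%:R * r ^+ k <= (1 - r)^-1.
  have d0 : 0 < 1 - r by rewrite subr_gt0.
  rewrite -[X in _ <= X]mul1r ler_pdivlMr //; apply: le_trans (bernoulli_inv k r0).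
  rewrite [X in X <= _](_ : _ = r ^+ k * (k%:R * (1 - r))); last by ring.
  by apply: ler_wpM2l; [apply: exprn_ge0|rewrite lerDr ler01].
apply: (@le_trans _ _ ((k%:R ^+ E * r ^+ k) * (k%:R * r ^+ k))).
  have -> : (k%:R ^+ E * r ^+ k) * (k%:R * r ^+ k) = k%:R ^+ E.+1 * (r ^+ 2) ^+ k.
    by rewrite -exprM mulnC exprM exprSr; ring.
  by apply: ler_wpM2l; [apply: exprn_ge0|apply: lerXn2r; rewrite ?nnegrE ?exprn_ge0].
by apply: ler_pM => //; rewrite mulr_ge0 // ?exprn_ge0.
Qed.

Lemma const_over_linear (C eps : R) : 0 < eps ->
  exists U, forall u : nat, (U <= u)%N -> C <= eps * u%:R.
Proof.
move=> e0; exists (Num.bound `|C / eps|) => u hu.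
rewrite mulrC -ler_pdivrMr //; apply: (le_trans (ler_norm _)).
by apply: (le_trans (ltW (archi_boundP (normr_ge0 _)))); rewrite ?ler_nat.
Qed.

Lemma poly_geom_small (E : nat) (s C eps : R) : 0 <= s -> s < 1 -> 0 <= C -> 0 < eps ->
  exists U, forall u : nat, (U <= u)%N -> C * (u%:R ^+ E * s ^+ u) <= eps.
Proof.
move=> s0 s1 C0 e0; have [B B0 hB] := poly_geom_bounded E.+1 s0 s1.
have [U hU] := const_over_linear (C * B) e0; exists (maxn U 1) => u.
rewrite geq_max => /andP[uU u1]; have up : 0 < u%:R :> R by rewrite ltr0n.
rewrite -(ler_pM2r up); apply: (le_trans _ (hU u uU)); rewrite -mulrA.
by apply: ler_wpM2l => //; rewrite mulrAC -exprSr.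
Qed.

Lemma sixth_root n : exists u : nat, (u ^ 6 <= n < u.+1 ^ 6)%N.
Proof.
elim: n => [|n [u /andP[u1 u2]]]; first by exists 0%N.
have [h|h] := leqP (u.+1 ^ 6) n.+1; last by exists u; rewrite h leqW.
by exists u.+1; rewrite h; apply: leq_ltn_trans u2 _; rewrite ltn_exp2r.
Qed.

(** [Z] gains at most a factor [a] per level and [Y] loses at most a factor [K], as [g] is at least
    1; hence [Z d] is at most [2 * e0 * (a * K) ^ d] times [Y d]. The true gain [g] is used only
    between the levels [d] and [d + 1], which suffices because [e0] will be exponentially small. *)
Lemma growth_chain (d : nat) (X Y Z : nat -> R) (Bad a K b e0 g : R) :
  (forall k, 0 <= Y k) -> (forall k, 0 <= Z k) -> (forall k, X k = Y k + Z k) ->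
  Z 0%N <= e0 * X 0%N -> 0 <= e0 <= 1 / 2%:R -> 0 <= a -> 0 <= K -> 0 <= b -> 1 <= g ->
  (forall k, Z k.+1 <= Z k * a) -> (forall k, (k <= d)%N -> Y k * g <= Y k.+1 * K) ->
  Bad <= Y d * b + Z d * a ->
  g * Bad <= X d.+1 * (K * (b + 2%:R * e0 * (a * K) ^+ d * a)).
Proof.
move=> Y0 R0 XE hR0 /andP[e00 e01] a0 K0 b0 g1 hR hY hB.
have R2 : Z 0%N <= 2%:R * e0 * Y 0%N.
  rewrite XE in hR0; have := ler_wpM2r (R0 0%N) e01; lra.
have Rk k : Z k <= a ^+ k * Z 0%N.
  elim: k => [|k IH]; first by rewrite expr0 mul1r.
  by apply: (le_trans (hR k)); rewrite exprSr mulrAC; apply: ler_wpM2r.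
have Yk k : (k <= d)%N -> Y 0%N <= K ^+ k * Y k.
  elim: k => [_|k IH kd]; first by rewrite expr0 mul1r.
  apply: (le_trans (IH (ltnW kd))); rewrite exprSr -mulrA; apply: ler_wpM2l; first exact: exprn_ge0.
  rewrite [K * _]mulrC; apply: le_trans (hY k (ltnW kd)).
  by rewrite -[X in X <= _]mulr1; apply: ler_wpM2l.
have Rd : Z d <= 2%:R * e0 * (a * K) ^+ d * Y d.
  apply: (le_trans (Rk d)); have -> : 2%:R * e0 * (a * K) ^+ d * Y d = a ^+ d * (2%:R * e0 * (K ^+ d * Y d)).
    by rewrite exprMn; ring.
  apply: ler_wpM2l; first exact: exprn_ge0.
  apply: (le_trans R2); apply: ler_wpM2l; [by rewrite mulr_ge0|exact: Yk].
set w := 2%:R * e0 * (a * K) ^+ d in Rd *.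
have w0 : 0 <= w by rewrite /w mulr_ge0 ?exprn_ge0 ?mulr_ge0.
have g0 : 0 <= g by apply: le_trans g1.
have B1 : Bad <= Y d * (b + w * a).
  apply: (le_trans hB); rewrite mulrDr; apply: lerD => //.
  by rewrite mulrCA mulrA; apply: ler_wpM2r.
have c0 : 0 <= b + w * a by rewrite addr_ge0 // mulr_ge0.
apply: (@le_trans _ _ (g * (Y d * (b + w * a)))); first exact: ler_wpM2l.
rewrite mulrA [g * _]mulrC; apply: (@le_trans _ _ (Y d.+1 * K * (b + w * a))).
  by apply: ler_wpM2r => //; apply: hY.
rewrite -mulrA; apply: ler_wpM2r; first by rewrite mulr_ge0.
by rewrite XE lerDl.
Qed.

(* Used to hide large constants from conversion. *)
Lemma abstract_ge0 (a : R) : 0 <= a -> exists2 b : R, 0 <= b & b = a.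
Proof. by exists a. Qed.

Variables (q d : nat) (bip : bool) (eps : R).
Hypotheses (q3 : (2 < q)%N) (eps0 : 0 < eps).

Let th : R := q%:R ^+ 3 / (q%:R ^+ 3 + 1).
Let y : R := 1 + (q%:R ^+ 2)^-1.
Let Q : R := q%:R.

Let Q3 : 3%:R <= Q. Proof. by rewrite /Q ler_nat. Qed.
Let Q1 : 1 <= Q. Proof. by rewrite /Q ler1n (ltn_trans _ q3). Qed.
Let Q0 : 0 < Q. Proof. exact: lt_le_trans Q1. Qed.

Lemma th_bounds : [/\ 1 / 2%:R <= th, 0 <= th & th < 1].
Proof.
have c1 : 1 <= Q ^+ 3 by rewrite exprn_ege1.
have p0 : 0 < Q ^+ 3 + 1 by rewrite addr_gt0 // exprn_gt0.
have h : 1 / 2%:R <= th by rewrite /th -/Q ler_pdivlMr //; lra.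
by split=> //; [apply: le_trans h; rewrite divr_ge0|rewrite /th -/Q ltr_pdivrMr // mul1r ltrDl].
Qed.

(* As [q ^ 3 + 1 = (q + 1) * (q ^ 2 - q + 1)], this is [bernoulli_inv] at [y]. *)
Lemma y_bounds : 1 <= y /\ y ^+ q.-1 <= th * (1 + q%:R * (y - 1)).
Proof.
have q2 : 0 < Q ^+ 2 by rewrite exprn_gt0.
have y1 : 1 <= y by rewrite /y lerDl invr_ge0 ltW.
split=> //; have := bernoulli_inv q.-1 (le_trans ler01 y1).
have -> : (q.-1)%:R = Q - 1 by rewrite /Q -subn1 natrB // (ltn_trans _ q3).
rewrite /y -/Q; set z := (Q ^+ 2)^-1.
have d0 : 0 < Q ^+ 2 - Q + 1.
  have := mulr_ge0 (ltW Q0) (ltW Q0); rewrite -expr2; have := Q3; nra.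
have -> : 1 + (Q - 1) * (1 - (1 + z)) = (Q ^+ 2 - Q + 1) / Q ^+ 2.
  by rewrite /z; field; rewrite gt_eqF.
have -> : th * (1 + Q * (1 + z - 1)) = ((Q ^+ 2 - Q + 1) / Q ^+ 2)^-1.
  rewrite /th -/Q /z; field.
  by rewrite !gt_eqF // addr_gt0 // exprn_gt0.
by move=> h; rewrite -[X in _ <= X]mul1r ler_pdivlMr // divr_gt0.
Qed.

(* Scales: [u ^ 6 ~ n], height below [2 * u ^ 4], components of size at most
   [2 + 2 * u]; the density of bad graphs is then of order [u ^ 5 / n = 1 / u]. *)
Lemma bad_small : exists N0, forall n, (N0 <= n)%N ->
  #|@badset q n bip d.+1|%:R <= eps * #|@Xset q n bip d.+1|%:R.
Proof.
have [th2 th0 th1] := th_bounds; have [y1 hy] := y_bounds.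
have yq0 : 0 <= y ^+ q.-1 by rewrite exprn_ge0 // (le_trans _ y1).
(* Origin of the constants: [n < (u + 1) ^ 6] is at most [64 * u ^ 6], so [c * u ^ 12] bounds
   [n ^ 2]; [C1 * u ^ 4] is the number [K] of nonbridges, [k2 * u * n] bounds [b], [C3 * n ^ 2]
   collects the prefactors of [nice_trees], and [C5 * u ^ 12] bounds [a]. *)
have [c c0 cE] := @abstract_ge0 (64%:R ^+ 2) (exprn_ge0 2 (ler0n _ _)).
have [q1 q10 q1E] := @abstract_ge0 (q.+1)%:R (ler0n _ _).
have [C1 C10 C1E] := @abstract_ge0 (16 * d.+1 * q.+1)%:R (ler0n _ _).
have [k2 k20 k2E] := @abstract_ge0 (8 * q.+1 ^ 2 * 3 ^ d)%:R (ler0n _ _).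
have [C3 C30 C3E] : exists2 C3 : R, 0 <= C3 & C3 = Q * (1 + 2%:R * y ^+ q.-1).
  apply: abstract_ge0; apply: mulr_ge0; first exact: ltW.
  by apply: addr_ge0 => //; apply: mulr_ge0.
have [C5 C50 C5E] : exists2 C5 : R, 0 <= C5 & C5 = 4%:R * c * q1.
  by apply: abstract_ge0; apply: mulr_ge0 => //; apply: mulr_ge0.
have C40 : 0 <= c * C3 by apply: mulr_ge0.
pose C2 := C1 * k2; pose C6 := 8%:R * C1 * q1 * (c * C3) * (C5 * C1) ^+ d.
have C60 : 0 <= C6.
  apply: mulr_ge0; last by apply: exprn_ge0; apply: mulr_ge0.
  by apply: mulr_ge0 => //; apply: mulr_ge0 => //; apply: mulr_ge0.
have e4 : 0 < eps / 4%:R by rewrite divr_gt0.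
(* [U1] settles the ordinary trees, with density of order [u ^ 5 / n]. [U2] settles the exceptional
   ones: [K * e0] has the polynomial factor [u ^ 16], and so has [a * K] at each of [d] levels. [U3]
   makes [e0] at most one half. *)
have [U1 h1] := const_over_linear C2 e4.
have [U2 h2] := poly_geom_small (16 + 16 * d) th0 th1 C60 e4.
have [U3 h3] := poly_geom_small 12 th0 th1 C40 (divr_gt0 ltr01 (ltr0Sn _ 1)).
exists ((U1 + U2 + U3 + 256 + 4 * d) ^ 6)%N => n hn.
have [u /andP[un nu]] := sixth_root n.
have : (U1 + U2 + U3 + 256 + 4 * d <= u)%N.
  by rewrite -ltnS -(ltn_exp2r _ _ (isT : (0 < 6)%N)); apply: leq_ltn_trans nu.
move=> hu; have {}h1 := h1 u ltac:(move: hu; clear; lia); have {}h2 := h2 u ltac:(move: hu; clear; lia).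
have {}h3 := h3 u ltac:(move: hu; clear; lia); have u256 : (256 <= u)%N by move: hu; clear; lia.
have ud : (4 * d <= u)%N by move: hu; clear; lia.
have u0 : (0 < u)%N by apply: leq_trans u256.
have uun : (u <= n)%N by apply: leq_trans un; rewrite -[X in (X <= _)%N]expn1 leq_pexp2l.
have n0 : (0 < n)%N by apply: leq_trans uun.
have n2 : (1 < n)%N by apply: leq_trans uun; apply: leq_trans u256.
clear hn hu U1 U2 U3.
pose v : R := u%:R; pose M : R := n%:R.
have v0 : 0 < v by rewrite ltr0n.
have v1 : 1 <= v by rewrite ler1n.
have M0 : 0 < M by rewrite ltr0n.
have M1 : 1 <= M by rewrite ler1n.
have Mlow : v ^+ 6 <= M by rewrite -natrX ler_nat.
have Mup : M <= 64%:R * v ^+ 6.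
  rewrite -natrX -natrM ler_nat; apply: (leq_trans (ltnW nu)).
  rewrite -[64%N]/(2 ^ 6)%N -expnMn leq_exp2r // mul2n -addnn -addn1 leq_add2l //.
(* After [u ^ 4] forced insertions at least [(q - 1) * u ^ 4] slots are open, against [q * n] of
   size at most [64 * q * u ^ 6]: so [1 - rho] may be of order [u ^ -2]. The value 256 leaves room
   for the estimates [rho >= 1 / 2] and [q - 1 >= q / 2]. *)
pose rho : R := 1 - (256%:R * v ^+ 2)^-1.
have v2 : 1 <= v ^+ 2 by rewrite exprn_ege1.
have p0 : 0 < 256%:R * v ^+ 2 by rewrite mulr_gt0 // exprn_gt0.
have ri : (256%:R * v ^+ 2)^-1 <= 1 / 2%:R.
  by rewrite div1r lef_pV2 ?posrE //; lra.
have rho1 : rho <= 1 by rewrite /rho gerDl oppr_le0 invr_ge0 ltW.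
have rho2 : 1 / 2%:R <= rho by rewrite /rho; lra.
have rho0 : 0 <= rho by apply: le_trans rho2; rewrite divr_ge0.
have hrho : (1 - rho) * (q * n.-1)%:R <= rho * (q + q.-1 * u ^ 4)%:R.
  have -> : 1 - rho = (256%:R * v ^+ 2)^-1 by rewrite /rho; ring.
  apply: (@le_trans _ _ (Q * v ^+ 4 / 4%:R)).
    rewrite mulrC ler_pdivrMr // natrM -/Q.
    have -> : Q * v ^+ 4 / 4%:R * (256%:R * v ^+ 2) = Q * (64%:R * v ^+ 6) by field.
    apply: ler_wpM2l; first exact: ltW.
    by apply: le_trans Mup; rewrite ler_nat leq_pred.
  rewrite natrD natrM natrX -/v -/Q.
  have -> : (q.-1)%:R = Q - 1 by rewrite /Q -subn1 natrB // (ltn_trans _ q3).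
  have v4 : 0 <= v ^+ 4 by rewrite exprn_ge0 // ltW.
  apply: (@le_trans _ _ (1 / 2%:R * ((Q - 1) * v ^+ 4))).
    rewrite -subr_ge0 (_ : _ - _ = v ^+ 4 * ((Q - 2%:R) / 4%:R)); last by field.
    by rewrite mulr_ge0 //; have := Q3; lra.
  have h0 : 0 <= (Q - 1) * v ^+ 4 by rewrite mulr_ge0 // subr_ge0.
  by apply: ler_pM => //; [rewrite divr_ge0|rewrite lerDr ltW].
(* A block of [256 * u ^ 2] factors at least halves, and as [u] is at least 256 there are [u] such
   blocks among the [u ^ 4] factors. *)
have rhoJ : rho ^+ (u ^ 4) <= th ^+ u.
  have b1 := bernoulli_inv (256 * u ^ 2) rho0.
  have b2 : rho ^+ (256 * u ^ 2) <= 1 / 2%:R.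
    move: b1; rewrite natrM natrX -/v.
    have -> : 256%:R * v ^+ 2 * (1 - rho) = 1 by rewrite /rho; field; rewrite gt_eqF.
    by move=> b1; rewrite ler_pdivlMr.
  apply: (@le_trans _ _ (rho ^+ (256 * u ^ 2 * u))).
    apply: ler_wiXn2l => //; rewrite -mulnA -expnSr [in X in (_ <= X)%N](expnS u 3).
    by rewrite leq_mul2r u256 orbT.
  rewrite exprM; apply: lerXn2r; rewrite ?nnegrE ?exprn_ge0 //.
  exact: le_trans b2 th2.
have hIJ : ((2 * u ^ 4).-1.+1 = u ^ 4 + u ^ 4)%N.
  by rewrite prednK ?mul2n ?addnn // double_gt0 expn_gt0 u0.
have [Y0 [sY layY clsY cY]] := @nice_trees q n bip q3 n0 R _ u _ _ rho th y hIJ rho0 rho1 hrho th0 y1 hy.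
set h := (2 * u ^ 4).-1 in layY.
pose a : R := (2 * n * q.+1 * (2 * n))%:R.
pose e0 : R := c * C3 * (v ^+ 12 * th ^+ u).
pose K : R := C1 * v ^+ 4.
pose b : R := (2 * n * q.+1 ^ 2 * (3 ^ d * (2 + 2 * u)))%:R.
pose g : R := (n * n.-1)%:R.
have thu : 0 <= th ^+ u by rewrite exprn_ge0.
have e00 : 0 <= e0 by rewrite /e0 mulr_ge0 // mulr_ge0 // exprn_ge0 // ltW.
have M2 : M ^+ 2 <= c * v ^+ 12.
  have -> : c * v ^+ 12 = (64%:R * v ^+ 6) ^+ 2 by rewrite cE; ring.
  by apply: lerXn2r; rewrite ?nnegrE ?mulr_ge0 ?exprn_ge0 // ltW.
have cY' : #|@Xset q n bip 0 :\: Y0|%:R <= e0 * #|@Xset q n bip 0|%:R.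
  apply: (le_trans cY); apply: ler_wpM2r => //.
  apply: (@le_trans _ _ (C3 * M ^+ 2 * th ^+ u)); last first.
    have -> : e0 = C3 * (c * v ^+ 12) * th ^+ u by rewrite /e0; ring.
    by apply: ler_wpM2r => //; apply: ler_wpM2l.
  rewrite !natrM -/M -/Q.
  have -> : C3 * M ^+ 2 * th ^+ u = (Q * (M * th ^+ u) + 2%:R * M * Q * (th ^+ u * y ^+ q.-1)) * M.
    by rewrite C3E; ring.
  apply: ler_wpM2r; first exact: ltW.
  rewrite lerD2r; apply: ler_wpM2l; first exact: ltW.
  by apply: (le_trans rhoJ); rewrite -[X in X <= _]mul1r; apply: ler_wpM2r.
have XY k : Yset bip Y0 k \subset @Xset q n bip k by apply: Y_X.
pose X k : R := #|@Xset q n bip k|%:R.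
pose Y k : R := #|Yset bip Y0 k|%:R.
pose Z k : R := #|@Xset q n bip k :\: Yset bip Y0 k|%:R.
have K0 : 0 <= K by rewrite /K mulr_ge0 // exprn_ge0 // ltW.
have main : g * #|@badset q n bip d.+1|%:R <= X d.+1 * (K * (b + 2%:R * e0 * (a * K) ^+ d * a)).
  apply: (@growth_chain d X Y Z) => //.
  - move=> k; rewrite /X /Y /Z -natrD -(cardsID (Yset bip Y0 k) (@Xset q n bip k)).
    by rewrite (setIidPr (XY k)).
  - by rewrite e00; apply: (le_trans _ h3); rewrite /e0.
  - by rewrite /g ler1n muln_gt0 n0 -subn1 subn_gt0.
  - by move=> k; rewrite /Z /a -natrM ler_nat; apply: XY_growth.
  - move=> k kd; have -> : K = (4 * d.+1 * (2 * h.+1 * q.+1))%:R.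
      rewrite /K C1E -[v ^+ 4]natrX -natrM /h hIJ; congr (_%:R).
      by move: (u ^ 4)%N d.+1 q.+1; clear; lia.
    rewrite /Y /g -!natrM ler_nat; apply: leq_trans (Y_growth q3 n0 sY layY (h := h) _) _.
      by apply: leq_trans uun; apply: leq_trans ud; rewrite leq_mul2l kd.
    by rewrite leq_mul2l; apply/orP; right; rewrite leq_mul2r; apply/orP; right; rewrite leq_mul2l ltnS kd.
  by rewrite /Y /Z /a /b -!natrM -natrD ler_nat; apply: card_bad.
have g0 : 0 < g by rewrite /g ltr0n muln_gt0 n0 -subn1 subn_gt0.
have g2 : M ^+ 2 / 2%:R <= g.
  rewrite ler_pdivrMr // /g /M -natrX -natrM ler_nat expnS expn1 -mulnA leq_mul2l.
  by apply/orP; right; move: n2; clear; lia.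
rewrite -(ler_pM2l g0); apply: (le_trans main).
have -> : g * (eps * #|@Xset q n bip d.+1|%:R) = X d.+1 * (eps * g) by rewrite /X; ring.
apply: ler_wpM2l => //.
apply: (@le_trans _ _ (eps / 4%:R * M ^+ 2 + eps / 4%:R * M ^+ 2)); last first.
  apply: (@le_trans _ _ (eps * (M ^+ 2 / 2%:R))); last by apply: ler_wpM2l; [apply: ltW|apply: g2].
  by rewrite (_ : _ + _ = eps * (M ^+ 2 / 2%:R)) //; field.
rewrite mulrDr; apply: lerD.
  apply: (@le_trans _ _ (C2 * v ^+ 5 * M)).
    have -> : C2 * v ^+ 5 * M = K * (k2 * v * M) by rewrite /C2 /K; ring.
    apply: ler_wpM2l => //; rewrite /b k2E /v /M -!natrM ler_nat.
    by move: (q.+1 ^ 2)%N (3 ^ d)%N u0; clear; nia.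
  apply: (@le_trans _ _ (eps / 4%:R * v ^+ 6 * M)).
    apply: ler_wpM2r; first exact: ltW.
    by rewrite (exprS v 5) mulrA; apply: ler_wpM2r => //; rewrite exprn_ge0 // ltW.
  by rewrite expr2 mulrA; apply: ler_wpM2r; [apply: ltW|apply: ler_wpM2l; [apply: ltW|]].
have aE : a = 4%:R * q1 * M ^+ 2 by rewrite q1E /a !natrM /M; ring.
have -> : K * (2%:R * e0 * (a * K) ^+ d * a) = 8%:R * K * q1 * e0 * (a * K) ^+ d * M ^+ 2.
  by rewrite {2}aE; ring.
apply: ler_wpM2r; first by rewrite exprn_ge0 // ltW.
apply: le_trans h2; rewrite -/v.
have -> : C6 * (v ^+ (16 + 16 * d) * th ^+ u) =
    8%:R * K * q1 * e0 * (C5 * v ^+ 12 * K) ^+ d.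
  have -> : v ^+ (16 + 16 * d) = v ^+ 16 * (v ^+ 12 * v ^+ 4) ^+ d by rewrite -exprD exprD exprM.
  by rewrite /C6 /e0 /K !exprMn; ring.
apply: ler_wpM2l; first by rewrite !mulr_ge0.
have a0 : 0 <= a by [].
apply: lerXn2r; rewrite ?nnegrE ?mulr_ge0 ?exprn_ge0 ?(ltW v0) //.
apply: ler_wpM2r => //; rewrite aE C5E.
have -> : 4%:R * c * q1 * v ^+ 12 = 4%:R * q1 * (c * v ^+ 12) by ring.
by apply: ler_wpM2l => //; apply: mulr_ge0.
Qed.

End Estimates.

Theorem mainTheorem16 (q delta : nat) (hq : (3 <= q)%N) (hdelta : (1 <= delta)%N)
  (bip : bool) (eps : rat) (heps : 0 < eps) :
  exists N0 : nat, forall n : nat, (N0 <= n)%N ->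
    exists T : {set rooted_graph q n},
      [/\ T \subset Gset q n delta bip,
          (forall G, G \in T -> good_graph G) &
          (1 - eps) * (#|Gset q n delta bip|)%:R <= (#|T|)%:R].
Proof.
case: delta hdelta => // d _; have [N0 hN] := @bad_small rat q d bip eps hq heps.
exists N0 => n hn.
pose X := @Xset q n bip d.+1; pose B := @badset q n bip d.+1.
have sB : B \subset X by apply/subsetP=> G; rewrite inE => /andP[].
(* Every vertex is an admissible origin of the root edge, so proportions among rooted graphs are
   those among unrooted ones. *)
have GE : Gset q n d.+1 bip = setX X setT.
  by apply/setP=> -[G r]; rewrite in_setX in_setT andbT [LHS]inE [RHS]inE.
exists (setX (X :\: B) setT); split.
- by rewrite GE; apply/subsetP=> -[G r]; rewrite !in_setX in_setD => /andP[/andP[_ ->]].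
- move=> [G r]; rewrite in_setX in_setD => /andP[/andP[nB GX] _].
  by have [] := good_notbad hq GX nB.
rewrite GE !cardsX !natrM mulrA; apply: ler_wpM2r => //.
have := hN n hn; rewrite -/X -/B => hB.
rewrite cardsD (setIidPr sB) natrB ?subset_leq_card // mulrBl mul1r lerD2l lerN2; exact: hB.
Qed.
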